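(* Let $W\subset GL(V)$ be a finite complex reflection group and let $k=\{k_{H,i}\}$ be a $W$-invariant collection of non-negative integers with $k_{H,0}=0$. Then $\mathbb{C}[V_{\mathrm{reg}}]\otimes\mathbb{C}W$, with the differential action of the rational Cherednik algebra $H_k$, contains a unique $H_k$-submodule $\mathbf{Q}_k$ such that $\mathbf{Q}_k$ is finitely generated over $\mathbb{C}[V]\subset H_k$ and $$e\,\mathbf{Q}_k=e\,(Q_k\otimes 1)\quad\text{in } \mathbb{C}[V_{\mathrm{reg}}]\otimes\mathbb{C}W,$$ where $Q_k\subseteq\mathbb{C}[V]$ is the space of $k$-quasi-invariants of $W$ and $e=|W|^{-1}\sum_{w\in W}w$.
   Context: Let $V$ be a finite-dimensional complex vector space and $W\subset GL(V)$ a finite group generated by complex reflections (elements acting as the identity on some hyperplane). $\mathcal{A}$ is the set of reflection hyperplanes of $W$; for $H\in\mathcal{A}$, $W_H$ is the pointwise stabilizer of $H$ in $W$, a cyclic group of order $n_H\ge 2$, and $\alpha_H\in V^*$ is a linear form with kernel $H$. $W$ acts on functions by $(wf)(x)=f(w^{-1}x)$. With $\det$ the determinant character of $W$ on $V$, put $e_{H,i}=\frac{1}{n_H}\sum_{w\in W_H}(\det w)^{-i}\,w\in\mathbb{C}W$, $i$ taken modulo $n_H$. $W$-invariance of $k$ means $k_{H,i}=k_{H',i}$ if $H,H'$ are in the same $W$-orbit. $Q_k$ is the space of all $f\in\mathbb{C}[V]$ with $e_{H,-i}(f)\equiv 0 \bmod \langle\alpha_H\rangle^{n_Hk_{H,i}}$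 for all $H\in\mathcal{A}$, $i=0,\dots,n_H-1$, with $\langle\alpha_H\rangle\subset\mathbb{C}[V]$ the ideal generated by $\alpha_H$. $V_{\mathrm{reg}}=V\setminus\bigcup_{H\in\mathcal{A}}H$, and $\mathcal{D}W=\mathcal{D}(V_{\mathrm{reg}})*W$ is the crossed product of the ring of regular differential operators on $V_{\mathrm{reg}}$ with $W$. The Dunkl operators are $T_\xi=\partial_\xi-\sum_{H\in\mathcal{A}}\frac{\alpha_H(\xi)}{\alpha_H}\sum_{i=0}^{n_H-1}n_Hk_{H,i}e_{H,i}\in\mathcal{D}W$, $\xi\in V$. The rational Cherednik algebra $H_k$ is the subalgebra of $\mathcal{D}W$ generated by $\mathbb{C}[V]$, $\mathbb{C}W$ and all $T_\xi$. $\mathcal{D}W$ acts on $\mathbb{C}[V_{\mathrm{reg}}]\otimes\mathbb{C}W$ by $g(f\otimes u)=gf\otimes u$ for $g\in\mathbb{C}[V_{\mathrm{reg}}]$, $\partial_\xi(f\otimes u)=\partial_\xi f\otimes u$, $w(f\otimes u)=wf\otimes wu$ for $w\in W$; the restriction of this action to $H_k$ is the differential action. *)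

(* Defs.v *)
From HB Require Import structures.
From mathcomp Require Import all_boot all_order all_algebra all_fingroup.
From mathcomp Require Import generic_quotient fraction complex mpoly.
From mathcomp Require Import boolp classical_sets reals.
From mathcomp Require Import ring.

Set Implicit Arguments.
Unset Strict Implicit.
Unset Printing Implicit Defensive.

Import GRing.Theory.
Local Open Scope ring_scope.
Local Open Scope quotient_scope.

Section FunctionsOnV.
Variables (C : fieldType) (V : vectType C).

(* C[V], in the coordinates of the basis vbasis {:V}; the variable 'X_i is the
   i-th coordinate function (see evalV). *)
Definition polyV := {mpoly C[\dim {:V}]}.

(* C(V), the field in which C[V_reg] is realized as a localization of C[V]. *)
Definition ratV := {fraction polyV}.

Definition evalV (p : polyV) (x : V) : C :=
  p.@[fun i => coord (vbasis {:V}) i x].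

(* The element of C[V] given by a linear form a; see evalV_linpoly. *)
Definition linpoly (a : V -> C) : polyV :=
  \sum_(i < \dim {:V}) a (vbasis {:V})`_i *: 'X_i.

Definition dpoly (xi : V) (p : polyV) : polyV :=
  \sum_(i < \dim {:V}) coord (vbasis {:V}) i xi *: p^`M(i).

(* The quotient rule, applied to the representative \n_ / \d_ of the fraction;
   the result does not depend on it (dratE). *)
Definition drat (xi : V) (f : ratV) : ratV :=
  let p := \n_(repr f) in let q := \d_(repr f) in
  tofrac (dpoly xi p * q - p * dpoly xi q) / tofrac q ^+ 2.

End FunctionsOnV.

Section ReflectionGroup.
Variables (C : fieldType) (V : vectType C) (W : finGroupType).
Variable rho : W -> 'End(V).

Definition is_reflection (w : W) : bool :=
  (\dim (fixedSpace (rho w))).+1 == \dim {:V}.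

Definition hyperplanes : seq {vspace V} :=
  undup [seq fixedSpace (rho w) | w <- enum W & is_reflection w].

Definition pstab (H : {vspace V}) : {set W} :=
  [set w | (H <= fixedSpace (rho w))%VS].

Definition ordH (H : {vspace V}) : nat := #|pstab H|.

Definition detV (w : W) : C :=
  \det (passmx.mxof (vbasis {:V}) (vbasis {:V}) (rho w)).

(* An element a of the group algebra CW is the function of its coefficients,
   standing for \sum_w (a w) w. *)
Definition idemH (H : {vspace V}) (i : int) : {ffun W -> C} :=
  [ffun w => if w \in pstab H then (ordH H)%:R^-1 * detV w ^ (- i) else 0].

Definition idemW : {ffun W -> C} := [ffun _ => #|W|%:R^-1].

(* (w p)(x) = p (w^-1 x); see evalV_actV. *)
Definition actV (w : W) (p : polyV V) : polyV V :=
  p \mPo [tuple linpoly (fun v => coord (vbasis {:V}) i (rho w^-1%g v))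
         | i < \dim {:V}].

Definition actF (w : W) (f : ratV V) : ratV V :=
  tofrac (actV w \n_(repr f)) / tofrac (actV w \d_(repr f)).

Definition gactV (a : {ffun W -> C}) (p : polyV V) : polyV V :=
  \sum_w a w *: actV w p.

Variable alpha : {vspace V} -> 'Hom(V, C^o).

Definition quasi_invariant (k : {vspace V} -> nat -> nat) : set (polyV V) :=
  [set f | forall H, H \in hyperplanes -> forall i, (i < ordH H)%N ->
     exists g : polyV V,
       gactV (idemH H (- i%:Z)) f = linpoly (alpha H) ^+ (ordH H * k H i) * g].

(* C[V_reg]: V_reg is the principal open subset where the product of all the
   alpha_H does not vanish. *)
Definition regV : set (ratV V) :=
  [set f | exists (p : polyV V) (m : nat),
     f = tofrac p / tofrac (\prod_(H <- hyperplanes) linpoly (alpha H)) ^+ m].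

(* D(V_reg), inside the endomorphisms of C(V): V_reg is open in the affine
   space V, so its differential operators are generated by the regular
   functions and the constant vector fields. *)
Inductive diffop : (ratV V -> ratV V) -> Prop :=
| diffop_fun g : regV g -> diffop (fun f => g * f)
| diffop_der xi : diffop (drat xi)
| diffop_add P Q : diffop P -> diffop Q -> diffop (fun f => P f + Q f)
| diffop_comp P Q : diffop P -> diffop Q -> diffop (fun f => P (Q f)).

(* A family a of operators stands for \sum_w (a w) w in the crossed product of
   the operators on C(V) with W, where w P = (w P w^-1) w for an operator P;
   DW consists of the families with values in D(V_reg). *)
Definition crossed := W -> ratV V -> ratV V.

Definition DW : set crossed := [set a | forall w, diffop (a w)].

Definition cadd (a b : crossed) : crossed := fun w f => a w f + b w f.

Definition cmul (a b : crossed) : crossed := fun u f =>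
  \sum_w a w (actF w (b (w^-1 * u)%g (actF w^-1%g f))).

Definition cop (P : ratV V -> ratV V) : crossed :=
  fun w f => if w == 1%g then P f else 0.

Definition cpoly (p : polyV V) : crossed := cop (fun f => tofrac p * f).

Definition cgrp (a : {ffun W -> C}) : crossed :=
  fun w f => tofrac (a w)%:MP * f.

Definition dunkl (k : {vspace V} -> nat -> nat) (xi : V) : crossed :=
  fun w f => cop (drat xi) w f -
    \sum_(H <- hyperplanes)
      tofrac (alpha H xi)%:MP / tofrac (linpoly (alpha H)) *
      \sum_(i < ordH H) cgrp (idemH H i) w f *+ (ordH H * k H i).

(* The subalgebra of DW (cherednik_DW) generated by C[V], CW and the Dunkl
   operators; it contains the scalars, as constant polynomials. *)
Inductive cherednik (k : {vspace V} -> nat -> nat) : crossed -> Prop :=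
| cherednik_poly p : cherednik k (cpoly p)
| cherednik_grp a : cherednik k (cgrp a)
| cherednik_dunkl xi : cherednik k (dunkl k xi)
| cherednik_add a b :
    cherednik k a -> cherednik k b -> cherednik k (cadd a b)
| cherednik_mul a b :
    cherednik k a -> cherednik k b -> cherednik k (cmul a b).

(* An element phi of C[V_reg] (x) CW is the function of its coefficients,
   standing for \sum_u (phi u) (x) u. *)
Definition regW : set {ffun W -> ratV V} := [set phi | forall u, regV (phi u)].

Definition tens (f : ratV V) (u : W) : {ffun W -> ratV V} :=
  [ffun v => if v == u then f else 0].

(* (P w) (f (x) u) = P (w f) (x) (w u); this is an action of DW on regW
   (dactM, dact_regW). *)
Definition dact (a : crossed) (phi : {ffun W -> ratV V}) :
    {ffun W -> ratV V} :=
  [ffun u => \sum_w a w (actF w (phi (w^-1 * u)%g))].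

Definition is_submodule (k : {vspace V} -> nat -> nat)
    (Q : set {ffun W -> ratV V}) : Prop :=
  [/\ (Q `<=` regW)%classic, Q 0,
      forall phi psi, Q phi -> Q psi -> Q (phi + psi) &
      forall a phi, cherednik k a -> Q phi -> Q (dact a phi)].

Definition fin_gen (Q : set {ffun W -> ratV V}) : Prop :=
  exists (m : nat) (q : 'I_m -> {ffun W -> ratV V}),
    (forall i, Q (q i)) /\
    forall phi, Q phi -> exists c : 'I_m -> polyV V,
      phi = \sum_(i < m) dact (cpoly (c i)) (q i).

End ReflectionGroup.

Section Facts.
Variables (C : fieldType) (V : vectType C) (W : finGroupType).
Variable rho : W -> 'End(V).

Lemma evalV_linpoly (a : 'Hom(V, C^o)) x : evalV (linpoly a) x = a x.
Proof.
rewrite /evalV /linpoly {2}(coord_vbasis (memvf x)).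
rewrite raddf_sum [RHS]linear_sum; apply: eq_bigr => i _ /=.
by rewrite mevalZ mevalXU linearZ /= mulrC.
Qed.

Lemma evalV_actV w p x : evalV (actV rho w p) x = evalV p (rho w^-1%g x).
Proof.
rewrite /evalV /actV comp_mpoly_meval; apply: meval_eq => i.
rewrite !tnth_mktuple.
by rewrite -[LHS]/(evalV _ _) /evalV /linpoly raddf_sum /=
   {2}(coord_vbasis (memvf x)) !linear_sum; apply: eq_bigr => j _;
   rewrite mevalZ mevalXU !linearZ /= mulrC.
Qed.

Lemma fracE (f : ratV V) :
  f = tofrac \n_(repr f) / tofrac \d_(repr f).
Proof.
apply: (canRL (mulfK _)); first by rewrite tofrac_eq0 denom_ratioP.
rewrite -{1}[f]reprK; unlock tofrac; rewrite -[LHS]FracField.pi_mul /=.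
apply/eqmodP; rewrite /= FracField.equivfE /FracField.mulf.
by rewrite !numden_Ratio ?mulf_neq0 ?oner_eq0 ?denom_ratioP //= !mulr1 mulrC.
Qed.

Lemma dpolyM (xi : V) (p q : polyV V) :
  dpoly xi (p * q) = dpoly xi p * q + p * dpoly xi q.
Proof.
rewrite /dpoly mulr_suml mulr_sumr -big_split /=; apply: eq_bigr => i _.
by rewrite mderivM scalerDr scalerAl -scalerAr.
Qed.

Lemma tofrac_div_eq (p q p' q' : polyV V) : q != 0 -> q' != 0 ->
  tofrac p / tofrac q = tofrac p' / tofrac q' <-> p * q' = p' * q.
Proof.
move=> q0 q'0; split.
  move/eqP; rewrite eqr_div ?tofrac_eq0 // -!tofracM tofrac_eq => /eqP.
  by [].
by move=> e; apply/eqP; rewrite eqr_div ?tofrac_eq0 // -!tofracM e.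
Qed.

Lemma dratE (xi : V) (p q : polyV V) : q != 0 ->
  drat xi (tofrac p / tofrac q) =
  tofrac (dpoly xi p * q - p * dpoly xi q) / tofrac q ^+ 2.
Proof.
move=> q0; set f := tofrac p / tofrac q.
have d0 : \d_(repr f) != 0 := denom_ratioP _.
have /(tofrac_div_eq _ _ q0 d0) e := fracE f.
rewrite /drat; set n := \n_(repr f) in e *; set d := \d_(repr f) in d0 e *.
rewrite -!tofracXn; apply/tofrac_div_eq; rewrite ?expf_neq0 //.
have := congr1 (dpoly xi) e; rewrite !dpolyM => e'.
transitivity ((dpoly xi n * q + n * dpoly xi q) * (d * q) - (n * q) *
    (dpoly xi d * q + dpoly xi q * d)); first by ring.
by rewrite -e' -{1}e; ring.
Qed.

Hypothesis rho1 : rho 1%g = \1%VF.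
Hypothesis rhoM : forall u w, rho (u * w)%g = (rho u \o rho w)%VF.

HB.instance Definition _ w := GRing.RMorphism.copy (actV rho w) (actV rho w).

Lemma actVX w i : actV rho w 'X_i =
  linpoly (fun v => coord (vbasis {:V}) i (rho w^-1%g v)).
Proof. by rewrite /actV comp_mpolyXU -tnth_nth tnth_mktuple. Qed.

Lemma actV_linpoly w (a : 'Hom(V, C^o)) :
  actV rho w (linpoly a) = linpoly (a \o rho w^-1%g)%VF.
Proof.
rewrite {1}/linpoly /actV raddf_sum /=.
under eq_bigr => i _ do rewrite comp_mpolyZ -/(actV rho w _) actVX /linpoly scaler_sumr.
rewrite exchange_big /=; apply: eq_bigr => j _.
under eq_bigr => i _ do rewrite scalerA.
rewrite -scaler_suml comp_lfunE; congr (_ *: _).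
rewrite {2}(coord_vbasis (memvf (rho w^-1%g (vbasis fullv)`_j))) linear_sum.
by apply: eq_bigr => i _; rewrite linearZ /= mulrC.
Qed.

Lemma polyV_ind (P : polyV V -> Prop) :
  (forall c, P c%:MP) -> (forall i, P 'X_i) ->
  (forall p q, P p -> P q -> P (p + q)) ->
  (forall p q, P p -> P q -> P (p * q)) -> forall p, P p.
Proof.
move=> PC PX PD PM p; rewrite (mpolyE p).
apply: (big_ind P) => [||m _]; [by rewrite -mpolyC0|exact: PD|].
rewrite -mul_mpolyC mpolyXE_id; apply: (PM); first exact: PC.
apply: (big_ind P) => [||i _]; [by rewrite -mpolyC1|exact: PM|].
elim: (m i) => [|l IH]; first by rewrite expr0 -mpolyC1.
by rewrite exprS; exact: PM.
Qed.

Lemma polyV_ext (f g : {rmorphism polyV V -> polyV V}) :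
  (forall c, f c%:MP = g c%:MP) -> (forall i, f 'X_i = g 'X_i) -> f =1 g.
Proof.
move=> fgC fgX; elim/polyV_ind => [//|//|p q hp hq|p q hp hq].
  by rewrite !raddfD /= hp hq.
by rewrite !rmorphM /= hp hq.
Qed.

Lemma actV1 p : actV rho 1%g p = p.
Proof.
apply: (polyV_ext (f := actV rho 1%g) (g := idfun)) => [c|i] /=.
  by rewrite /actV comp_mpolyC.
rewrite actVX /linpoly invg1 rho1.
rewrite (bigD1 i) //= big1 ?addr0 => [|j ji].
  rewrite lfunE coord_free ?eqxx ?scale1r //.
  exact: basis_free (vbasisP _).
by rewrite lfunE coord_free ?(basis_free (vbasisP _)) // (negPf ji) scale0r.
Qed.

Lemma actVM u w p : actV rho (u * w)%g p = actV rho u (actV rho w p).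
Proof.
apply: (polyV_ext (f := actV rho (u * w)%g)
   (g := actV rho u \o actV rho w)) => [c|i] /=.
  by rewrite /actV !comp_mpolyC.
have linE (x : W) : actV rho x 'X_i =
  linpoly (linfun (coord (vbasis {:V}) i : V -> C^o) \o rho x^-1%g)%VF.
  rewrite actVX /linpoly; apply: eq_bigr => j _.
  by rewrite comp_lfunE lfunE.
rewrite !linE actV_linpoly invMg rhoM.
by apply: eq_bigr => j _; rewrite !comp_lfunE.
Qed.

Lemma actVK w : cancel (actV rho w) (actV rho w^-1%g).
Proof. by move=> p; rewrite -actVM mulVg actV1. Qed.

Lemma actV_eq0 w p : (actV rho w p == 0) = (p == 0).
Proof. by rewrite -[RHS](inj_eq (can_inj (actVK w))) raddf0. Qed.

Lemma actFE w (p q : polyV V) : q != 0 ->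
  actF rho w (tofrac p / tofrac q) =
  tofrac (actV rho w p) / tofrac (actV rho w q).
Proof.
move=> q0; set f := tofrac p / tofrac q.
have d0 : \d_(repr f) != 0 := denom_ratioP _.
have /(tofrac_div_eq _ _ q0 d0) e := fracE f.
rewrite /actF; apply/tofrac_div_eq; rewrite ?actV_eq0 // -!rmorphM.
by rewrite e.
Qed.

Lemma ratVP (f : ratV V) : exists p q, q != 0 /\ f = tofrac p / tofrac q.
Proof.
by exists \n_(repr f), \d_(repr f); split; [exact: denom_ratioP|exact: fracE].
Qed.

Lemma actFp w p : actF rho w (tofrac p) = tofrac (actV rho w p).
Proof.
have := @actFE w p 1 (oner_neq0 _).
by rewrite !rmorph1 !divr1.
Qed.

Lemma actFM w f g : actF rho w (f * g) = actF rho w f * actF rho w g.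
Proof.
have [p [q [q0 ->]]] := ratVP f; have [p' [q' [q'0 ->]]] := ratVP g.
rewrite mulf_div -!tofracM !actFE ?mulf_neq0 //.
by rewrite !rmorphM mulf_div.
Qed.

Lemma actFD w f g : actF rho w (f + g) = actF rho w f + actF rho w g.
Proof.
have [p [q [q0 ->]]] := ratVP f; have [p' [q' [q'0 ->]]] := ratVP g.
rewrite addf_div ?tofrac_eq0 // -!tofracM -tofracD !actFE ?mulf_neq0 //.
rewrite addf_div ?tofrac_eq0 ?actV_eq0 // -!tofracM -tofracD.
by rewrite !rmorphD !rmorphM.
Qed.

Lemma actF1 f : actF rho 1%g f = f.
Proof. by have [p [q [q0 ->]]] := ratVP f; rewrite actFE // !actV1. Qed.

Lemma actF_mul u w f : actF rho (u * w)%g f = actF rho u (actF rho w f).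
Proof.
have [p [q [q0 ->]]] := ratVP f.
rewrite [actF rho w _]actFE // !actFE ?actV_eq0 //.
by rewrite !actVM.
Qed.

Lemma actFKV w f : actF rho w (actF rho w^-1%g f) = f.
Proof. by rewrite -actF_mul mulgV actF1. Qed.

Lemma rhoVK w : cancel (rho w^-1%g) (rho w).
Proof.
by move=> x; rewrite -comp_lfunE -rhoM mulgV rho1 lfunE.
Qed.

Lemma rhoKV w : cancel (rho w) (rho w^-1%g).
Proof. by move=> x; have := rhoVK w^-1%g x; rewrite invgK. Qed.

Lemma fixedSpace_conj w x :
  fixedSpace (rho (w * x * w^-1)%g) = (rho w @: fixedSpace (rho x))%VS.
Proof.
apply/vspaceP => v; apply/fixedSpaceP/memv_imgP => [|[u /fixedSpaceP ux ->]].
  rewrite !rhoM !comp_lfunE => e.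
  exists (rho w^-1%g v); last by rewrite rhoVK.
  by apply/fixedSpaceP; rewrite -{2}e rhoKV.
by rewrite !rhoM !comp_lfunE rhoKV ux.
Qed.

Lemma dim_rho w (H : {vspace V}) : \dim (rho w @: H) = \dim H.
Proof.
apply: limg_dim_eq; apply/eqP; rewrite -subv0; apply/subvP => v.
rewrite memv_cap memv_ker => /andP[_ /eqP e].
by rewrite -[v](rhoKV w) e linear0 mem0v.
Qed.

Lemma hyperplanesP H :
  reflect (exists2 w, is_reflection rho w & H = fixedSpace (rho w))
          (H \in hyperplanes rho).
Proof.
rewrite /hyperplanes mem_undup; apply: (iffP mapP) => [[w]|[w rw ->]].
  by rewrite mem_filter => /andP[rw _] ->; exists w.
by exists w => //; rewrite mem_filter rw mem_enum.
Qed.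

Lemma rho_hyperplanes w H :
  H \in hyperplanes rho -> (rho w @: H)%VS \in hyperplanes rho.
Proof.
move=> /hyperplanesP[x rx ->]; apply/hyperplanesP; exists (w * x * w^-1)%g.
  by rewrite /is_reflection fixedSpace_conj dim_rho.
by rewrite fixedSpace_conj.
Qed.

Lemma rho_img_inj w : injective (fun H : {vspace V} => (rho w @: H)%VS).
Proof.
move=> H K e; have := congr1 (fun U => rho w^-1%g @: U)%VS e.
by rewrite -!limg_comp -rhoM mulVg rho1 !lim1g.
Qed.

Lemma perm_hyperplanes w :
  perm_eq [seq (rho w @: H)%VS | H <- hyperplanes rho] (hyperplanes rho).
Proof.
have u : uniq [seq (rho w @: H)%VS | H <- hyperplanes rho].
  by rewrite map_inj_uniq ?undup_uniq //; exact: rho_img_inj.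
apply: uniq_perm => //; first exact: undup_uniq.
have sub : {subset [seq (rho w @: H)%VS | H <- hyperplanes rho]
    <= hyperplanes rho} by move=> K /mapP[H HA ->]; exact: rho_hyperplanes.
by have [] := uniq_min_size u sub (eq_leq (esym (size_map _ _))).
Qed.

Variable alpha : {vspace V} -> 'Hom(V, C^o).
Hypothesis alphaP : forall H, H \in hyperplanes rho -> lker (alpha H) = H.

Lemma linpolyZ c (a : 'Hom(V, C^o)) :
  linpoly (c *: a) = c *: linpoly a.
Proof.
rewrite /linpoly scaler_sumr; apply: eq_bigr => i _.
by rewrite scale_lfunE scalerA.
Qed.

Lemma linpoly_eq0 (a : 'Hom(V, C^o)) : (linpoly a == 0) = (a == 0).
Proof.
apply/eqP/eqP => [e|->]; last first.
  by rewrite /linpoly big1 // => i _; rewrite lfunE scale0r.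
by apply/lfunP => x; rewrite -evalV_linpoly e /evalV raddf0 lfunE.
Qed.

Lemma alpha_neq0 H : H \in hyperplanes rho -> alpha H != 0.
Proof.
move=> HA; apply/eqP => a0; have := alphaP HA; rewrite a0.
have -> : lker (0 : 'Hom(V, C^o)) = fullv.
  by apply/vspaceP => x; rewrite memv_ker lfunE eqxx memvf.
move=> e; have /hyperplanesP[w] := HA.
by rewrite /is_reflection => + eH; rewrite -eH -e gtn_eqF.
Qed.

Lemma lker_prop (a b : 'Hom(V, C^o)) : b != 0 -> lker b = lker a ->
  exists c, a = c *: b.
Proof.
move=> b0 e; have [x bx] : exists x, b x != 0.
  apply: contrapT => no; case/eqP: b0; apply/lfunP => x; rewrite lfunE.
  by apply/eqP/negP => bx; apply: no; exists x; apply/negP.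
exists (a x / b x); apply/lfunP => y; rewrite scale_lfunE.
have : y - (b y / b x) *: x \in lker b.
  by rewrite memv_ker linearB linearZ /= [X in _ - X]divfK // subrr.
rewrite e memv_ker linearB linearZ /= subr_eq0 => /eqP ->.
by rewrite /GRing.scale /= mulrAC [RHS]mulrAC [a x * _]mulrC.
Qed.

Lemma actV_alpha w H : H \in hyperplanes rho ->
  exists2 c, c != 0 & actV rho w (linpoly (alpha H)) =
                      c *: linpoly (alpha (rho w @: H)%VS).
Proof.
move=> HA; rewrite actV_linpoly.
have HA' := rho_hyperplanes w HA.
have [|c e] := @lker_prop (alpha H \o rho w^-1%g)%VF _ (alpha_neq0 HA').
  rewrite alphaP //; apply/vspaceP => v; rewrite memv_ker comp_lfunE.
  rewrite -memv_ker alphaP //; apply/memv_imgP/idP => [[u uH ->]|vH].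
    by rewrite rhoKV.
  by exists (rho w^-1%g v) => //; rewrite rhoVK.
exists c; last by rewrite e linpolyZ.
apply/eqP => c0; have := alpha_neq0 HA.
suff -> : alpha H = 0 by rewrite eqxx.
apply/lfunP => x; rewrite -[x](rhoKV w) -comp_lfunE e c0.
by rewrite scale0r !lfunE.
Qed.

Let delta := \prod_(H <- hyperplanes rho) linpoly (alpha H).

Lemma delta_neq0 : delta != 0.
Proof.
rewrite prodf_seq_neq0; apply/allP => H HA /=.
by rewrite linpoly_eq0 alpha_neq0.
Qed.

Lemma actV_delta w : exists2 c, c != 0 & actV rho w delta = c *: delta.
Proof.
have /boolp.choice [f fP] : forall H : {vspace V}, exists c,
    H \in hyperplanes rho -> c != 0 /\
    actV rho w (linpoly (alpha H)) = c *: linpoly (alpha (rho w @: H)%VS).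
  move=> H; have [HA|/negP HA] := boolP (H \in hyperplanes rho).
    by have [c c0 e] := actV_alpha w HA; exists c.
  by exists 0.
exists (\prod_(H <- hyperplanes rho) f H).
  by rewrite prodf_seq_neq0; apply/allP => H HA /=; case: (fP H HA).
rewrite {2}/delta -[X in _ *: X](perm_big _ (perm_hyperplanes w)) big_map /=.
rewrite /delta rmorph_prod -scaler_prod.
by apply: eq_big_seq => H HA /=; have [_ ->] := fP H HA.
Qed.

Lemma regV_poly p : regV rho alpha (tofrac p).
Proof. by exists p, 0%N; rewrite expr0 divr1. Qed.

Lemma regVM f g : regV rho alpha f -> regV rho alpha g -> regV rho alpha (f * g).
Proof.
move=> [p [m ->]] [q [l ->]]; exists (p * q), (m + l)%N.
by rewrite tofracM exprD mulf_div.
Qed.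

Lemma regVD f g : regV rho alpha f -> regV rho alpha g -> regV rho alpha (f + g).
Proof.
move=> [p [m ->]] [q [l ->]]; exists (p * delta ^+ l + q * delta ^+ m), (m + l)%N.
have d0 : tofrac delta != 0 by rewrite tofrac_eq0 delta_neq0.
by rewrite addf_div ?expf_neq0 // tofracD !tofracM !tofracXn exprD.
Qed.

Lemma regV_alphaV H : H \in hyperplanes rho ->
  regV rho alpha (tofrac (linpoly (alpha H)))^-1.
Proof.
move=> HA; exists (\prod_(K <- hyperplanes rho | K != H) linpoly (alpha K)), 1%N.
have aH0 : tofrac (linpoly (alpha H)) != 0.
  by rewrite tofrac_eq0 linpoly_eq0 alpha_neq0.
have := delta_neq0; rewrite expr1 -tofrac_eq0 /delta (bigD1_seq H) ?undup_uniq //=.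
rewrite tofracM mulf_eq0 negb_or => /andP[_ r0].
by rewrite invfM mulrC divfK // mulrC.
Qed.

Lemma regV_act w f : regV rho alpha f -> regV rho alpha (actF rho w f).
Proof.
move=> [p [m ->]]; have [c c0 e] := actV_delta w.
rewrite -tofracXn actFE ?expf_neq0 ?delta_neq0 // rmorphXn /= e.
exists (c ^- m *: actV rho w p), m.
rewrite -tofracXn; apply/tofrac_div_eq; rewrite ?expf_neq0 ?scaler_eq0 ?negb_or ?c0 ?delta_neq0 //.
by rewrite exprZn -scalerAl -scalerAr scalerA mulVf ?expf_neq0 // scale1r.
Qed.

Lemma regV_der xi f : regV rho alpha f -> regV rho alpha (drat xi f).
Proof.
move=> [p [m ->]]; rewrite -tofracXn dratE ?expf_neq0 ?delta_neq0 //.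
by rewrite -tofracXn -exprM tofracXn; eexists _, _; reflexivity.
Qed.

Lemma diffop_regV P f : diffop rho alpha P ->
  regV rho alpha f -> regV rho alpha (P f).
Proof.
move=> dP; elim: dP f => {P} [g gR|xi|P Q _ hP _ hQ|P Q _ hP _ hQ] f fR.
- exact: regVM.
- exact: regV_der.
- by apply: regVD; [exact: hP|exact: hQ].
- by apply/hP/hQ.
Qed.

Lemma diffop_cst c : diffop rho alpha (fun f => tofrac c%:MP * f).
Proof. exact/diffop_fun/regV_poly. Qed.

Lemma diffop_eq P Q : P =1 Q -> diffop rho alpha P -> diffop rho alpha Q.
Proof. by move=> /funext ->. Qed.

Lemma diffop0 : diffop rho alpha (fun=> 0).
Proof.
apply: diffop_eq (diffop_cst 0) => f.
by rewrite mpolyC0 tofrac0 mul0r.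
Qed.

Lemma diffop_sum (I : Type) (r : seq I) (Q : pred I) (P : I -> ratV V -> ratV V) :
  (forall i, Q i -> diffop rho alpha (P i)) ->
  diffop rho alpha (fun f => \sum_(i <- r | Q i) P i f).
Proof.
move=> h; elim: r => [|i r IH].
  by apply: diffop_eq diffop0 => f; rewrite big_nil.
case Qi : (Q i); last by apply: diffop_eq IH => f; rewrite big_cons Qi.
by apply: diffop_eq (diffop_add (h i Qi) IH) => f; rewrite big_cons Qi.
Qed.

Lemma diffop_scale g P : regV rho alpha g ->
  diffop rho alpha P -> diffop rho alpha (fun f => g * P f).
Proof. by move=> gR dP; exact: diffop_comp (diffop_fun gR) dP. Qed.

Lemma dpolyC xi c : dpoly xi (c%:MP : polyV V) = 0.
Proof. by rewrite /dpoly big1 // => i _; rewrite mderivC scaler0. Qed.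

Lemma dpolyD xi (p q : polyV V) : dpoly xi (p + q) = dpoly xi p + dpoly xi q.
Proof.
rewrite /dpoly -big_split; apply: eq_bigr => i _ /=.
by rewrite mderivD scalerDr.
Qed.

Lemma dpolyZ xi c (p : polyV V) : dpoly xi (c *: p) = c *: dpoly xi p.
Proof. by rewrite -mul_mpolyC dpolyM dpolyC mul0r add0r mul_mpolyC. Qed.

Lemma dpolyX xi i : dpoly xi ('X_i : polyV V) = (coord (vbasis {:V}) i xi)%:MP.
Proof.
rewrite /dpoly (bigD1 i) //= big1 ?addr0 => [|j ji].
  rewrite mderivX mnm1E eqxx scale1r.
  have -> : (U_(i) - U_(i))%MM = 0%MM :> 'X_{1.. \dim {:V}}.
    by apply/mnmP => l; rewrite mnmBE subnn mnm0E.
  by rewrite mpolyX0 -mul_mpolyC mulr1.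
by rewrite mderivX mnm1E eq_sym (negPf ji) scale0r scaler0.
Qed.

Lemma dpoly_linpoly xi (a : 'Hom(V, C^o)) : dpoly xi (linpoly a) = (a xi)%:MP.
Proof.
rewrite /linpoly (big_morph (dpoly xi) (dpolyD xi) (dpolyC xi 0)).
rewrite {2}(coord_vbasis (memvf xi)) linear_sum raddf_sum.
apply: eq_bigr => i _; rewrite dpolyZ dpolyX linearZ -mul_mpolyC -rmorphM /=.
by congr (_%:MP); exact: mulrC.
Qed.

Lemma dpoly_conj (xi : V) w p :
  actV rho w (dpoly xi (actV rho w^-1%g p)) = dpoly (rho w xi) p.
Proof.
have actVKV q : actV rho w (actV rho w^-1%g q) = q by rewrite -actVM mulgV actV1.
elim/polyV_ind: p => [c|i|p q hp hq|p q hp hq].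
- by rewrite {2}/actV comp_mpolyC !dpolyC raddf0.
- rewrite actVX invgK dpolyX.
  have -> : linpoly (fun v => coord (vbasis {:V}) i (rho w v)) =
    linpoly (linfun (coord (vbasis {:V}) i : V -> C^o) \o rho w)%VF.
    by rewrite /linpoly; apply: eq_bigr => j _; rewrite comp_lfunE lfunE.
  by rewrite dpoly_linpoly comp_lfunE lfunE /actV comp_mpolyC.
- by rewrite raddfD /= !dpolyD raddfD /= hp hq.
- by rewrite rmorphM /= !dpolyM raddfD /= !rmorphM /= hp hq !actVKV.
Qed.

Lemma drat_conj (xi : V) w f :
  actF rho w (drat xi (actF rho w^-1%g f)) = drat (rho w xi) f.
Proof.
have actVKV q : actV rho w (actV rho w^-1%g q) = q by rewrite -actVM mulgV actV1.
have [p [q [q0 ->]]] := ratVP f.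
rewrite actFE // !dratE ?actV_eq0 // -tofracXn actFE ?expf_neq0 ?actV_eq0 //.
by rewrite rmorphXn rmorphB /= ![actV rho w (_ * _)]rmorphM /= !dpoly_conj !actVKV tofracXn.
Qed.

Lemma diffop_conj w P : diffop rho alpha P ->
  diffop rho alpha (fun f => actF rho w (P (actF rho w^-1%g f))).
Proof.
elim=> {P} [g gR|xi|P Q _ hP _ hQ|P Q _ hP _ hQ].
- apply: diffop_eq (diffop_fun (regV_act w gR)) => f.
  by rewrite actFM actFKV.
- by apply: diffop_eq (diffop_der _ _ (rho w xi)) => f; rewrite drat_conj.
- by apply: diffop_eq (diffop_add hP hQ) => f; rewrite actFD.
- apply: diffop_eq (diffop_comp hP hQ) => f /=.
  by rewrite -[actF rho w^-1%g (actF rho w _)]actF_mul mulVg actF1.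
Qed.

Lemma cop_DW P : diffop rho alpha P -> DW rho alpha (cop P).
Proof. by move=> dP w; rewrite /cop; case: eqP => _ //; exact: diffop0. Qed.

Lemma cgrp_DW a : DW rho alpha (cgrp a).
Proof. by move=> w; exact: diffop_cst. Qed.

Lemma cadd_DW a b :
  DW rho alpha a -> DW rho alpha b -> DW rho alpha (cadd a b).
Proof. by move=> ha hb w; exact: diffop_add. Qed.

Lemma cmul_DW a b :
  DW rho alpha a -> DW rho alpha b -> DW rho alpha (cmul rho a b).
Proof.
move=> ha hb u; apply: diffop_sum => w _.
exact: diffop_comp (ha w) (diffop_conj w (hb _)).
Qed.

Lemma dunkl_DW k xi : DW rho alpha (dunkl rho alpha k xi).
Proof.
move=> w.
apply: (@diffop_eq (fun f => cop (drat xi) w f +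
   tofrac (-1)%:MP * \sum_(H <- hyperplanes rho | H \in hyperplanes rho)
      tofrac (alpha H xi)%:MP / tofrac (linpoly (alpha H)) *
      \sum_(i < ordH rho H) tofrac (ordH rho H * k H i)%:R%:MP *
        cgrp (idemH rho H i) w f)) => [f|].
  rewrite /dunkl; congr (_ + _).
  rewrite mpolyCN tofracN mpolyC1 tofrac1 mulN1r; congr (- _).
  rewrite -big_seq; apply: eq_bigr => H _; congr (_ * _).
  by apply: eq_bigr => i _; rewrite mpolyC_nat rmorph_nat mulr_natl.
apply: diffop_add; first exact: cop_DW (diffop_der _ _ xi) w.
apply: diffop_scale (regV_poly _) _.
apply: diffop_sum => H HA; apply: diffop_scale.
  by apply: regVM (regV_poly _) (regV_alphaV HA).
apply: diffop_sum => i _; apply: diffop_scale (regV_poly _) _.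
exact: cgrp_DW.
Qed.

Lemma cherednik_DW k a : cherednik rho alpha k a -> DW rho alpha a.
Proof.
elim=> {a} [p|a|xi|a b _ ha _ hb|a b _ ha _ hb].
- exact/cop_DW/diffop_fun/regV_poly.
- exact: cgrp_DW.
- exact: dunkl_DW.
- exact: cadd_DW.
- exact: cmul_DW.
Qed.

Lemma dact_regW a phi :
  DW rho alpha a -> regW rho alpha phi -> regW rho alpha (dact rho a phi).
Proof.
move=> ha hphi u; rewrite ffunE.
apply: (big_ind (regV rho alpha)) => [||w _]; last 1 first.
- by apply: diffop_regV (ha w) _; exact: regV_act.
- by rewrite -tofrac0; exact: regV_poly.
- exact: regVD.
Qed.

Lemma diffopD P f g : diffop rho alpha P -> P (f + g) = P f + P g.
Proof.
move=> dP; elim: dP f g => {P} [h _|xi|P Q _ hP _ hQ|P Q _ hP _ hQ] f g.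
- exact: mulrDr.
- have [p [q [q0 ->]]] := ratVP f; have [p' [q' [q'0 ->]]] := ratVP g.
  rewrite addf_div ?tofrac_eq0 // -!tofracM -tofracD !dratE ?mulf_neq0 //.
  rewrite addf_div ?expf_neq0 ?tofrac_eq0 // -!tofracXn -!tofracM -tofracD.
  apply/tofrac_div_eq; rewrite ?mulf_neq0 ?expf_neq0 ?mulf_neq0 //.
  by rewrite !(dpolyM, dpolyD); ring.
- by rewrite hP hQ addrACA.
- by rewrite hQ hP.
Qed.

Lemma dactM a b phi : DW rho alpha a ->
  dact rho (cmul rho a b) phi = dact rho a (dact rho b phi).
Proof.
move=> ha; apply/ffunP => u; rewrite !ffunE.
have a0 w : a w 0 = 0.
  by apply: (addrI (a w 0)); rewrite -(diffopD _ _ (ha w)) !addr0.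
have act0 w : actF rho w 0 = 0.
  by apply: (addrI (actF rho w 0)); rewrite -actFD !addr0.
rewrite /cmul exchange_big /=; apply: eq_bigr => w _.
rewrite ffunE (big_morph (actF rho w) (actFD w) (act0 w)).
rewrite (big_morph (a w) (fun f g => diffopD f g (ha w)) (a0 w)).
rewrite (reindex_inj (mulgI w)); apply: eq_bigr => x _.
by rewrite mulKg -actF_mul mulKg invMg mulgA.
Qed.
End Facts.

(* Main.v *)
Require Import Defs.
From HB Require Import structures.
From mathcomp Require Import all_boot all_order all_algebra all_fingroup cyclic.
From mathcomp Require Import fraction complex mpoly ring zify.
From mathcomp Require Import boolp classical_sets reals.
Import Defs.

(* Write E for the W-tuples of rational functions, i.e. C(V) (x) CW.

   Existence: the tuples whose component along each e_(H,i), for the action of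
   W_H on the factor CW alone, is divisible by alpha_H^(n_H k_(H,i)) in the
   local ring of H form a submodule; being contained in C[V] (x) CW, it is
   finitely generated.

   Uniqueness: let M, M' be submodules, M with bounded poles, and e M <= M'. By
   induction on the degree, phi in M may be assumed to satisfy T_xi phi in M'.
   Then f (x) u |-> f . (u phi) maps the standard module C[V] (x) CW, whose Dunkl
   operators are built on the Knizhnik-Zamolodchikov connection
   d + sum_H (d alpha_H / alpha_H) sum_i n_H k_(H,i) (1 (x) e_(H,i)),
   to E, and the preimage of M' is a submodule containing e (C[V] (x) CW). Such a
   submodule is everything, because a singular vector of the standard module is
   constant. Indeed integrality of k makes the connection trivial over C(V): the
   iterates of a covariant derivative have bounded poles while their degree
   drops, so they vanish eventually, and Taylor expansion yields a basis of flat
   sections. Hence equivariant horizontal endomorphisms have pseudo-inverses of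
   the same kind, and these again preserve C[V] (x) CW. *)

Set Implicit Arguments.
Unset Strict Implicit.
Unset Printing Implicit Defensive.

Import Order.TTheory GRing.Theory Num.Theory passmx.
Local Open Scope ring_scope.

(** * Reflections and their hyperplanes *)

(** The two sides of the condition on e are linked by invariance: a W-invariant tuple is determined
    by its component at 1, and on it s in W_H acting on the factor CW is s^-1 acting on functions.
    So e_(H,i) on CW becomes e_(H,-i) on C[V], which is why divisibility is imposed on the factor
    CW. Finite generation over C[V] enters uniqueness through a common denominator: it bounds the
    degrees of nonzero elements of M from below, and this starts the induction. The map f (x) u |->
    f . (u phi) always respects C[V] and W, but the Dunkl operators only up to the tuples T_xi (u
    phi); hence these are brought into M' first. The obstacle is that singular vectors of positive
    degree do exist for non-integral parameters: in rank one with n_H = 2, k_(H,0) = 0 and k_(H,1) =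
    1/2, the vector alpha_H on the trivial representation is one. Integrality excludes them by
    making horizontal endomorphisms constant matrices, for which pseudo-inverses are available; a
    degree argument alone would not do. *)

Lemma det_1_add_col_row (C : fieldType) n (u : 'cV[C]_n) (v : 'rV[C]_n) :
  \det (1%:M + u *m v) = 1 + (v *m u) 0 0.
Proof.
(* Two triangular factorizations of one bordered matrix: the first has determinant det(1 + u v), the
   second det(1 + v u). *)
have e1 : block_mx 1%:M (- u) 0 1%:M *m block_mx (1%:M + u *m v) 0 v (1%:M : 'M_1)
   = block_mx 1%:M (- u) v 1%:M.
  by rewrite mulmx_block !(mul1mx, mul0mx, mulmx1, add0r, mulNmx, addrK).
have e2 : block_mx 1%:M 0 v 1%:M *m block_mx 1%:M (- u) 0 (1%:M + v *m u)
   = block_mx 1%:M (- u) v (1%:M : 'M_1).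
  by rewrite mulmx_block !(mul1mx, mul0mx, mulmx1, mulmx0, addr0, mulmxN) addrCA addNr addr0.
have := congr1 determinant (etrans e1 (esym e2)).
rewrite !det_mulmx !det_ublock !det_lblock !det1 !mulr1 !mul1r => ->.
by rewrite det_mx11 !mxE.
Qed.

Section Reflections.
Variables (C : fieldType) (V : vectType C) (W : finGroupType).
Variables (rho : W -> 'End(V)) (alpha : {vspace V} -> 'Hom(V, C^o)).
Hypothesis char0 : forall n, (n%:R == 0 :> C) = (n == 0)%N.
Hypothesis rho1 : rho 1%g = \1%VF.
Hypothesis rhoM : forall u w, rho (u * w)%g = (rho u \o rho w)%VF.
Hypothesis rho_inj : injective rho.
Hypothesis alphaP : forall H, H \in hyperplanes rho -> lker (alpha H) = H.

(** * Determinant character and pointwise stabilizers *)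

Lemma detV1 : detV rho 1%g = 1.
Proof. by rewrite /detV rho1 mxof1 ?det1 //; exact: basis_free (vbasisP _). Qed.

Lemma detVM u w : detV rho (u * w)%g = detV rho u * detV rho w.
Proof.
by rewrite /detV rhoM (mxof_comp _ _ (vbasisP _)) det_mulmx mulrC.
Qed.

Lemma detVJ u w : detV rho (u ^ w)%g = detV rho u.
Proof. by rewrite conjgE !detVM mulrCA -detVM mulVg detV1 mulr1. Qed.

Lemma detV_neq0 w : detV rho w != 0.
Proof.
apply/eqP => e; have := detVM w w^-1%g.
by rewrite mulgV detV1 e mul0r => /eqP; rewrite oner_eq0.
Qed.

Lemma detVV w : detV rho w^-1%g = (detV rho w)^-1.
Proof.
by apply: (mulfI (detV_neq0 w)); rewrite -detVM mulgV detV1 divff ?detV_neq0.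
Qed.

Lemma detVX w m : detV rho (w ^+ m)%g = detV rho w ^+ m.
Proof. by elim: m => [|m IH]; rewrite ?detV1 // expgS detVM IH exprS. Qed.

Lemma pstab_group_set H : group_set (pstab rho H).
Proof.
apply/group_setP; split=> [|x y]; rewrite !inE.
  by apply/subvP => v _; apply/fixedSpaceP; rewrite rho1 lfunE.
move=> /subvP hx /subvP hy; apply/subvP => v vH.
apply/fixedSpaceP; rewrite rhoM comp_lfunE.
by rewrite (fixedSpaceP (hy v vH)) (fixedSpaceP (hx v vH)).
Qed.
Canonical pstab_group H := Group (pstab_group_set H).

Lemma pstabP (H : {vspace V}) s : reflect (forall x, x \in H -> rho s x = x) (s \in pstab rho H).
Proof.
rewrite inE; apply: (iffP subvP) => h x xH; first exact/fixedSpaceP/h.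
exact/fixedSpaceP/h.
Qed.

Lemma pstabJ (H : {vspace V}) w s : ((s ^ w^-1)%g \in pstab rho (rho w @: H)%VS) = (s \in pstab rho H).
Proof.
rewrite conjgE invgK; apply/pstabP/pstabP => h x xH.
  have := h (rho w x) (memv_img _ xH).
  rewrite !rhoM !comp_lfunE (rhoKV rho1 rhoM) => e.
  by rewrite -[LHS](rhoKV rho1 rhoM w) e (rhoKV rho1 rhoM).
move/memv_imgP: xH => [y yH ->].
by rewrite !rhoM !comp_lfunE (rhoKV rho1 rhoM) h.
Qed.

Lemma pstab_img (H : {vspace V}) w : pstab rho (rho w @: H)%VS = (pstab rho H :^ w^-1)%g.
Proof.
apply/setP => s; rewrite mem_conjg invgK.
by rewrite -(pstabJ H w) -conjgM mulgV conjg1.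
Qed.

Lemma ordH_img (H : {vspace V}) w : ordH rho (rho w @: H)%VS = ordH rho H.
Proof. by rewrite /ordH pstab_img cardJg. Qed.

Lemma ordH_gt0 H : (0 < ordH rho H)%N.
Proof. exact: (cardG_gt0 (pstab_group H)). Qed.

Lemma detV_ordH H s : s \in pstab rho H -> detV rho s ^+ ordH rho H = 1.
Proof.
by move=> sH; rewrite -detVX (@expg_cardG _ (pstab_group H) _ sH) detV1.
Qed.

(** * The cyclic stabilizer of one hyperplane *)

Section Hyperplane.
Variable H : {vspace V}.
Hypothesis HA : H \in hyperplanes rho.

Lemma alpha_normal : exists v, alpha H v = 1.
Proof.
have [v hv] : exists v, alpha H v != 0.
  apply: contrapT => no; have := alpha_neq0 alphaP HA => /eqP; apply.
  apply/lfunP => x; rewrite lfunE.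
  by apply/eqP/negP => bx; apply: no; exists x; apply/negP.
exists ((alpha H v)^-1 *: v); rewrite linearZ /=.
exact: mulVf.
Qed.

Lemma alpha_eq0 x : (alpha H x == 0) = (x \in H).
Proof. by rewrite -{2}(alphaP HA) memv_ker. Qed.

(** Since s fixes H pointwise, s x = x + alpha(x) b with b = s v - v. This is a rank-one
    perturbation of the identity, and its determinant 1 + alpha(b) is the factor by which s scales
    alpha. *)
Lemma alpha_pstab s x : s \in pstab rho H ->
  alpha H (rho s x) = detV rho s * alpha H x.
Proof.
move=> /pstabP sH; have [v av] := alpha_normal.
pose b := rho s v - v.
have sE y : rho s y = y + alpha H y *: b.
  have : y - alpha H y *: v \in H.
    by rewrite -alpha_eq0 linearB linearZ /= av -[_ *: _]/(_ * _) mulr1 subrr.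
  move=> /sH; rewrite linearB linearZ /= => /eqP; rewrite subr_eq => /eqP ->.
  by rewrite /b scalerBr addrAC addrA.
suff -> : detV rho s = 1 + alpha H b.
  by rewrite sE linearD linearZ /= -[_ *: _]/(_ * _) mulrDl mul1r mulrC.
rewrite /detV.
pose a := \col_i alpha H (vbasis {:V})`_i : 'cV[C]_(\dim {:V}).
have -> : mxof (vbasis {:V}) (vbasis {:V}) (rho s) =
   1%:M + a *m (\row_j coord (vbasis {:V}) j b).
  apply/matrixP => i j.
  have e := congr1 (fun M : 'rV_ _ => M 0 j)
    (mul_mxof (vbasis {:V}) (vbasis {:V}) (rho s) (delta_mx 0 i)).
  rewrite /= -rowE [LHS]mxE in e; rewrite {}e !mxE.
  have -> : vecof (vbasis {:V}) (delta_mx 0 i) = (vbasis {:V})`_i.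
    by rewrite vecof_delta.
  rewrite sE linearD linearZ /= coord_free ?(basis_free (vbasisP _)) //.
  by rewrite big_ord1 !mxE eq_sym (eq_sym j).
rewrite det_1_add_col_row; congr (_ + _).
rewrite mxE {2}(coord_vbasis (memvf b)) linear_sum.
by apply: eq_bigr => i _; rewrite !mxE linearZ.
Qed.

(** An element of W_H of determinant one is a transvection: s v - v lies in H, so s^m v = v + m (s v
    - v), and finite order forces s v = v in characteristic zero. Thus det embeds W_H into the units
    of C. *)
Lemma detV_pstab_eq1 s : s \in pstab rho H -> detV rho s = 1 -> s = 1%g.
Proof.
move=> sS d1; have sH := pstabP _ _ sS; have [v av] := alpha_normal.
apply: rho_inj; rewrite rho1.
have bH : rho s v - v \in H.
  by rewrite -alpha_eq0 linearB /= alpha_pstab // d1 mul1r subrr.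
have vX m : rho (s ^+ m)%g v = v + (rho s v - v) *+ m.
  elim: m => [|m IH]; first by rewrite rho1 lfunE addr0.
  rewrite expgS rhoM comp_lfunE IH linearD linearMn /= (sH _ bH).
  by rewrite mulrS addrA subrKC.
have := vX #[s]%g; rewrite expg_order rho1 lfunE => /esym/eqP.
rewrite -subr_eq0 addrC addrA addNr add0r -scaler_nat scaler_eq0 char0.
rewrite eqn0Ngt order_gt0 /= subr_eq0 => /eqP sv.
apply/lfunP => y; rewrite lfunE /=.
have : y - alpha H y *: v \in H.
  by rewrite -alpha_eq0 linearB linearZ /= av -[_ *: _]/(_ * _) mulr1 subrr.
by move=> /sH; rewrite linearB linearZ /= sv => /addIr.
Qed.

Lemma sum_detV_expn s : s \in pstab rho H ->
  \sum_(i < ordH rho H) detV rho s ^+ i = (ordH rho H * (s == 1%g))%:R.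
Proof.
move=> sS; case: eqP => [->|/eqP s1].
  by rewrite muln1 detV1; under eq_bigr do rewrite expr1n; rewrite sumr_const card_ord.
rewrite muln0; have h := subrX1 (detV rho s) (ordH rho H).
move/eqP: h; rewrite detV_ordH // subrr eq_sym mulf_eq0 subr_eq0.
by case/orP => [/eqP/(detV_pstab_eq1 sS) /eqP|/eqP //]; rewrite (negPf s1).
Qed.

(** W_H is cyclic because det is injective on it. If n_H does not divide m, translation by a
    generator g multiplies the sum by det(g)^m, which is not 1. *)
Lemma sum_detV_pstab m :
  \sum_(s in pstab rho H) detV rho s ^+ m = (ordH rho H * (ordH rho H %| m)%N)%:R.
Proof.
case: (boolP (ordH rho H %| m)%N) => [/dvdnP[q ->]|nm].
  rewrite muln1 (eq_bigr (fun=> 1)) ?sumr_const // => s sS.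
  by rewrite mulnC exprM detV_ordH // expr1n.
rewrite muln0.
have /cyclicP[g gE] : cyclic (pstab_group H).
  apply: (@field_mul_group_cyclic _ _ _ (detV rho)) => [u v _ _|x xS].
    exact: detVM.
  by split=> [|->]; [exact: detV_pstab_eq1|exact: detV1].
have gS : g \in pstab rho H by rewrite -[pstab rho H]/(pstab_group H : {set W}) gE cycle_id.
have gm : detV rho g ^+ m != 1.
  apply/eqP; rewrite -detVX => /detV_pstab_eq1 h.
  have /h/eqP : (g ^+ m)%g \in pstab rho H by exact: (@groupX _ (pstab_group H)).
  rewrite -order_dvdn /order -gE; exact/negP.
set S := \sum_(s in _) _.
have : detV rho g ^+ m * S = S.
  rewrite {2}/S (reindex_inj (mulgI g)) mulr_sumr /=; apply: eq_big => s.
    by rewrite -[pstab rho H]/(pstab_group H : {set W}) groupMl.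
  by move=> _; rewrite detVM exprMn.
move/eqP; rewrite -subr_eq0 -{2}[S]mul1r -mulrBl mulf_eq0 subr_eq0 (negPf gm).
by move/eqP.
Qed.

Lemma ordH_gt1 : (1 < ordH rho H)%N.
Proof.
have /hyperplanesP[w rw eH] := HA.
have wS : w \in pstab rho H by rewrite inE eH subvv.
rewrite /ordH (cardsD1 1%g) (cardsD1 w) !inE.
have -> : (w != 1%g).
  apply/eqP => w1; move: rw; rewrite w1 /is_reflection.
  have -> : fixedSpace (rho 1%g) = fullv.
    by apply/vspaceP => x; rewrite memvf; apply/fixedSpaceP; rewrite rho1 lfunE.
  by rewrite gtn_eqF.
have := wS; rewrite inE => ->.
by have := group1 (pstab_group H); rewrite inE => ->.
Qed.

(** Averaging over W_H is a projection onto H: it maps into H because the determinants of W_H sum to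
    0, as n_H > 1. Its kernel is the stable complement of H, and v is taken there. *)
Lemma alpha_eigenvector : exists v, alpha H v = 1 /\
  forall s, s \in pstab rho H -> rho s v = detV rho s *: v.
Proof.
have [v0 av0] := alpha_normal; set n := ordH rho H.
have n0 : n%:R != 0 :> C by rewrite char0 -lt0n ordH_gt0.
pose avg x := n%:R^-1 *: \sum_(s in pstab rho H) rho s x.
have alpha_avg x : alpha H (avg x) = 0.
  rewrite linearZ linear_sum /= (eq_bigr (fun s => detV rho s ^+ 1 * alpha H x)); last first.
    by move=> s sS; rewrite alpha_pstab // expr1.
  rewrite -mulr_suml sum_detV_pstab dvdn1 gtn_eqF ?ordH_gt1 // muln0 mul0r.
  exact: mulr0.
have avgH x : x \in H -> avg x = x.
  move=> xH; rewrite /avg (eq_bigr (fun=> x)); last by move=> s /pstabP->.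
  by rewrite sumr_const -/(ordH rho H) -/n -scaler_nat scalerA mulVf // scale1r.
have avgB x y : avg (x - y) = avg x - avg y.
  rewrite /avg -scalerBr; congr (_ *: _); rewrite -sumrB.
  by apply: eq_bigr => s _; rewrite linearB.
have avgZ a x : avg (a *: x) = a *: avg x.
  rewrite /avg scalerA mulrC -scalerA; congr (_ *: _); rewrite scaler_sumr.
  by apply: eq_bigr => s _; rewrite linearZ.
have avgR t x : t \in pstab rho H -> avg (rho t x) = avg x.
  move=> tS; rewrite /avg; congr (_ *: _).
  rewrite [RHS](reindex_inj (mulIg t)) /=; apply: eq_big => s.
    by rewrite -[pstab rho H]/(pstab_group H : {set W}) groupMr.
  by move=> _; rewrite rhoM comp_lfunE.
pose v := v0 - avg v0.
have av : avg v = 0.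
  by rewrite avgB (avgH (avg v0)) ?subrr // -alpha_eq0 alpha_avg.
have alv : alpha H v = 1 by rewrite linearB /= alpha_avg subr0.
exists v; split => // s sS; apply/eqP; rewrite -subr_eq0; apply/eqP.
have hH : rho s v - detV rho s *: v \in H.
  rewrite -alpha_eq0 linearB linearZ /= alpha_pstab // alv mulr1.
  by rewrite -[_ *: _]/(_ * _) mulr1 subrr.
by rewrite -(avgH _ hH) avgB avgZ avgR // av scaler0 subrr.
Qed.

End Hyperplane.
End Reflections.

(** * The standard module and the KZ connection *)

Section DunklConnections.
Variables (C : fieldType) (V : vectType C) (W : finGroupType).
Variables (rho : W -> 'End(V)) (alpha : {vspace V} -> 'Hom(V, C^o)).
Hypothesis char0 : forall n, (n%:R == 0 :> C) = (n == 0)%N.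
Hypothesis rho1 : rho 1%g = \1%VF.
Hypothesis rhoM : forall u w, rho (u * w)%g = (rho u \o rho w)%VF.
Hypothesis rho_inj : injective rho.
Hypothesis alphaP : forall H, H \in hyperplanes rho -> lker (alpha H) = H.
Variable k : {vspace V} -> nat -> nat.
Hypothesis k_inv : forall w H i, H \in hyperplanes rho -> (i < ordH rho H)%N ->
  k (rho w @: H)%VS i = k H i.

(* K stands for C(V), al H for the form alpha_H, O H (below) for the localization
   of C[V] at the prime alpha_H, Pol for C[V], degle d for degree at most d, and
   ord m for order at least m at the origin; only the stated properties of these
   are used, so that no computation has to unfold fractions of polynomials. *)
Variables (K : fieldType) (cst : {rmorphism C -> K}).
Variables (act : W -> {rmorphism K -> K}) (der : V -> K -> K) (al : {vspace V} -> K).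
Hypothesis act1 : forall f, act 1%g f = f.
Hypothesis actM : forall u w f, act (u * w)%g f = act u (act w f).
Hypothesis act_cst : forall w c, act w (cst c) = cst c.
Hypothesis derD : forall xi f g, der xi (f + g) = der xi f + der xi g.
Hypothesis derM : forall xi f g, der xi (f * g) = der xi f * g + f * der xi g.
Hypothesis der_cst : forall xi c, der xi (cst c) = 0.
Hypothesis der_lin : forall b xi eta f,
  der (b *: xi + eta) f = cst b * der xi f + der eta f.
Hypothesis act_der : forall w xi f, act w (der xi f) = der (rho w xi) (act w f).
Hypothesis al_neq0 : forall H, H \in hyperplanes rho -> al H != 0.
Hypothesis der_al : forall H xi, H \in hyperplanes rho ->
  der xi (al H) = cst (alpha H xi).
Hypothesis act_alpha_frac : forall w H xi, H \in hyperplanes rho ->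
  act w (cst (alpha H xi) / al H) =
  cst (alpha (rho w @: H)%VS (rho w xi)) / al (rho w @: H)%VS.

Local Notation A := (hyperplanes rho).
Local Notation stab := (pstab rho).
Local Notation chi := (detV rho).

(* phi u is the coefficient of u in C(V) (x) CW. *)
Definition Efun := {ffun W -> K^o}.
Local Notation E := Efun.

Definition basisE (u : W) : E := [ffun x => (x == u)%:R].
Definition lact (w : W) (phi : E) : E := [ffun u => phi (w^-1 * u)%g].
Definition wact (w : W) (phi : E) : E := [ffun u => act w (phi (w^-1 * u)%g)].
Definition derE (xi : V) (phi : E) : E := [ffun u => der xi (phi u)].

(* The coefficient of s in sum_i n_H k_(H,i) e_(H,i). *)
Definition refl_coef (H : {vspace V}) (s : W) : C :=
  \sum_(i < ordH rho H) (k H i)%:R * chi s ^- i.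

(* sum_i n_H k_(H,i) e_(H,i), for W_H acting diagonally, resp. on CW only. *)
Definition zdiag H (phi : E) : E :=
  \sum_(s in stab H) cst (refl_coef H s) *: wact s phi.
Definition zleft H (phi : E) : E :=
  \sum_(s in stab H) cst (refl_coef H s) *: lact s phi.

Definition afrac H (xi : V) : K := cst (alpha H xi) / al H.

Definition KZ (xi : V) (phi : E) : E :=
  derE xi phi + \sum_(H <- A) afrac H xi *: zleft H phi.

(* [derE] for D gives the differential action, [KZ] the standard module. *)
Definition dunklE (D : V -> E -> E) (xi : V) (phi : E) : E :=
  D xi phi - \sum_(H <- A) afrac H xi *: zdiag H phi.

Definition connection (D : V -> E -> E) :=
  [/\ forall xi phi psi, D xi (phi + psi) = D xi phi + D xi psi,
      forall xi f phi, D xi (f *: phi) = der xi f *: phi + f *: D xi phi,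
      forall b xi eta phi, D (b *: xi + eta) phi = cst b *: D xi phi + D eta phi &
      forall w xi phi, wact w (D xi phi) = D (rho w xi) (wact w phi)].

Lemma der0 xi : der xi 0 = 0.
Proof. by have := der_cst xi 0; rewrite rmorph0. Qed.

Lemma der1 xi : der xi 1 = 0.
Proof. by have := der_cst xi 1; rewrite rmorph1. Qed.

Lemma lactE w phi u : lact w phi u = phi (w^-1 * u)%g.
Proof. by rewrite ffunE. Qed.
Lemma lactD w phi psi : lact w (phi + psi) = lact w phi + lact w psi.
Proof. by apply/ffunP => u; rewrite !ffunE. Qed.
Lemma wactD w phi psi : wact w (phi + psi) = wact w phi + wact w psi.
Proof. by apply/ffunP => u; rewrite !ffunE rmorphD. Qed.
Lemma derED xi phi psi : derE xi (phi + psi) = derE xi phi + derE xi psi.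
Proof. by apply/ffunP => u; rewrite !ffunE derD. Qed.
Lemma lactZ w f phi : lact w (f *: phi) = f *: lact w phi.
Proof. by apply/ffunP => u; rewrite !ffunE. Qed.
Lemma wactZ w f phi : wact w (f *: phi) = act w f *: wact w phi.
Proof. by apply/ffunP => u; rewrite !ffunE rmorphM. Qed.
Lemma derEZ xi f phi : derE xi (f *: phi) = der xi f *: phi + f *: derE xi phi.
Proof. by apply/ffunP => u; rewrite !ffunE derM. Qed.

Lemma wact0 w : wact w 0 = 0.
Proof. by apply/ffunP => u; rewrite !ffunE rmorph0. Qed.
Lemma lact0 w : lact w 0 = 0.
Proof. by apply/ffunP => u; rewrite !ffunE. Qed.

Lemma wact_sum w (I : Type) (r : seq I) (P : pred I) (F : I -> E) :
  wact w (\sum_(i <- r | P i) F i) = \sum_(i <- r | P i) wact w (F i).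
Proof. exact: (big_morph _ (wactD w) (wact0 w)). Qed.
Lemma lact_sum w (I : Type) (r : seq I) (P : pred I) (F : I -> E) :
  lact w (\sum_(i <- r | P i) F i) = \sum_(i <- r | P i) lact w (F i).
Proof. exact: (big_morph _ (lactD w) (lact0 w)). Qed.

Lemma wact1 phi : wact 1%g phi = phi.
Proof. by apply/ffunP => u; rewrite ffunE invg1 mul1g act1. Qed.
Lemma wactM u w phi : wact (u * w)%g phi = wact u (wact w phi).
Proof. by apply/ffunP => x; rewrite !ffunE invMg actM mulgA. Qed.
Lemma lactM u w phi : lact (u * w)%g phi = lact u (lact w phi).
Proof. by apply/ffunP => x; rewrite !ffunE invMg mulgA. Qed.
Lemma lact1 phi : lact 1%g phi = phi.
Proof. by apply/ffunP => u; rewrite ffunE invg1 mul1g. Qed.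

Lemma wact_lact w s phi : wact w (lact s phi) = lact (s ^ w^-1)%g (wact w phi).
Proof.
apply/ffunP => x; rewrite !ffunE; congr (act w (phi _)).
by rewrite conjgE !invMg !invgK !mulgA mulVg mul1g.
Qed.

Lemma wactJ w s phi : wact w (wact s phi) = wact (s ^ w^-1)%g (wact w phi).
Proof. by rewrite -!wactM conjgE invgK mulgA mulgKV. Qed.

Lemma derE_lact xi w phi : derE xi (lact w phi) = lact w (derE xi phi).
Proof. by apply/ffunP => x; rewrite !ffunE. Qed.

Lemma wact_basisE w u : wact w (basisE u) = basisE (w * u)%g.
Proof.
apply/ffunP => x; rewrite !ffunE rmorph_nat; congr (_%:R).
by rewrite -(inj_eq (mulgI w)) mulKVg.
Qed.
Lemma lact_basisE w u : lact w (basisE u) = basisE (w * u)%g.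
Proof.
apply/ffunP => x; rewrite !ffunE; congr (_%:R).
by rewrite -(inj_eq (mulgI w)) mulKVg.
Qed.
Lemma derE_basisE xi u : derE xi (basisE u) = 0.
Proof. by apply/ffunP => x; rewrite !ffunE; case: eqP; rewrite ?der0 ?der1. Qed.

Lemma basisE_sum (phi : E) : phi = \sum_u phi u *: basisE u.
Proof.
apply/ffunP => x; rewrite sum_ffunE (bigD1 x) //= big1 => [|u ux].
  by rewrite !ffunE eqxx addr0 -[_ *: _]/(_ * _) mulr1.
by rewrite !ffunE eq_sym (negPf ux) scaler0.
Qed.

Lemma refl_coef_img w H s : H \in A ->
  refl_coef (rho w @: H)%VS (s ^ w^-1)%g = refl_coef H s.
Proof.
move=> HA; rewrite /refl_coef (ordH_img rho1 rhoM).
by apply: eq_bigr => i _; rewrite k_inv // (detVJ rho1 rhoM).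
Qed.

Lemma wact_zdiag w H phi : H \in A ->
  wact w (zdiag H phi) = zdiag (rho w @: H)%VS (wact w phi).
Proof.
move=> HA; rewrite /zdiag wact_sum.
rewrite [RHS](reindex_inj (conjg_inj w^-1%g)) /=.
apply: eq_big => s; first by rewrite (pstabJ rho1 rhoM).
by move=> _; rewrite wactZ act_cst refl_coef_img // wactJ.
Qed.

Lemma wact_zleft w H phi : H \in A ->
  wact w (zleft H phi) = zleft (rho w @: H)%VS (wact w phi).
Proof.
move=> HA; rewrite /zleft wact_sum.
rewrite [RHS](reindex_inj (conjg_inj w^-1%g)) /=.
apply: eq_big => s; first by rewrite (pstabJ rho1 rhoM).
by move=> _; rewrite wactZ act_cst refl_coef_img // wact_lact.
Qed.

Lemma zdiagD H phi psi : zdiag H (phi + psi) = zdiag H phi + zdiag H psi.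
Proof.
by rewrite /zdiag -big_split; apply: eq_bigr => s _; rewrite wactD scalerDr.
Qed.
Lemma zleftD H phi psi : zleft H (phi + psi) = zleft H phi + zleft H psi.
Proof.
by rewrite /zleft -big_split; apply: eq_bigr => s _; rewrite lactD scalerDr.
Qed.
Lemma zleftZ H f phi : zleft H (f *: phi) = f *: zleft H phi.
Proof.
rewrite /zleft scaler_sumr; apply: eq_bigr => s _.
by rewrite lactZ !scalerA mulrC.
Qed.

Lemma wact_sum_afrac (z : {vspace V} -> E -> E) w xi phi :
  (forall H, H \in A -> wact w (z H phi) = z (rho w @: H)%VS (wact w phi)) ->
  wact w (\sum_(H <- A) afrac H xi *: z H phi) =
  \sum_(H <- A) afrac H (rho w xi) *: z H (wact w phi).
Proof.
move=> hz; rewrite wact_sum -[RHS](perm_big _ (perm_hyperplanes rho1 rhoM w)) big_map.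
by apply: eq_big_seq => H HA; rewrite wactZ act_alpha_frac // hz.
Qed.

Lemma afrac_lin H b xi eta :
  afrac H (b *: xi + eta) = cst b * afrac H xi + afrac H eta.
Proof.
by rewrite /afrac linearD linearZ /= rmorphD rmorphM /= mulrDl mulrA.
Qed.

Lemma sum_afrac_lin (z : {vspace V} -> E) b xi eta :
  \sum_(H <- A) afrac H (b *: xi + eta) *: z H =
  cst b *: (\sum_(H <- A) afrac H xi *: z H) + \sum_(H <- A) afrac H eta *: z H.
Proof.
rewrite scaler_sumr -big_split; apply: eq_bigr => H _.
by rewrite afrac_lin scalerDl scalerA.
Qed.

Lemma connection_derE : connection derE.
Proof.
split=> [xi phi psi|xi f phi|b xi eta phi|w xi phi].
- exact: derED.
- exact: derEZ.
- by apply/ffunP => u; rewrite !ffunE der_lin.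
- by apply/ffunP => u; rewrite !ffunE act_der.
Qed.

Lemma connection_KZ : connection KZ.
Proof.
have [dD dZ dL dW] := connection_derE.
split=> [xi phi psi|xi f phi|b xi eta phi|w xi phi].
- rewrite /KZ dD addrACA; congr (_ + _); rewrite -big_split.
  by apply: eq_bigr => H _; rewrite zleftD scalerDr.
- rewrite /KZ dZ -addrA scalerDr; congr (_ + (_ + _)); rewrite scaler_sumr.
  by apply: eq_bigr => H _; rewrite zleftZ !scalerA mulrC.
- by rewrite /KZ dL sum_afrac_lin scalerDr addrACA.
- rewrite /KZ wactD dW (wact_sum_afrac xi (z := zleft)) // => H HA.
  exact: wact_zleft.
Qed.

Lemma KZ_basisE xi u : KZ xi (basisE u) =
  \sum_(H <- A) afrac H xi *: zdiag H (basisE u).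
Proof.
rewrite /KZ derE_basisE add0r; apply: eq_bigr => H _; congr (_ *: _).
by apply: eq_bigr => s _; rewrite lact_basisE wact_basisE.
Qed.

Lemma KZ_dunklE xi phi :
  KZ xi phi = dunklE KZ xi phi + \sum_(H <- A) afrac H xi *: zdiag H phi.
Proof. by rewrite /dunklE subrK. Qed.

(** * Dunkl operators of an equivariant connection *)

Section Connection.
Variable D : V -> E -> E.
Hypothesis Dconn : connection D.

Local Notation T := (dunklE D).

Lemma dunklED xi phi psi : T xi (phi + psi) = T xi phi + T xi psi.
Proof.
have [dD _ _ _] := Dconn; rewrite /dunklE dD addrACA -opprD; congr (_ - _).
by rewrite -big_split; apply: eq_bigr => H _; rewrite zdiagD scalerDr.
Qed.

Lemma conn0 xi : D xi 0 = 0.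
Proof. by case: Dconn => dD _ _ _; apply: (addrI (D xi 0)); rewrite -dD !addr0. Qed.

Lemma dunklE0 xi : T xi 0 = 0.
Proof. by apply: (addrI (T xi 0)); rewrite -dunklED !addr0. Qed.

Lemma connN xi phi : D xi (- phi) = - D xi phi.
Proof.
case: Dconn => dD _ _ _; apply: (addrI (D xi phi)).
by rewrite -dD !subrr conn0.
Qed.

Lemma conn_sum xi (I : Type) (r : seq I) (P : pred I) (F : I -> E) :
  D xi (\sum_(i <- r | P i) F i) = \sum_(i <- r | P i) D xi (F i).
Proof. by case: Dconn => dD _ _ _; exact: (big_morph _ (dD xi) (conn0 xi)). Qed.

Lemma dunklE_sum xi (I : Type) (r : seq I) (P : pred I) (F : I -> E) :
  T xi (\sum_(i <- r | P i) F i) = \sum_(i <- r | P i) T xi (F i).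
Proof. exact: (big_morph _ (dunklED xi) (dunklE0 xi)). Qed.

Lemma dunklE_wact w xi phi : wact w (T xi phi) = T (rho w xi) (wact w phi).
Proof.
have [dD _ _ dW] := Dconn; rewrite /dunklE wactD dW; congr (_ + _).
have -> psi : wact w (- psi) = - wact w psi.
  by apply: (addrI (wact w psi)); rewrite -wactD !subrr wact0.
rewrite (wact_sum_afrac xi (z := zdiag)) // => H HA.
exact: wact_zdiag.
Qed.

(** The failure of the Leibniz rule for Dunkl operators. It does not involve the connection, and it
    takes the translates s phi as an argument B, so that [orbit_map] carries it over term by
    term. *)
Definition refl_diff xi f (B : W -> E) : E :=
  \sum_(H <- A) afrac H xi *:
    \sum_(s in stab H) (cst (refl_coef H s) * (f - act s f)) *: B s.

Lemma dunklE_scale xi f phi : T xi (f *: phi) =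
  f *: T xi phi + der xi f *: phi + refl_diff xi f (fun s => wact s phi).
Proof.
have [_ dZ _ _] := Dconn.
have key : refl_diff xi f (fun s => wact s phi) =
    f *: (\sum_(H <- A) afrac H xi *: zdiag H phi)
    - \sum_(H <- A) afrac H xi *: zdiag H (f *: phi).
  rewrite scaler_sumr -sumrB; apply: eq_bigr => H _.
  have -> : f *: (afrac H xi *: zdiag H phi) = afrac H xi *: (f *: zdiag H phi).
    by rewrite !scalerA mulrC.
  rewrite -scalerBr; congr (_ *: _).
  rewrite /zdiag scaler_sumr -sumrB; apply: eq_bigr => s _.
  rewrite wactZ !scalerA -scalerBl; congr (_ *: _); ring.
rewrite key /dunklE dZ scalerBr [in RHS]addrAC [in RHS]addrA subrK.
by rewrite [_ + f *: _]addrC addrAC.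
Qed.
End Connection.

(** On 1 (x) u the diagonal and the left action of W_H agree, so the reflection part cancels the
    connection form. This is what identifies the standard module. *)
Lemma dunklE_KZ_basisE xi u : dunklE KZ xi (basisE u) = 0.
Proof. by rewrite /dunklE KZ_basisE subrr. Qed.

(* The K-linear extension of the map f (x) u |-> f . (u v). *)
Definition orbit_map (v phi : E) : E := \sum_u phi u *: wact u v.

Lemma orbit_mapD v phi psi :
  orbit_map v (phi + psi) = orbit_map v phi + orbit_map v psi.
Proof.
by rewrite /orbit_map -big_split; apply: eq_bigr => u _; rewrite ffunE scalerDl.
Qed.
Lemma orbit_mapZ v f phi : orbit_map v (f *: phi) = f *: orbit_map v phi.
Proof.
by rewrite /orbit_map scaler_sumr; apply: eq_bigr => u _; rewrite ffunE scalerA.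
Qed.
Lemma orbit_map0 v : orbit_map v 0 = 0 :> E.
Proof. by rewrite /orbit_map big1 // => u _; rewrite ffunE scale0r. Qed.
Lemma orbit_map_sum v (I : Type) (r : seq I) (P : pred I) (F : I -> E) :
  orbit_map v (\sum_(i <- r | P i) F i) = \sum_(i <- r | P i) orbit_map v (F i).
Proof. exact: (big_morph _ (orbit_mapD v) (orbit_map0 v)). Qed.
Lemma orbit_map_basisE v u : orbit_map v (basisE u) = wact u v.
Proof.
rewrite /orbit_map (bigD1 u) //= big1 => [|x xu].
  by rewrite ffunE eqxx scale1r addr0.
by rewrite ffunE (negPf xu) mulr0n scale0r.
Qed.

Lemma orbit_map_wact v w phi : orbit_map v (wact w phi) = wact w (orbit_map v phi).
Proof.
rewrite {1}/orbit_map (reindex_inj (mulgI w)) /= wact_sum; apply: eq_bigr => u _.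
by rewrite ffunE mulKg wactZ wactM.
Qed.

(** Both Dunkl operators have the same derivation term and the same [refl_diff]; as T_xi kills 1 (x)
    u in the standard module, only the values T_xi (u v) are left over. *)
Lemma orbit_map_dunklE D v xi phi : connection D ->
  dunklE D xi (orbit_map v phi) = orbit_map v (dunklE KZ xi phi) +
    \sum_u phi u *: dunklE D xi (wact u v).
Proof.
move=> Dconn.
have -> : orbit_map v (dunklE KZ xi phi) =
    \sum_u orbit_map v (dunklE KZ xi (phi u *: basisE u)).
  by rewrite {1}(basisE_sum phi) (dunklE_sum connection_KZ) orbit_map_sum.
rewrite -big_split [orbit_map v phi]/orbit_map (dunklE_sum Dconn).
apply: eq_bigr => u _ /=.
rewrite (dunklE_scale Dconn) (dunklE_scale connection_KZ) dunklE_KZ_basisE.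
rewrite scaler0 add0r orbit_mapD orbit_mapZ orbit_map_basisE [RHS]addrC addrA.
congr (_ + _); rewrite /refl_diff orbit_map_sum; apply: eq_bigr => H _.
rewrite orbit_mapZ orbit_map_sum; congr (_ *: _); apply: eq_bigr => s _.
by rewrite orbit_mapZ wact_basisE orbit_map_basisE wactM.
Qed.

(** * Integrality along one hyperplane *)

Variable O : {vspace V} -> K -> Prop.
Hypothesis O_cst : forall H c, H \in A -> O H (cst c).
Hypothesis O_add : forall H f g, H \in A -> O H f -> O H g -> O H (f + g).
Hypothesis O_mul : forall H f g, H \in A -> O H f -> O H g -> O H (f * g).
Hypothesis O_der : forall H xi f, H \in A -> O H f -> O H (der xi f).
Hypothesis O_al : forall H H', H \in A -> H' \in A -> O H (al H').
Hypothesis O_alV : forall H H', H \in A -> H' \in A -> H' != H -> O H (al H')^-1.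
Hypothesis O_act : forall H s f, H \in A -> s \in stab H -> O H f ->
  O H ((act s f - f) / al H).

Section AtHyperplane.
Variable H : {vspace V}.
Hypothesis HA : H \in A.

Local Notation n := (ordH rho H).
Local Notation aH := (al H).
(** Weights are characters of the cyclic group W_H, represented by natural numbers of any size; the
    index is reduced modulo n_H here. *)
Definition kmod j := k H (j %% n).
Local Notation kk := kmod.

Definition inO (phi : E) := forall u, O H (phi u).

Let aH0 : aH != 0. Proof. exact: al_neq0. Qed.
Let n0 : n%:R != 0 :> C. Proof. by rewrite char0 -lt0n ordH_gt0. Qed.

Lemma O_0 : O H 0. Proof. by rewrite -(rmorph0 cst); exact: O_cst. Qed.
Lemma O_1 : O H 1. Proof. by rewrite -(rmorph1 cst); exact: O_cst. Qed.
Lemma O_opp f : O H f -> O H (- f).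
Proof.
move=> Of; rewrite -mulN1r -(rmorph1 cst) -rmorphN.
by apply: O_mul => //; exact: O_cst.
Qed.
Lemma O_exp f m : O H f -> O H (f ^+ m).
Proof.
move=> Of; elim: m => [|m IH]; first by rewrite expr0; exact: O_1.
by rewrite exprS; exact: O_mul.
Qed.
Lemma O_act_stab s f : s \in stab H -> O H f -> O H (act s f).
Proof.
move=> sS Of; have -> : act s f = aH * ((act s f - f) / aH) + f.
  by rewrite mulrC divfK // subrK.
by apply: O_add => //; apply: O_mul => //; [exact: O_al|exact: O_act].
Qed.
Lemma O_afrac H' xi : H' \in A -> H' != H -> O H (afrac H' xi).
Proof. by move=> HA' ne; apply: O_mul => //; [exact: O_cst|exact: O_alV]. Qed.

Lemma inO0 : inO 0. Proof. by move=> u; rewrite ffunE; exact: O_0. Qed.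
Lemma inOD phi psi : inO phi -> inO psi -> inO (phi + psi).
Proof. by move=> hp hq u; rewrite ffunE; exact: O_add. Qed.
Lemma inOZ f phi : O H f -> inO phi -> inO (f *: phi).
Proof. by move=> hp hq u; rewrite ffunE; exact: O_mul. Qed.
Lemma inO_cst c phi : inO phi -> inO (cst c *: phi).
Proof. by apply: inOZ; exact: O_cst. Qed.
Lemma inON phi : inO phi -> inO (- phi).
Proof. by move=> hp u; rewrite ffunE; exact: O_opp. Qed.
Lemma inOB phi psi : inO phi -> inO psi -> inO (phi - psi).
Proof. by move=> hp hq; apply: inOD hp (inON hq). Qed.
Lemma inO_sum (I : eqType) (r : seq I) (P : pred I) (F : I -> E) :
  (forall i, i \in r -> P i -> inO (F i)) -> inO (\sum_(i <- r | P i) F i).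
Proof.
move=> h; rewrite big_seq_cond; apply: (big_ind inO) => [||i /andP[ir Pi]].
- exact: inO0.
- exact: inOD.
- exact: h.
Qed.
Lemma inO_wact s phi : s \in stab H -> inO phi -> inO (wact s phi).
Proof. by move=> sS hp u; rewrite ffunE; exact: O_act_stab. Qed.
Lemma inO_derE xi phi : inO phi -> inO (derE xi phi).
Proof. by move=> hp u; rewrite ffunE; exact: O_der. Qed.
Lemma inO_basisE u : inO (basisE u).
Proof. by move=> x; rewrite ffunE -(rmorph_nat cst); exact: O_cst. Qed.
Lemma inO_zdiag phi : inO phi -> inO (zdiag H phi).
Proof.
move=> hp; apply: (big_ind inO); [exact: inO0|exact: inOD|move=> s sS].
exact/inO_cst/inO_wact.
Qed.
Lemma img_pstab s : s \in stab H -> (rho s @: H)%VS = H.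
Proof.
move=> /pstabP sS; apply/vspaceP => v; apply/memv_imgP/idP => [[x xH ->]|vH].
  by rewrite sS.
by exists v; rewrite ?sS.
Qed.

Lemma act_al s : s \in stab H -> act s aH = cst (chi s)^-1 * aH.
Proof.
move=> sS; have [v av] := alpha_normal alphaP HA.
have := act_alpha_frac s v HA; rewrite img_pstab // (alpha_pstab alphaP HA) //.
rewrite av mulr1 rmorph1 mul1r fmorphV => /(congr1 (fun x => x^-1)).
by rewrite invrK => ->; rewrite invf_div mulrC fmorphV.
Qed.

(** * Weights under the stabilizer *)

Definition weight j (phi : E) :=
  forall s, s \in stab H -> wact s phi = cst (chi s ^+ j) *: phi.

(** Orthogonality of characters leaves only the index i = j mod n_H. The value is the scalar by
    which sum_i n_H k_(H,i) e_(H,i) acts in weight j. *)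
Lemma sum_refl_coef j :
  \sum_(s in stab H) refl_coef H s * chi s ^+ j = (n * kk j)%:R.
Proof.
under eq_bigr do rewrite /refl_coef mulr_suml.
rewrite exchange_big /=.
have ltj : (j %% n < n)%N by rewrite ltn_mod ordH_gt0.
rewrite (bigD1 (Ordinal ltj)) //= [X in _ + X]big1 ?addr0 => [|i ij].
  rewrite (eq_bigr (fun=> (kk j)%:R)) => [|s sS].
    by rewrite sumr_const natrM mulr_natl.
  have -> : chi s ^+ j = chi s ^+ (j %% n).
    by rewrite {1}(divn_eq j n) exprD mulnC exprM detV_ordH // expr1n mul1r.
  by rewrite -mulrA mulVf ?mulr1 // expf_neq0 ?detV_neq0.
rewrite (eq_bigr (fun s => (k H i)%:R * chi s ^+ (n - i + j))) => [|s sS]; last first.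
  rewrite -mulrA; congr (_ * _); rewrite exprD; congr (_ * _).
  have := detV_ordH rho1 rhoM sS; rewrite -{1}(subnK (ltnW (ltn_ord i))) exprD => e.
  have ci : chi s ^+ i != 0 by rewrite expf_neq0 ?(detV_neq0 rho1 rhoM).
  by apply: (mulIf ci); rewrite e mulVf.
rewrite -mulr_sumr (sum_detV_pstab char0 rho1 rhoM rho_inj alphaP HA).
case: (boolP (n %| n - i + j)%N) => [dv|]; last by rewrite muln0 mulr0.
case/negP: ij; apply/eqP/val_inj => /=.
have : j = i %[mod n].
  apply/eqP; rewrite -(eqn_modDl (n - i)) subnK ?(ltnW (ltn_ord i)) // modnn.
  by move: dv; rewrite /dvdn.
by move=> ->; rewrite modn_small.
Qed.

Lemma zdiag_weight j phi : weight j phi -> zdiag H phi = cst (n * kk j)%:R *: phi.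
Proof.
move=> hw; rewrite -sum_refl_coef rmorph_sum scaler_suml; apply: eq_bigr => s sS.
by rewrite hw // scalerA rmorphM.
Qed.

(** The form alpha_H has weight -1, written as n_H - 1 so that weights stay natural numbers. *)
Lemma weight_alX j r phi : weight j phi -> weight (j + r * n.-1) (aH ^+ r *: phi).
Proof.
move=> hw s sS; rewrite wactZ hw // rmorphXn /= act_al // !scalerA.
rewrite exprMn exprD mulnC exprM rmorphM /= -!mulrA [aH ^+ r * _]mulrC mulrA mulrCA mulrA.
congr (_ * _ *: _); congr (_ * _); rewrite -rmorphXn; congr (cst (_ ^+ r)).
apply: (mulfI (detV_neq0 rho1 rhoM s)); rewrite divff ?detV_neq0 //.
by rewrite -exprS prednK ?ordH_gt0 // detV_ordH.
Qed.

Definition weight_proj j (phi : E) : E :=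
  cst n%:R^-1 *: \sum_(s in stab H) cst (chi s ^- j) *: wact s phi.

Lemma weight_projP j phi : weight j (weight_proj j phi).
Proof.
move=> t tS; rewrite /weight_proj wactZ act_cst scalerA mulrC -scalerA.
congr (_ *: _); rewrite wact_sum scaler_sumr [RHS](reindex_inj (mulgI t)) /=.
apply: eq_big => s; first by rewrite -[stab H]/(pstab_group rho1 rhoM H : {set W}) groupMl.
move=> _; rewrite wactZ act_cst wactM scalerA -rmorphM /=.
rewrite (detVM rhoM) exprMn invfM mulrA mulfV ?mul1r //.
by rewrite expf_neq0 ?detV_neq0.
Qed.

Lemma sum_weight_proj phi : \sum_(j < n) weight_proj j phi = phi.
Proof.
rewrite /weight_proj -scaler_sumr exchange_big /=.
rewrite (bigD1 1%g) ?(group1 (pstab_group rho1 rhoM H)) //=.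
rewrite [X in _ + X]big1 ?addr0 => [|s /andP[sS s1]].
  rewrite -scaler_suml wact1 scalerA -rmorph_sum -rmorphM /=.
  under eq_bigr do rewrite detV1 // expr1n invr1.
  by rewrite sumr_const card_ord mulVf // rmorph1 scale1r.
rewrite -scaler_suml -rmorph_sum; under eq_bigr do rewrite -exprVn -(detVV rho1 rhoM).
rewrite (sum_detV_expn char0 rho1 rhoM rho_inj alphaP HA); last first.
  exact: (@groupVr _ (pstab_group rho1 rhoM H)).
by rewrite invg_eq1 (negPf s1) muln0 rmorph0 scale0r.
Qed.

Lemma inO_weight_proj j phi : inO phi -> inO (weight_proj j phi).
Proof.
move=> hp; apply/inO_cst/(big_ind inO); [exact: inO0|exact: inOD|move=> s sS].
exact/inO_cst/inO_wact.
Qed.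

(* The part of the Dunkl operator of the standard module singular along H. *)
Definition dunklH xi phi := KZ xi phi - afrac H xi *: zdiag H phi.

Lemma dunklHD xi phi psi : dunklH xi (phi + psi) = dunklH xi phi + dunklH xi psi.
Proof.
have [dD _ _ _] := connection_KZ.
by rewrite /dunklH dD zdiagD scalerDr opprD addrACA.
Qed.

Lemma wact_dunklH s xi phi : s \in stab H ->
  wact s (dunklH xi phi) = dunklH (rho s xi) (wact s phi).
Proof.
have [_ _ _ dW] := connection_KZ.
move=> sS; rewrite /dunklH wactD dW -scaleNr wactZ rmorphN /= act_alpha_frac //.
by rewrite wact_zdiag // img_pstab // scaleNr.
Qed.

(** On f (x) u the pole of the connection form along H combines with that of the reflection term to
    multiples of (f - s f) / alpha_H, which are integral because s is trivial on H. *)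
Lemma inO_dunklH xi phi : inO phi -> inO (dunklH xi phi).
Proof.
move=> hp; rewrite (basisE_sum phi).
elim/big_ind: _ => [|p q|u _].
- have [_ dZ _ _] := connection_KZ.
  rewrite -(scale0r 0) /dunklH dZ der0 !scale0r add0r sub0r -scaleNr.
  rewrite (_ : zdiag H 0 = 0) ?scaler0; first exact: inO0.
  by rewrite /zdiag big1 // => s _; rewrite wact0 scaler0.
- by rewrite dunklHD; exact: inOD.
have [_ dZ _ _] := connection_KZ.
rewrite /dunklH dZ KZ_basisE -addrA; apply: inOD.
  by apply: inOZ; [exact: O_der|exact: inO_basisE].
rewrite (bigD1_seq H) ?undup_uniq //= scalerDr addrAC; apply: inOD.
  rewrite scalerA mulrC -scalerA -scalerBr /zdiag scaler_sumr -sumrB scaler_sumr.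
  apply: inO_sum => s _ sS; rewrite wactZ wact_basisE !scalerA -scalerBl scalerA.
  rewrite /afrac [phi u * _]mulrC -mulrBr.
  have -> : cst (alpha H xi) / aH * (cst (refl_coef H s) * (phi u - act s (phi u))) =
    - (cst (alpha H xi * refl_coef H s) * ((act s (phi u) - phi u) / aH)).
    by rewrite rmorphM /=; field.
  by apply: inOZ (inO_basisE _); apply/O_opp/O_mul => //; [exact: O_cst|exact: O_act].
rewrite -big_filter; apply: inOZ => //; apply: inO_sum => H'.
rewrite mem_filter => /andP[ne HA'] _; apply: inOZ; first exact: O_afrac.
apply: (big_ind inO); [exact: inO0|exact: inOD|move=> s sS].
by rewrite wact_basisE; exact/inO_cst/inO_basisE.
Qed.

Lemma KZ_dunklH xi phi : alpha H xi = 0 -> KZ xi phi = dunklH xi phi.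
Proof. by move=> a0; rewrite /dunklH /afrac a0 rmorph0 mul0r scale0r subr0. Qed.

Lemma inO_al_KZ xi phi : inO phi -> inO (aH *: KZ xi phi).
Proof.
move=> hp; have -> : KZ xi phi = dunklH xi phi + afrac H xi *: zdiag H phi.
  by rewrite subrK.
rewrite scalerDr; apply: inOD; first by apply: inOZ; [exact: O_al|exact: inO_dunklH].
by rewrite scalerA mulrC divfK //; exact/inO_cst/inO_zdiag.
Qed.

Lemma dunklE_dunklH xi phi : dunklE KZ xi phi =
  dunklH xi phi - \sum_(H' <- A | H' != H) afrac H' xi *: zdiag H' phi.
Proof.
by rewrite /dunklE (bigD1_seq H) ?undup_uniq //= opprD addrA.
Qed.

(* For phi of weight j in X and v normal to H, the integral tuple
   [dunklH v (aH ^+ r.+1 *: phi) - aH ^+ r.+1 *: dunklH v phi] is c times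
   aH ^+ r *: phi with c = r + 1 + n (k_j - k_(j - r - 1)); c can only vanish if
   n divides r + 1, but then the two k's cancel. *)
Lemma lattice_bound_step (X : E -> Prop) r :
  X 0 -> (forall phi psi, X phi -> X psi -> X (phi + psi)) ->
  (forall c phi, X phi -> X (cst c *: phi)) ->
  (forall w phi, X phi -> X (wact w phi)) ->
  (forall xi phi, X phi -> X (dunklE KZ xi phi)) ->
  (forall phi, X phi -> inO (aH ^+ r.+1 *: phi)) ->
  forall phi, X phi -> inO (aH ^+ r *: phi).
Proof.
move=> X0 XD Xc Xw XT Xr phi Xphi.
have Xsum (P : pred W) (F : W -> E) : (forall s, X (F s)) -> X (\sum_(s | P s) F s).
  by move=> h; apply: (big_ind X).
have Xz H' psi : X psi -> X (zdiag H' psi).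
  by move=> h; apply: (Xsum) => s; apply/Xc/Xw.
rewrite -[phi]sum_weight_proj scaler_sumr; apply: inO_sum => j _ _.
have : X (weight_proj j phi) by apply: (Xc); apply: Xsum => s; apply/Xc/Xw.
move: (weight_projP j phi) => {Xphi}; move: (weight_proj _ _) => {}phi wphi Xphi.
have [v [av _]] := alpha_eigenvector char0 rho1 rhoM rho_inj alphaP HA.
set m := aH ^+ r.+1 *: phi.
have mO : inO m by exact: Xr.
have wm : weight (j + r.+1 * n.-1) m by exact: weight_alX.
(* The other hyperplanes contribute vectors of X with coefficients integral at H, so stability of X
   under T_v controls [dunklH v phi] as well. *)
have tO : inO (aH ^+ r.+1 *: dunklH v phi).
  have -> : dunklH v phi = dunklE KZ v phi +
     \sum_(H' <- A | H' != H) afrac H' v *: zdiag H' phi.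
    by rewrite dunklE_dunklH subrK.
  rewrite scalerDr; apply: inOD; first exact/Xr/XT.
  rewrite scaler_sumr; apply: inO_sum => H' HA' ne.
  rewrite scalerA mulrC -scalerA; apply: inOZ; first exact: O_afrac.
  exact/Xr/Xz.
have derX : der v (aH ^+ r.+1) = r.+1%:R * aH ^+ r.
  elim: (r) => [|q IH]; first by rewrite !expr1 der_al // av rmorph1 expr0 mul1r.
  rewrite exprS derM IH der_al // av rmorph1 mul1r !exprS -[q.+2]addn1 natrD; ring.
pose c : C := (r.+1 + n * kk j)%:R - (n * kk (j + r.+1 * n.-1))%:R.
have e : cst c *: (aH ^+ r *: phi) = dunklH v m - aH ^+ r.+1 *: dunklH v phi.
  have [_ dZ _ _] := connection_KZ.
  rewrite /dunklH (zdiag_weight wm) (zdiag_weight wphi) dZ derX.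
  have gen (P Q Z Y : E) : (P + Q - Z) - (Q - Y) = P - Z + Y.
    by apply/ffunP => u; rewrite !ffunE; ring.
  rewrite scalerBr gen /m !scalerA -scaleNr -!scalerDl.
  congr (_ *: _); rewrite /afrac av rmorph1 mul1r /c rmorphB !rmorph_nat natrD exprS.
  by field.
have c0 : c != 0.
  rewrite /c subr_eq0; apply/eqP => /eqP ec.
  have {ec} : (r.+1 + n * kk j)%N = (n * kk (j + r.+1 * n.-1))%N.
    apply/eqP; wlog le : / ((r.+1 + n * kk j) <= n * kk (j + r.+1 * n.-1))%N.
      case/orP: (leq_total (r.+1 + n * kk j) (n * kk (j + r.+1 * n.-1))).
        by move=> le; exact.
      move=> le _; move: ec; rewrite -subr_eq0 -natrB // char0 subn_eq0 => le'.
      by rewrite eqn_leq le le'.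
    by move: ec; rewrite eq_sym -subr_eq0 -natrB // char0 subn_eq0 eqn_leq le.
  move=> ec; have nr : (n %| r.+1)%N.
    by rewrite -(dvdn_addl _ (dvdn_mulr (kk j) (dvdnn n))) ec dvdn_mulr.
  have kE : kk (j + r.+1 * n.-1) = kk j.
    have /eqP z : (n %| r.+1 * n.-1)%N := dvdn_mulr _ nr.
    by rewrite /kmod -modnDmr z addn0.
  have : (0 + n * kk j < r.+1 + n * kk j)%N by rewrite ltn_add2r.
  by rewrite ec kE add0n ltnn.
have -> : aH ^+ r *: phi = cst c^-1 *: (cst c *: (aH ^+ r *: phi)).
  by rewrite scalerA -rmorphM mulVf // rmorph1 scale1r.
by rewrite e; apply: inO_cst; apply: inOB tO; exact: inO_dunklH.
Qed.

(** * Curvature along a hyperplane *)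

Definition curvature xi eta phi := KZ xi (KZ eta phi) - KZ eta (KZ xi phi).

Lemma der_inv_eq0 xi f : der xi f = 0 -> der xi f^-1 = 0.
Proof.
move=> df; have [->|f0] := eqVneq f 0; first by rewrite invr0 der0.
have := derM xi f f^-1; rewrite df mul0r add0r mulfV // der1 => /eqP.
by rewrite eq_sym mulf_eq0 (negPf f0) => /eqP.
Qed.

(** For eta tangent to H, the derivative along eta annihilates alpha_H and commutes with W_H, hence
    with the singular part of [KZ] along H. In the commutator [KZ] may therefore be replaced by
    [dunklH], which preserves integrality. *)
Lemma inO_curvature_ker xi eta phi : alpha H eta = 0 -> inO phi ->
  inO (curvature xi eta phi).
Proof.
move=> eta0 phiO; have [dD dZ _ dW] := connection_KZ.
have zE : KZ eta (zdiag H phi) = zdiag H (KZ eta phi).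
  rewrite /zdiag (conn_sum connection_KZ); apply: eq_bigr => s sS.
  rewrite dZ der_cst scale0r add0r dW; congr (_ *: KZ _ _).
  have etaH : eta \in H by rewrite -(alpha_eq0 alphaP) ?eta0.
  by rewrite (pstabP _ _ _ sS).
have -> : curvature xi eta phi = dunklH xi (KZ eta phi) - KZ eta (dunklH xi phi).
  rewrite /dunklH /curvature dD (connN connection_KZ) dZ.
  rewrite /afrac derM der_cst mul0r add0r der_inv_eq0; last first.
    by rewrite der_al // eta0 rmorph0.
  by rewrite mulr0 scale0r add0r zE opprB addrA subrK.
apply: inOB; first by apply: inO_dunklH; rewrite (KZ_dunklH _ eta0); exact: inO_dunklH.
by rewrite (KZ_dunklH _ eta0); apply: inO_dunklH; exact: inO_dunklH.
Qed.

Lemma inO_curvature xi eta phi : inO phi -> inO (curvature xi eta phi).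
Proof.
move=> phiO; have [eta0|eta0] := eqVneq (alpha H eta) 0.
  exact: inO_curvature_ker.
have [dD dZ dL _] := connection_KZ.
(* The curvature is alternating, so the component of xi along eta drops out, and the remaining xi'
   is tangent to H. *)
pose b := alpha H xi / alpha H eta; pose xi' := xi - b *: eta.
have xi'0 : alpha H xi' = 0.
  by rewrite linearB linearZ /= -[_ *: _]/(_ * _) /b divfK // subrr.
have xiE : xi = b *: eta + xi' by rewrite /xi' subrKC.
have -> : curvature xi eta phi = - curvature eta xi' phi.
  have e : KZ eta (KZ xi phi) = cst b *: KZ eta (KZ eta phi) + KZ eta (KZ xi' phi).
    by rewrite {1}xiE dL dD dZ der_cst scale0r add0r.
  rewrite /curvature e {1}xiE dL opprB.
  by rewrite opprD addrACA subrr add0r.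
exact/inON/inO_curvature_ker.
Qed.

(** * Iterated derivatives normal to a hyperplane *)

Section NormalDirection.
Variable v : V.
Hypothesis av : alpha H v = 1.
Hypothesis v_eigen : forall s, s \in stab H -> rho s v = chi s *: v.

Lemma der_alX N : der v (aH ^+ N) = N%:R * (aH ^+ N / aH).
Proof.
elim: N => [|N IH]; first by rewrite expr0 der1 mul0r.
rewrite exprS derM IH der_al // av rmorph1 -[N.+1]addn1 natrD; by field.
Qed.

(** The Euler operator alpha_H nabla_v, shifted by a. These operators commute, so a product of them
    depends only on the multiset of shifts. *)
Definition theta (a : nat) (phi : E) : E := aH *: KZ v phi - a%:R *: phi.
Definition thetas (s : seq nat) (phi : E) : E := foldr theta phi s.

Lemma thetaC a b phi : theta a (theta b phi) = theta b (theta a phi).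
Proof.
have [dD dZ _ _] := connection_KZ.
have e (c : nat) psi : KZ v (aH *: KZ v psi - c%:R *: psi) =
    KZ v (aH *: KZ v psi) - c%:R *: KZ v psi.
  by rewrite dD (connN connection_KZ) [KZ v (c%:R *: _)]dZ -(rmorph_nat cst) der_cst scale0r add0r.
rewrite /theta !e; move: (KZ v phi) => Q; move: (KZ v (aH *: Q)) => P.
by apply/ffunP => u; rewrite !ffunE -![_ *: _]/(_ * _); ring.
Qed.

Lemma theta_thetas a s phi : theta a (thetas s phi) = thetas s (theta a phi).
Proof. by elim: s => [|b s IH] //=; rewrite thetaC IH. Qed.

Lemma thetas_cat s t phi : thetas (s ++ t) phi = thetas s (thetas t phi).
Proof. exact: foldr_cat. Qed.

Lemma thetasC s t phi : thetas s (thetas t phi) = thetas t (thetas s phi).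
Proof. by elim: s => [|a s IH] //=; rewrite IH theta_thetas. Qed.

Lemma thetas_perm s t phi : perm_eq s t -> thetas s phi = thetas t phi.
Proof.
apply: (catCA_perm_subst (F := fun s => thetas s phi)) => s1 s2 s3.
by rewrite !thetas_cat thetasC.
Qed.

Lemma theta_alX a N psi :
  theta a (aH ^+ N *: psi) = aH ^+ N *: (aH *: KZ v psi + (N%:R - a%:R) *: psi).
Proof.
have [_ dZ _ _] := connection_KZ.
rewrite /theta dZ der_alX; move: (KZ v psi) => Q.
by apply/ffunP => u; rewrite !ffunE -![_ *: _]/(_ * _); field.
Qed.

(** The covariant form of x^N d^N = (x d)(x d - 1)...(x d - N + 1): moving a power of alpha_H past
    nabla_v shifts the Euler operator. *)
Lemma thetas_iota N phi : thetas (rev (iota 0 N)) phi = aH ^+ N *: iter N (KZ v) phi.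
Proof.
elim: N => [|N IH]; first by rewrite expr0 scale1r.
rewrite -addn1 iotaD rev_cat /= IH theta_alX add0n subrr scale0r addr0.
by rewrite addn1 iterS scalerA -exprSr.
Qed.

Lemma weight_dunklH j phi : weight j phi -> weight j.+1 (dunklH v phi).
Proof.
have [dD dZ dL dW] := connection_KZ.
move=> hw s sS; rewrite wact_dunklH // v_eigen // hw //.
have KL c psi : KZ (c *: v) psi = cst c *: KZ v psi.
  have -> : c *: v = c *: v + (0 - 0) *: v by rewrite subrr scale0r addr0.
  rewrite dL; have -> : KZ ((0 - 0) *: v) psi = 0.
    have := dL 0 v v psi; rewrite scale0r add0r rmorph0 scale0r add0r => _.
    have := dL (-1) v v psi; rewrite scaleN1r addNr rmorphN1 scaleN1r addNr.
    by rewrite subrr scale0r.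
  by rewrite addr0.
rewrite /dunklH KL dZ der_cst scale0r add0r.
have -> : zdiag H (cst (chi s ^+ j) *: phi) = cst (chi s ^+ j) *: zdiag H phi.
  rewrite /zdiag scaler_sumr; apply: eq_bigr => t _.
  by rewrite wactZ act_cst !scalerA mulrC.
have -> : afrac H (chi s *: v) = cst (chi s) * afrac H v.
  by rewrite /afrac linearZ /= av -[_ *: _]/(_ * _) mulr1 rmorph1 mul1r.
rewrite exprS rmorphM scalerBr !scalerA; congr (_ - _ *: _).
by rewrite -mulrA mulrCA mulrC -mulrA mulrCA mulrA.
Qed.

Lemma weight_iter_dunklH j N phi : weight j phi -> weight (j + N) (iter N (dunklH v) phi).
Proof.
by move=> hw; elim: N => [|N IH]; rewrite ?addn0 // addnS iterS; exact: weight_dunklH.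
Qed.

(** The analogue of [thetas_iota] for [dunklH v]. Each application raises the weight by one, so at
    stage a the reflection term is the scalar n_H k_(H,j+a), which is added to the shift a. *)
Lemma thetas_dunklH j N phi : weight j phi ->
  thetas (rev [seq (a + n * kk (j + a))%N | a <- iota 0 N]) phi =
  aH ^+ N *: iter N (dunklH v) phi.
Proof.
move=> hw; elim: N => [|N IH]; first by rewrite expr0 scale1r.
rewrite -addn1 iotaD map_cat rev_cat /= IH theta_alX add0n addn1 iterS.
have hN := weight_iter_dunklH N hw; move: (iter N _ _) hN => psi hpsi.
rewrite exprSr -scalerA; congr (_ *: _).
rewrite /dunklH (zdiag_weight hpsi) /afrac av rmorph1 mul1r.
rewrite scalerBr !scalerA mulrA divff // mul1r; congr (_ + _).
by rewrite rmorph_nat natrD opprD addrA subrr add0r scaleNr.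
Qed.

(** Equal values force a = b modulo n_H, and then the two added terms coincide. *)
Lemma kmod_shift_inj j : injective (fun a => a + n * kk (j + a))%N.
Proof.
move=> a b /= e; have ab : a = b %[mod n].
  have := congr1 (modn^~ n) e.
  by rewrite ![(_ + n * _)%N]addnC ![(n * _)%N]mulnC !modnMDl.
move: e; rewrite /kmod -modnDmr ab modnDmr => /eqP.
by rewrite eqn_add2r => /eqP.
Qed.

Lemma theta_alX_inO r a phi : (exists2 psi, phi = aH ^+ r *: psi & inO psi) ->
  exists2 psi, theta a phi = aH ^+ r *: psi & inO psi.
Proof.
move=> [psi -> psiO]; rewrite theta_alX; eexists; first by reflexivity.
apply: inOD; first exact: inO_al_KZ.
rewrite -!(rmorph_nat cst) -rmorphB; exact: inO_cst.
Qed.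

Lemma thetas_alX_inO r s phi : (exists2 psi, phi = aH ^+ r *: psi & inO psi) ->
  exists2 psi, thetas s phi = aH ^+ r *: psi & inO psi.
Proof. by move=> h; elim: s => [|a s IH] //=; exact: theta_alX_inO. Qed.

Lemma inO_iter_dunklH xi N phi : inO phi -> inO (iter N (dunklH xi) phi).
Proof. by move=> h; elim: N => [|N IH] //; rewrite iterS; exact: inO_dunklH. Qed.

(* On a vector of weight j the operators [aH^N nabla_v^N] and [aH^N T_v^N] are
   the products of [theta - a] over a < N, resp. of [theta - c a] over a < N with
   [c a = a + n k_(j+a)]; as c is injective and bounded by a + d, the first
   product for N contains the second one for N - d. *)
Lemma inO_iter_KZ_weight d j N phi : (forall i, n * kk i <= d)%N ->
  weight j phi -> inO phi -> inO (aH ^+ d *: iter N (KZ v) phi).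
Proof.
move=> kd hw phiO; have [le|lt] := leqP N d.
  rewrite -(subnK le) exprD -scalerA -thetas_iota.
  apply: inOZ; first by apply: O_exp; exact: O_al.
  have [|psi ->] := @thetas_alX_inO 0 (rev (iota 0 N)) phi.
    by exists phi; rewrite ?expr0 ?scale1r.
  by rewrite expr0 scale1r.
(* As c a <= a + d < N for a < N - d, the shifts of the second product occur without repetition
   among 0, ..., N - 1; [rest] lists the others. *)
pose cs := [seq (a + n * kk (j + a))%N | a <- iota 0 (N - d)].
pose rest := [seq a <- iota 0 N | a \notin cs].
have pe : perm_eq (rev (iota 0 N)) (rest ++ rev cs).
  rewrite perm_rev perm_sym perm_catC; apply: (@perm_trans _ (cs ++ rest)).
    by rewrite perm_cat2r perm_rev.
  apply: uniq_perm; last first.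
  - move=> x; rewrite mem_cat mem_filter.
    case: (boolP (x \in cs)) => //= /mapP[a]; rewrite !mem_iota /= !add0n => lea ->.
    by have := kd (j + a)%N; move: (n * kk _)%N => c; lia.
  - exact: iota_uniq.
  rewrite cat_uniq filter_uniq ?iota_uniq // map_inj_uniq ?iota_uniq ?andbT //=.
    apply/hasPn => x; rewrite mem_filter => /andP[]; by [].
  exact: kmod_shift_inj.
have := thetas_iota N phi; rewrite (thetas_perm _ pe) thetas_cat thetas_dunklH //.
have [|psi -> psiO] := @thetas_alX_inO (N - d) rest
    (aH ^+ (N - d) *: iter (N - d) (dunklH v) phi).
  by exists (iter (N - d) (dunklH v) phi) => //; exact: inO_iter_dunklH.
(* Both sides carry the factor alpha_H^(N - d); cancelling it leaves the pole bound d, independent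
   of N. *)
rewrite -{2}(subnK (ltnW lt)) exprD -scalerA => /(scalerI (expf_neq0 _ aH0)) <-.
exact: psiO.
Qed.

Lemma KZ_iterD N phi psi :
  iter N (KZ v) (phi + psi) = iter N (KZ v) phi + iter N (KZ v) psi.
Proof.
have [dD _ _ _] := connection_KZ.
by elim: N => [|N IH] //; rewrite !iterS IH dD.
Qed.

Lemma inO_iter_KZ_normal d N phi : (forall i, n * kk i <= d)%N ->
  inO phi -> inO (aH ^+ d *: iter N (KZ v) phi).
Proof.
move=> kd phiO; rewrite -[phi]sum_weight_proj.
elim/big_ind: _ => [|p q hp hq|j _].
- have -> : iter N (KZ v) 0 = 0.
    by elim: N => [|N IH] //; rewrite iterS IH (conn0 connection_KZ).
  rewrite scaler0; exact: inO0.
- by rewrite KZ_iterD scalerDr; exact: inOD.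
by apply: (inO_iter_KZ_weight _ _ (@weight_projP j phi)) => //; exact: inO_weight_proj.
Qed.

End NormalDirection.

Lemma inO_iter_KZ d xi N phi : (forall i, n * kk i <= d)%N ->
  (forall eta psi, KZ xi (KZ eta psi) = KZ eta (KZ xi psi)) ->
  inO phi -> inO (aH ^+ d *: iter N (KZ xi) phi).
Proof.
move=> kd flat phiO; have [dD dZ dL _] := connection_KZ.
have [v [av v_eigen]] := alpha_eigenvector char0 rho1 rhoM rho_inj alphaP HA.
pose b := alpha H xi; pose h := xi - b *: v.
have h0 : alpha H h = 0.
  by rewrite linearB linearZ /= av -[_ *: _]/(_ * _) mulr1 subrr.
have xiE : xi = b *: v + h by rewrite /h subrKC.
(* The induction needs the extra nabla_v^M: xi = b v + h trades one nabla_xi for one more nabla_v or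
   for nabla_h, and the latter keeps the bound because h annihilates alpha_H. *)
suff : forall M, inO (aH ^+ d *: iter M (KZ v) (iter N (KZ xi) phi)) by move/(_ 0%N).
elim: N => [|N IH] M; first exact: inO_iter_KZ_normal.
have -> : iter M (KZ v) (iter N.+1 (KZ xi) phi) =
    KZ xi (iter M (KZ v) (iter N (KZ xi) phi)).
  by rewrite iterS; elim: M => [|M IHM] //; rewrite !iterS IHM flat.
rewrite {1}xiE dL scalerDr; apply: inOD.
  by rewrite scalerA mulrC -scalerA; apply: inO_cst; exact: (IH M.+1).
have := inO_dunklH h (IH M); rewrite -KZ_dunklH // dZ.
have -> : der h (aH ^+ d) = 0.
  have dh0 : der h aH = 0 by rewrite der_al // h0 rmorph0.
  elim: (d) => [|q IHq]; first by rewrite expr0 der1.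
  by rewrite exprS derM IHq dh0 mul0r mulr0 addr0.
by rewrite scale0r add0r.
Qed.

End AtHyperplane.

(** * Polynomial tuples, regular tuples and degree *)

Hypothesis derC : forall xi eta f, der xi (der eta f) = der eta (der xi f).

Definition arrpoly : K := \prod_(H <- A) al H.

Variable Pol : K -> Prop.
Hypothesis Pol_cst : forall c, Pol (cst c).
Hypothesis Pol_add : forall f g, Pol f -> Pol g -> Pol (f + g).
Hypothesis Pol_mul : forall f g, Pol f -> Pol g -> Pol (f * g).
Hypothesis Pol_der : forall xi f, Pol f -> Pol (der xi f).
Hypothesis Pol_act : forall w f, Pol f -> Pol (act w f).
Hypothesis Pol_al : forall H, H \in A -> Pol (al H).
Hypothesis Pol_O : forall H f, H \in A -> Pol f -> O H f.
Hypothesis Pol_of_O : forall m f, Pol (arrpoly ^+ m * f) ->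
  (forall H, H \in A -> O H f) -> Pol f.

Variable degle : int -> K -> Prop.
Hypothesis deg_cst : forall c, degle 0 (cst c).
Hypothesis deg_0 : forall d, degle d 0.
Hypothesis deg_add : forall d f g, degle d f -> degle d g -> degle d (f + g).
Hypothesis deg_mul : forall d e f g, degle d f -> degle e g -> degle (d + e) (f * g).
Hypothesis deg_der : forall d xi f, degle d f -> degle (d - 1) (der xi f).
Hypothesis deg_act : forall d w f, degle d f -> degle d (act w f).
Hypothesis deg_le : forall d e f, d <= e -> degle d f -> degle e f.
Hypothesis deg_Pol : forall f, Pol f -> exists d : nat, degle d%:Z f.
Hypothesis deg_neg : forall d f, d < 0 -> Pol f -> degle d f -> f = 0.
Hypothesis deg_al : forall H, H \in A -> degle 1 (al H).
Hypothesis deg_alV : forall H, H \in A -> degle (- 1) (al H)^-1.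

Lemma arrpoly_neq0 : arrpoly != 0.
Proof.
rewrite prodf_seq_neq0; apply/allP => H HA /=; exact: al_neq0.
Qed.

Lemma Pol_0 : Pol 0. Proof. by rewrite -(rmorph0 cst). Qed.
Lemma Pol_1 : Pol 1. Proof. by rewrite -(rmorph1 cst). Qed.
Lemma Pol_opp f : Pol f -> Pol (- f).
Proof.
by move=> hf; rewrite -mulN1r -(rmorph1 cst) -rmorphN; exact: Pol_mul.
Qed.
Lemma Pol_exp f m : Pol f -> Pol (f ^+ m).
Proof.
move=> hf; elim: m => [|m IH]; first by rewrite expr0; exact: Pol_1.
by rewrite exprS; exact: Pol_mul.
Qed.
Lemma Pol_arrpoly : Pol arrpoly.
Proof.
rewrite /arrpoly big_seq; apply: big_ind => [|f g|H HA]; first exact: Pol_1.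
  exact: Pol_mul.
exact: Pol_al.
Qed.

Definition Reg f := exists m, Pol (arrpoly ^+ m * f).

Lemma Reg_Pol f : Pol f -> Reg f.
Proof. by move=> hf; exists 0%N; rewrite expr0 mul1r. Qed.
Lemma Reg_cst c : Reg (cst c). Proof. exact/Reg_Pol/Pol_cst. Qed.
Lemma Reg_mul f g : Reg f -> Reg g -> Reg (f * g).
Proof.
by move=> [m hf] [l hg]; exists (m + l)%N; rewrite exprD mulrACA; exact: Pol_mul.
Qed.
Lemma Reg_add f g : Reg f -> Reg g -> Reg (f + g).
Proof.
move=> [m hf] [l hg]; exists (m + l)%N; rewrite mulrDr; apply: Pol_add.
  by rewrite exprD -mulrA mulrCA; apply: Pol_mul => //; apply/Pol_exp/Pol_arrpoly.
by rewrite exprD -mulrA; apply: Pol_mul => //; apply/Pol_exp/Pol_arrpoly.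
Qed.
Lemma Reg_der xi f : Reg f -> Reg (der xi f).
Proof.
move=> [m hf]; exists m.+1.
have -> : arrpoly ^+ m.+1 * der xi f =
    arrpoly * der xi (arrpoly ^+ m * f) - arrpoly * (der xi (arrpoly ^+ m) * f).
  by rewrite derM mulrDr [X in X - _]addrC addrK exprS mulrA.
apply: Pol_add; first by apply: Pol_mul; [exact: Pol_arrpoly|exact: Pol_der].
apply: Pol_opp; elim: m hf => [|m IH] hf; first by rewrite expr0 der1 mul0r mulr0; exact: Pol_0.
have -> : arrpoly * (der xi (arrpoly ^+ m.+1) * f) = m.+1%:R * der xi arrpoly * (arrpoly ^+ m.+1 * f).
  have -> : der xi (arrpoly ^+ m.+1) = m.+1%:R * arrpoly ^+ m * der xi arrpoly.
    elim: (m) => [|q IHq]; first by rewrite expr0 !expr1 !mul1r.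
    by rewrite exprS derM IHq -[q.+2]addn1 natrD !exprS; ring.
  by rewrite exprS; ring.
apply: Pol_mul => //; apply: Pol_mul; last exact/Pol_der/Pol_arrpoly.
by rewrite -(rmorph_nat cst).
Qed.
Lemma Reg_alV H : H \in A -> Reg (al H)^-1.
Proof.
move=> HA; exists 1%N; rewrite expr1 /arrpoly (bigD1_seq H) ?undup_uniq //=.
rewrite mulrAC divff ?al_neq0 // mul1r -big_filter big_seq.
apply: big_ind => [|f g|H']; [exact: Pol_1|exact: Pol_mul|].
by rewrite mem_filter => /andP[_]; exact: Pol_al.
Qed.
Lemma Reg_afrac H xi : H \in A -> Reg (afrac H xi).
Proof. by move=> HA; apply: Reg_mul; [exact: Reg_cst|exact: Reg_alV]. Qed.

Definition polE (phi : E) := forall u, Pol (phi u).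
Definition regE (phi : E) := forall u, Reg (phi u).
Definition degE d (phi : E) := forall u, degle d (phi u).

Lemma polE0 : polE 0. Proof. by move=> u; rewrite ffunE; exact: Pol_0. Qed.
Lemma polED phi psi : polE phi -> polE psi -> polE (phi + psi).
Proof. by move=> hp hq u; rewrite ffunE; exact: Pol_add. Qed.
Lemma polEZ f phi : Pol f -> polE phi -> polE (f *: phi).
Proof. by move=> hp hq u; rewrite ffunE; exact: Pol_mul. Qed.
Lemma polE_cst c phi : polE phi -> polE (cst c *: phi).
Proof. by apply: polEZ; exact: Pol_cst. Qed.
Lemma polE_basisE u : polE (basisE u).
Proof. by move=> x; rewrite ffunE -(rmorph_nat cst). Qed.
Lemma polE_wact w phi : polE phi -> polE (wact w phi).
Proof. by move=> hp u; rewrite ffunE; exact: Pol_act. Qed.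
Lemma polE_zdiag H phi : polE phi -> polE (zdiag H phi).
Proof.
move=> hp; apply: (big_ind polE) => [||s sS]; [exact: polE0|exact: polED|].
exact/polE_cst/polE_wact.
Qed.
Lemma polE_inO H phi : H \in A -> polE phi -> inO H phi.
Proof. by move=> HA hp u; exact: Pol_O. Qed.
Lemma polE_regE phi : polE phi -> regE phi.
Proof. by move=> hp u; exact: Reg_Pol. Qed.
Lemma polE_of_inO phi : regE phi -> (forall H, H \in A -> inO H phi) -> polE phi.
Proof. by move=> hr hO u; have [m] := hr u; move/Pol_of_O; apply=> H HA; exact: hO. Qed.

Lemma regE0 : regE 0. Proof. exact/polE_regE/polE0. Qed.
Lemma regED phi psi : regE phi -> regE psi -> regE (phi + psi).
Proof. by move=> hp hq u; rewrite ffunE; exact: Reg_add. Qed.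
Lemma regEZ f phi : Reg f -> regE phi -> regE (f *: phi).
Proof. by move=> hp hq u; rewrite ffunE; exact: Reg_mul. Qed.
Lemma regE_sum (I : eqType) (r : seq I) (P : pred I) (F : I -> E) :
  (forall i, i \in r -> P i -> regE (F i)) -> regE (\sum_(i <- r | P i) F i).
Proof.
move=> h; rewrite big_seq_cond; apply: (big_ind regE) => [||i /andP[ir Pi]].
- exact: regE0.
- exact: regED.
- exact: h.
Qed.
Lemma regE_KZ xi phi : regE phi -> regE (KZ xi phi).
Proof.
move=> hp; apply: regED; first by move=> u; rewrite ffunE; exact: Reg_der.
apply: regE_sum => H HA _; apply: regEZ; first exact: Reg_afrac.
apply: regE_sum => s _ _; apply: regEZ; first exact: Reg_cst.
by move=> u; rewrite ffunE.
Qed.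
Lemma regE_dunklE D xi phi : (forall psi, regE psi -> regE (D xi psi)) ->
  polE phi -> regE (dunklE D xi phi).
Proof.
move=> hD hp; apply: regED; first exact/hD/polE_regE.
rewrite -scaleN1r; apply: regEZ; first by rewrite -(rmorphN1 cst); exact: Reg_cst.
apply: regE_sum => H HA _; apply: regEZ; first exact: Reg_afrac.
exact/polE_regE/polE_zdiag.
Qed.

Lemma polE_dunklE_KZ xi phi : polE phi -> polE (dunklE KZ xi phi).
Proof.
move=> hp; apply: polE_of_inO.
  by apply: regE_dunklE => // psi; exact: regE_KZ.
move=> H HA; rewrite (dunklE_dunklH HA).
apply: inOB => //; first exact/inO_dunklH/polE_inO.
apply: inO_sum => // H' HA' ne; apply: inOZ => //; first exact: O_afrac.
exact/polE_inO/polE_zdiag.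
Qed.

Lemma deg_afrac H xi : H \in A -> degle (- 1) (afrac H xi).
Proof. by move=> HA; rewrite -[-1]add0r; apply: deg_mul; [exact: deg_cst|exact: deg_alV]. Qed.
Lemma deg_opp d f : degle d f -> degle d (- f).
Proof.
move=> h; rewrite -mulN1r -(rmorphN1 cst) -[d]add0r; apply: deg_mul h.
exact: deg_cst.
Qed.
Lemma deg_exp d f m : degle d f -> degle (d * m%:Z) (f ^+ m).
Proof.
move=> h; elim: m => [|m IH].
  by rewrite mulr0 expr0 -(rmorph1 cst); exact: deg_cst.
by rewrite exprS -addn1 PoszD mulrDr mulr1 addrC; exact: deg_mul.
Qed.
Lemma deg_arrpoly : degle (size A)%:Z arrpoly.
Proof.
rewrite /arrpoly; have h : {subset A <= A} by [].
elim: {1 3 4}A h => [|H r IH] h.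
  by rewrite big_nil -(rmorph1 cst); exact: deg_cst.
rewrite big_cons /= -add1n PoszD; apply: deg_mul.
  by apply: deg_al; apply: h; rewrite mem_head.
by apply: IH => H' H'r; apply: h; rewrite inE H'r orbT.
Qed.
Lemma deg_arrpolyV : degle (- (size A)%:Z) arrpoly^-1.
Proof.
rewrite /arrpoly; have h : {subset A <= A} by [].
elim: {1 3 4}A h => [|H r IH] h.
  by rewrite big_nil invr1 -(rmorph1 cst) oppr0; exact: deg_cst.
rewrite big_cons /= -add1n PoszD opprD invfM; apply: deg_mul.
  by apply: deg_alV; apply: h; rewrite mem_head.
by apply: IH => H' H'r; apply: h; rewrite inE H'r orbT.
Qed.

Lemma degE0 d : degE d 0. Proof. by move=> u; rewrite ffunE; exact: deg_0. Qed.
Lemma degED d phi psi : degE d phi -> degE d psi -> degE d (phi + psi).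
Proof. by move=> hp hq u; rewrite ffunE; exact: deg_add. Qed.
Lemma degEN d phi : degE d phi -> degE d (- phi).
Proof. by move=> hp u; rewrite ffunE; exact: deg_opp. Qed.
Lemma degEZ d e f phi : degle d f -> degE e phi -> degE (d + e) (f *: phi).
Proof. by move=> hp hq u; rewrite ffunE; exact: deg_mul. Qed.
Lemma degE_cst d c phi : degE d phi -> degE d (cst c *: phi).
Proof. by move=> h; rewrite -[d]add0r; apply: degEZ => //; exact: deg_cst. Qed.
Lemma degE_sum d (I : eqType) (r : seq I) (P : pred I) (F : I -> E) :
  (forall i, i \in r -> P i -> degE d (F i)) -> degE d (\sum_(i <- r | P i) F i).
Proof.
move=> h; rewrite big_seq_cond; apply: (big_ind (degE d)) => [||i /andP[ir Pi]].
- exact: degE0.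
- exact: degED.
- exact: h.
Qed.
Lemma degE_wact d w phi : degE d phi -> degE d (wact w phi).
Proof. by move=> h u; rewrite ffunE; exact: deg_act. Qed.
Lemma degE_derE d xi phi : degE d phi -> degE (d - 1) (derE xi phi).
Proof. by move=> h u; rewrite ffunE; exact: deg_der. Qed.
Lemma degE_afrac_sum d xi (z : {vspace V} -> E) : (forall H, degE d (z H)) ->
  degE (d - 1) (\sum_(H <- A) afrac H xi *: z H).
Proof.
move=> h; apply: degE_sum => H HA _; rewrite addrC; apply: degEZ => //.
exact: deg_afrac.
Qed.
Lemma degE_KZ d xi phi : degE d phi -> degE (d - 1) (KZ xi phi).
Proof.
move=> h; apply: degED; first exact: degE_derE.
apply: degE_afrac_sum => H; apply: degE_sum => s _ _; apply: degE_cst => u.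
by rewrite ffunE.
Qed.
Lemma degE_dunklE D d xi phi : (forall psi, degE d psi -> degE (d - 1) (D xi psi)) ->
  degE d phi -> degE (d - 1) (dunklE D xi phi).
Proof.
move=> hD h; apply: degED; first exact: hD.
apply: degEN; apply: degE_afrac_sum => H; apply: degE_sum => s _ _.
exact/degE_cst/degE_wact.
Qed.
Lemma degE_neg d phi : d < 0 -> polE phi -> degE d phi -> phi = 0.
Proof.
by move=> d0 hp hd; apply/ffunP => u; rewrite ffunE; apply: deg_neg d0 _ _.
Qed.
Lemma degE_le d e phi : d <= e -> degE d phi -> degE e phi.
Proof. by move=> le h u; apply: deg_le (h u). Qed.
Lemma degE_polE phi : polE phi -> exists d : nat, degE d%:Z phi.
Proof.
move=> hp; have /boolp.choice[d hd] : forall u, exists d : nat, degle d%:Z (phi u).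
  by move=> u; exact: deg_Pol.
exists (\max_u d u) => u; apply: deg_le (hd u).
by rewrite lez_nat; exact: leq_bigmax.
Qed.
Lemma degE_basisE u : degE 0 (basisE u).
Proof. by move=> x; rewrite ffunE -(rmorph_nat cst); exact: deg_cst. Qed.

(** * Flatness and nilpotency of the covariant derivatives *)

Lemma curvatureD xi eta phi psi :
  curvature xi eta (phi + psi) = curvature xi eta phi + curvature xi eta psi.
Proof.
have [dD _ _ _] := connection_KZ.
by rewrite /curvature !dD opprD addrACA.
Qed.

Lemma curvatureZ xi eta f phi : curvature xi eta (f *: phi) = f *: curvature xi eta phi.
Proof.
have [dD dZ _ _] := connection_KZ.
have e xi' eta' : KZ xi' (KZ eta' (f *: phi)) =
    der xi' (der eta' f) *: phi + der eta' f *: KZ xi' phi +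
    (der xi' f *: KZ eta' phi + f *: KZ xi' (KZ eta' phi)).
  by rewrite dZ dD !dZ.
rewrite /curvature !e derC scalerBr.
move: (KZ xi (KZ eta phi)) (KZ eta (KZ xi phi)) => P Q.
move: (KZ xi phi) (KZ eta phi) => p q.
by apply/ffunP => u; rewrite !ffunE -![_ *: _]/(_ * _); ring.
Qed.

(* The curvature has polynomial entries, since it is regular along every
   hyperplane, while its entries have degree at most -2. *)
Lemma KZ_flat xi eta phi : KZ xi (KZ eta phi) = KZ eta (KZ xi phi).
Proof.
apply/eqP; rewrite -subr_eq0; apply/eqP; rewrite -/(curvature xi eta phi).
have c0 u : curvature xi eta (basisE u) = 0.
  apply: (@degE_neg (0 - 1 - 1)) => //.
    apply: polE_of_inO => [|H HA]; last exact/inO_curvature/inO_basisE.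
    apply: regED; first exact/regE_KZ/regE_KZ/polE_regE/polE_basisE.
    rewrite -scaleN1r; apply: regEZ; first by rewrite -(rmorphN1 cst); exact: Reg_cst.
    exact/regE_KZ/regE_KZ/polE_regE/polE_basisE.
  apply: degED; first exact/degE_KZ/degE_KZ/degE_basisE.
  exact/degEN/degE_KZ/degE_KZ/degE_basisE.
have curv0 : curvature xi eta 0 = 0.
  by apply: (addrI (curvature xi eta 0)); rewrite -curvatureD !addr0.
rewrite {1}(basisE_sum phi) (big_morph (curvature xi eta) (curvatureD xi eta) curv0).
by apply: big1 => u _; rewrite curvatureZ c0 scaler0.
Qed.

Definition nilp xi (phi : E) := exists N, iter N (KZ xi) phi = 0.

Lemma iter_KZ0 xi N : iter N (KZ xi) 0 = 0.
Proof. by elim: N => [|N IH] //; rewrite iterS IH (conn0 connection_KZ). Qed.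

Lemma nilp_polE xi phi : polE phi -> nilp xi phi.
Proof.
move=> hp; have [d hd] := degE_polE hp.
pose D := (\sum_(H <- A) \sum_(i < ordH rho H) ordH rho H * k H i)%N.
have kD H i : H \in A -> (ordH rho H * kmod H i <= D)%N.
  move=> HA; rewrite /D (bigD1_seq H) ?undup_uniq //=.
  have lti : (i %% ordH rho H < ordH rho H)%N by rewrite ltn_mod ordH_gt0.
  by rewrite (bigD1 (Ordinal lti)) //= -addnA leq_addr.
(* D bounds all n_H k_(H,i), so arrpoly^D nabla_xi^N phi is polynomial; its degree is at most size A
   * D + d - N = -1. *)
pose N := (size A * D + d).+1.
exists N; apply: (scalerI (expf_neq0 D arrpoly_neq0)); rewrite scaler0.
apply: (@degE_neg (- 1)) => //.
  apply: polE_of_inO => [|H HA].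
    apply: regEZ; first exact/Reg_Pol/Pol_exp/Pol_arrpoly.
    elim: N => [|N IH]; first exact: polE_regE.
    by rewrite iterS; exact: regE_KZ.
  have -> : arrpoly ^+ D = (\prod_(H' <- A | H' != H) al H') ^+ D * al H ^+ D.
    by rewrite -exprMn mulrC /arrpoly (bigD1_seq H) ?undup_uniq.
  rewrite -scalerA; apply: inOZ => //.
    apply: O_exp => //; rewrite -big_filter big_seq.
    apply: big_ind => [|f g|H']; [exact: O_1|exact: O_mul|].
    by rewrite mem_filter => /andP[_ HA']; exact: O_al.
  apply: inO_iter_KZ => // [i|eta psi|]; [exact: kD|exact: KZ_flat|exact: polE_inO].
have hN M : degE (d%:Z - M%:Z) (iter M (KZ xi) phi).
  elim: M => [|M IH]; first by rewrite subr0.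
  by rewrite iterS -addn1 PoszD opprD addrA; exact: degE_KZ.
have := degEZ (deg_exp D deg_arrpoly) (hN N); apply: degE_le.
rewrite /N; lia.
Qed.

Lemma nilpD xi phi psi : nilp xi phi -> nilp xi psi -> nilp xi (phi + psi).
Proof.
move=> [N hN] [M hM]; exists (N + M)%N.
have iterKD L p q : iter L (KZ xi) (p + q) = iter L (KZ xi) p + iter L (KZ xi) q.
  have [dD _ _ _] := connection_KZ.
  by elim: L => [|L IH] //; rewrite !iterS IH dD.
by rewrite iterKD {1}addnC !iterD hN hM !iter_KZ0 addr0.
Qed.
Lemma nilp_KZ xi eta phi : nilp xi phi -> nilp xi (KZ eta phi).
Proof.
move=> [N hN]; exists N.
have -> : iter N (KZ xi) (KZ eta phi) = KZ eta (iter N (KZ xi) phi).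
  by elim: (N) => [|L IH] //; rewrite !iterS IH KZ_flat.
by rewrite hN (conn0 connection_KZ).
Qed.
Lemma nilpZ xi f phi : der xi f = 0 -> nilp xi phi -> nilp xi (f *: phi).
Proof.
have [_ dZ _ _] := connection_KZ.
move=> df [N hN]; exists N.
have -> : iter N (KZ xi) (f *: phi) = f *: iter N (KZ xi) phi.
  by elim: (N) => [|L IH] //; rewrite !iterS IH dZ df scale0r add0r.
by rewrite hN scaler0.
Qed.

(** * Flat sections by Taylor expansion *)

Variable X : 'I_(\dim {:V}) -> K.
Hypothesis Pol_X : forall i, Pol (X i).
Hypothesis der_X : forall i j : 'I_(\dim {:V}), der (vbasis {:V})`_i (X j) = (i == j)%:R.

Local Notation bas i := ((vbasis {:V})`_i : V).

Definition flat (phi : E) := regE phi /\ forall xi, KZ xi phi = 0.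

Lemma KZ_basis_eq0 phi : (forall i : 'I_(\dim {:V}), KZ (bas i) phi = 0) ->
  forall xi, KZ xi phi = 0.
Proof.
have [_ _ dL _] := connection_KZ.
have KZ0 psi : KZ 0 psi = 0.
  have := dL (-1) 0 0 psi; rewrite scaler0 add0r rmorphN1 scaleN1r.
  by rewrite addNr.
move=> h xi; rewrite (coord_vbasis (memvf xi)).
elim/big_rec: _ => [|i y _ IH]; first exact: KZ0.
by rewrite dL h scaler0 add0r.
Qed.

Lemma natK_neq0 m : (m.+1%:R : K) != 0.
Proof. by rewrite -(rmorph_nat cst) fmorph_eq0 char0. Qed.

Definition taylor_coef i j : K := (- X i) ^+ j / j`!%:R.

Lemma der_factV xi j : der xi (j`!%:R^-1) = 0.
Proof. by apply: der_inv_eq0; rewrite -(rmorph_nat cst) der_cst. Qed.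

Lemma derN xi f : der xi (- f) = - der xi f.
Proof. by apply: (addrI (der xi f)); rewrite -derD !subrr der0. Qed.

Lemma der_taylor_coef (i l : 'I_(\dim {:V})) j :
  der (bas l) (taylor_coef i j) =
  if l == i then if j is j'.+1 then - taylor_coef i j' else 0 else 0.
Proof.
rewrite /taylor_coef derM der_factV mulr0 addr0.
have -> : der (bas l) ((- X i) ^+ j) = - (j%:R * (- X i) ^+ j.-1 * (l == i)%:R).
  elim: j => [|j IH]; first by rewrite expr0 der1 !mul0r oppr0.
  rewrite exprS derM IH derN der_X -[j.+1]addn1 natrD addn1 /=.
  case: j {IH} => [|j]; first by rewrite !expr0; ring.
  by rewrite /= !exprS; ring.
case: eqP => _; last by rewrite mulr0 oppr0 mul0r.
case: j => [|j]; first by rewrite !mul0r oppr0 mul0r.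
rewrite mulr1 /= factS natrM invfM mulNr; congr (- _).
have := natK_neq0 j; have : (j`!%:R : K) != 0.
  by rewrite -(prednK (fact_gt0 j)) natK_neq0.
by move=> h1 h2; field; rewrite h1 -natr1 in h2 *; rewrite addrC.
Qed.

Lemma Pol_taylor_coef i j : Pol (taylor_coef i j).
Proof.
apply: Pol_mul; first exact/Pol_exp/Pol_opp.
by rewrite -(rmorph_nat cst) -fmorphV.
Qed.

(** If nabla_i^(r+1) phi = 0, the alternating Taylor sum psi = sum_j (-X_i)^j / j! nabla_i^j phi is
    killed by nabla_i, and psi - phi is a polynomial combination of the nabla_i^j phi with j > 0,
    which nabla_i^r kills. Treating the coordinates one after another reduces phi to flat tuples. *)
Lemma flat_induction (Z : E -> Prop) : Z 0 ->
  (forall phi psi, Z phi -> Z psi -> Z (phi + psi)) ->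
  (forall f phi, Pol f -> Z phi -> Z (f *: phi)) ->
  (forall phi, flat phi -> Z phi) ->
  forall phi, polE phi -> Z phi.
Proof.
move=> Z0 ZD ZZ Zflat.
have [dD dZ _ _] := connection_KZ.
set m := \dim {:V}.
(* Here l counts the directions not yet treated: those of index below m - l already kill phi. *)
suff main l : (l <= m)%N -> forall phi, regE phi ->
    (forall i : 'I_m, nilp (bas i) phi) ->
    (forall i : 'I_m, (i < m - l)%N -> KZ (bas i) phi = 0) -> Z phi.
  move=> phi hp; apply: (main m) => //; first exact: polE_regE.
    by move=> i; exact: nilp_polE.
  by move=> i; rewrite subnn.
elim: l => [|l IHl] lm phi regphi nilphi killphi.
  apply: Zflat; split=> //; apply: KZ_basis_eq0 => i; apply: killphi.
  by rewrite subn0.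
have ltm : (m - l.+1 < m)%N by rewrite ltn_subrL /=; exact: leq_ltn_trans lm.
pose i0 := Ordinal ltm; pose D := KZ (bas i0).
have [r hr] := nilphi i0.
elim: r phi hr regphi nilphi killphi => [|r IHr] phi hr regphi nilphi killphi.
  by rewrite /= in hr; rewrite hr.
pose term j := taylor_coef i0 j *: iter j D phi.
have regD j : regE (iter j D phi).
  by elim: j => [|j IH]; [exact: regphi|rewrite iterS; exact: regE_KZ].
have nilD j (i : 'I_m) : nilp (bas i) (iter j D phi).
  by elim: j => [|j IH]; [exact: nilphi|rewrite iterS; exact: nilp_KZ].
have killD j (i : 'I_m) : (i < m - l.+1)%N -> KZ (bas i) (iter j D phi) = 0.
  move=> lti; elim: j => [|j IH]; first exact: killphi.
  by rewrite iterS /D KZ_flat IH (conn0 connection_KZ).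
pose psi := \sum_(0 <= j < r.+1) term j.
have Dpsi : D psi = 0.
  suff -> : D psi = taylor_coef i0 r *: iter r.+1 D phi by rewrite hr scaler0.
  rewrite /psi; elim: (r) => [|q IH].
    rewrite big_nat1 /term /D dZ der_taylor_coef eqxx scale0r add0r; reflexivity.
  rewrite big_nat_recr //= /D dD -/D IH /term /D dZ der_taylor_coef eqxx scaleNr.
  by rewrite addrA subrr add0r.
have -> : phi = psi - \sum_(1 <= j < r.+1) term j.
  rewrite /psi big_ltn // addrK /term /taylor_coef /= expr0 mul1r fact0.
  by rewrite invr1 scale1r.
apply: (ZD).
  apply: IHl; first exact: ltnW.
  - apply: regE_sum => j _ _; apply: regEZ => //.
    exact/Reg_Pol/Pol_taylor_coef.
  - move=> i; have [->|ne] := eqVneq i i0; first by exists 1%N.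
    apply: (big_ind (nilp (bas i))) => [|p q|j _]; first by exists 0%N.
      exact: nilpD.
    by apply: nilpZ => //; rewrite der_taylor_coef (negPf ne).
  - move=> i lti; have [->//|ne] := eqVneq i i0.
    rewrite (conn_sum connection_KZ) big1 // => j _.
    rewrite /term dZ der_taylor_coef (negPf ne) scale0r add0r killD ?scaler0 //.
    move: ne lti; rewrite -val_eqE /= => ne lti; rewrite ltn_neqAle ne /=.
    by move: lti lm; move: (i : nat) => x; lia.
rewrite -scaleN1r; apply: (ZZ); first by rewrite -(rmorphN1 cst); exact: Pol_cst.
rewrite big_seq; apply: big_ind => [//|p q|j]; first exact: ZD.
rewrite mem_index_iota => /andP[j1 jr]; apply: (ZZ); first exact: Pol_taylor_coef.
apply: IHr => //; last by move=> i; exact: killD.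
rewrite -iterD -(subnK jr) in hr *.
have -> : (r + j = r.+1 + (j - 1))%N by lia.
have {}hr : iter r.+1 D phi = 0 by rewrite -hr subnK.
rewrite addnC iterD hr; exact: iter_KZ0.
Qed.
Hypothesis der_const : forall f, (forall xi, der xi f = 0) -> exists c, f = cst c.

(** A free family of flat tuples can be extended unless its span contains every flat tuple; in that
    case, by [flat_induction], it contains all polynomial tuples, hence the standard basis. *)
Lemma flat_basis : exists B : (\dim {:E}).-tuple E,
  basis_of fullv B /\ forall i : 'I_(\dim {:E}), flat B`_i.
Proof.
suff main m : (m <= \dim {:E})%N -> exists s : seq E,
    [/\ size s = m, free s & forall phi, phi \in s -> flat phi].
  have [s [/eqP sz fs hs]] := main _ (leqnn _).
  exists (Tuple sz); split; last by move=> i; apply/hs/mem_nth; rewrite (eqP sz).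
  rewrite basisEfree fs subvf /=; exact/eq_leq/esym/eqP.
elim: m => [|m IH] lm; first by exists [::]; split=> //; exact: nil_free.
have [s [sz fs hs]] := IH (ltnW lm).
have [phi [hphi nphi]] : exists phi, flat phi /\ phi \notin <<s>>%VS.
  apply: contrapT => no.
  have sp phi : polE phi -> phi \in <<s>>%VS.
    move: phi; apply: (flat_induction (Z := fun phi => phi \in <<s>>%VS)) => [|p q|f p _|p hp].
    - exact: mem0v.
    - exact: memvD.
    - exact: memvZ.
    - by apply/negPn/negP => np; apply: no; exists p.
  have full : (fullv <= <<s>>)%VS.
    apply/subvP => phi _; rewrite (basisE_sum phi); apply: memv_suml => u _.
    exact/memvZ/sp/polE_basisE.
  have := leq_trans (dimvS full) (dim_span s); rewrite sz leqNgt => /negP; exact.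
exists (phi :: s); split; first by rewrite /= sz.
  by rewrite free_cons nphi.
by move=> p; rewrite inE => /orP[/eqP->|/hs].
Qed.

Lemma Reg_act w f : Reg f -> Reg (act w f).
Proof.
have Ral H : H \in A -> Reg (act w (al H)^-1).
  move=> HA; have [v av] := alpha_normal alphaP HA.
  have := act_alpha_frac w v HA; rewrite av rmorph1 mul1r => ->.
  by apply: Reg_afrac; exact: rho_hyperplanes.
have Rd : Reg (act w arrpoly^-1).
  rewrite /arrpoly -prodfV rmorph_prod /= big_seq.
  by apply: big_ind => [|f1 f2|//]; [exact/Reg_Pol/Pol_1|exact: Reg_mul].
move=> [m hm]; have -> : f = arrpoly^-1 ^+ m * (arrpoly ^+ m * f).
  by rewrite mulrA -exprMn mulVf ?arrpoly_neq0 // expr1n mul1r.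
rewrite rmorphM rmorphXn /=; apply: Reg_mul; last exact/Reg_Pol/Pol_act.
elim: (m) => [|q IH]; first by rewrite expr0; exact/Reg_Pol/Pol_1.
by rewrite exprS; exact: Reg_mul.
Qed.

Lemma regE_wact w phi : regE phi -> regE (wact w phi).
Proof. by move=> h u; rewrite ffunE; exact: Reg_act. Qed.

Lemma regE_bound phi : regE phi -> exists m, polE (arrpoly ^+ m *: phi).
Proof.
move=> /boolp.choice[m hm]; exists (\max_u m u) => u; rewrite ffunE.
have le : (m u <= \max_u m u)%N by exact: leq_bigmax.
by rewrite -[_ *: _]/(_ * _) -(subnK le) exprD -mulrA; apply: Pol_mul (hm u); exact/Pol_exp/Pol_arrpoly.
Qed.

(** * Horizontal endomorphisms and their pseudo-inverses *)

Definition linE (th : E -> E) :=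
  (forall phi psi, th (phi + psi) = th phi + th psi) /\
  (forall f phi, th (f *: phi) = f *: th phi).

Lemma linE0 th : linE th -> th 0 = 0.
Proof. by move=> [tD _]; apply: (addrI (th 0)); rewrite -tD !addr0. Qed.

Lemma linE_sum th (I : Type) (r : seq I) (P : pred I) (F : I -> E) : linE th ->
  th (\sum_(i <- r | P i) F i) = \sum_(i <- r | P i) th (F i).
Proof. by move=> tl; case: (tl) => tD _; exact: (big_morph th tD (linE0 tl)). Qed.

Lemma linE_basisE th phi : linE th -> th phi = \sum_u phi u *: th (basisE u).
Proof.
move=> tl; rewrite {1}(basisE_sum phi) linE_sum //; apply: eq_bigr => u _.
by case: tl.
Qed.

Lemma linE_orbit_map v : linE (orbit_map v).
Proof. by split; [exact: orbit_mapD|exact: orbit_mapZ]. Qed.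

Lemma coord_KZ (B : (\dim {:E}).-tuple E) : basis_of fullv B ->
  (forall i : 'I_(\dim {:E}), flat B`_i) ->
  forall xi i phi, coord B i (KZ xi phi) = der xi (coord B i phi).
Proof.
move=> bB fB xi i phi; have [_ dZ _ _] := connection_KZ.
have -> : KZ xi phi = \sum_j der xi (coord B j phi) *: B`_j.
  rewrite {1}(coord_basis bB (memvf phi)) (conn_sum connection_KZ).
  apply: eq_bigr => j _; have [_ kj] := fB j.
  by rewrite dZ kj scaler0 addr0.
by rewrite coord_sum_free ?(basis_free bB).
Qed.

(** The coordinates of a flat tuple are constants, and [flat_induction] does the rest. So polynomial
    tuples have polynomial coordinates although B itself may have poles. *)
Lemma coord_polE (B : (\dim {:E}).-tuple E) : basis_of fullv B ->
  (forall i : 'I_(\dim {:E}), flat B`_i) ->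
  forall phi i, polE phi -> Pol (coord B i phi).
Proof.
move=> bB fB phi i hp; move: phi hp i.
apply: (flat_induction (Z := fun phi => forall i, Pol (coord B i phi))).
- by move=> i; rewrite linear0; exact: Pol_0.
- by move=> phi psi hp hq i; rewrite linearD; exact: (Pol_add (hp i) (hq i)).
- by move=> f phi hf hp i; rewrite linearZ; exact: (Pol_mul hf (hp i)).
move=> phi [_ fphi] i; have [xi|c ->] := @der_const (coord B i phi); last exact: Pol_cst.
by rewrite -(coord_KZ bB fB) fphi linear0.
Qed.

(* In a basis of flat sections a horizontal endomorphism has a constant matrix,
   whose pseudo-inverse again defines a horizontal endomorphism. *)
Lemma flat_pseudo_inverse th : linE th ->
  (forall xi phi, th (KZ xi phi) = KZ xi (th phi)) ->
  exists eta, [/\ linE eta, forall xi phi, eta (KZ xi phi) = KZ xi (eta phi),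
    forall phi, polE phi -> regE (eta phi) &
    forall phi, th (eta (th phi)) = th phi].
Proof.
move=> thl thK; have [thD thZ] := thl; have [_ dZ _ _] := connection_KZ.
have [B [bB fB]] := flat_basis; have cK := coord_KZ bB fB.
pose n := \dim {:E}.
pose op (M : 'M[C]_n) (phi : E) : E :=
  \sum_i coord B i phi *: \sum_j cst (M i j) *: B`_j.
have opl M : linE (op M).
  split=> [phi psi|f phi].
    rewrite /op -big_split; apply: eq_bigr => i _.
    by rewrite linearD scalerDl.
  rewrite /op scaler_sumr; apply: eq_bigr => i _.
  by rewrite linearZ scalerA.
have opB M (i : 'I_n) : op M B`_i = \sum_j cst (M i j) *: B`_j.
  rewrite /op (bigD1 i) //= [X in _ + X]big1 => [|j ji].
    by rewrite coord_free ?(basis_free bB) // eqxx scale1r addr0.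
  by rewrite coord_free ?(basis_free bB) // eq_sym (negPf ji) scale0r.
have ext (f g : E -> E) : linE f -> linE g -> (forall i : 'I_n, f B`_i = g B`_i) -> f =1 g.
  move=> fl gl fg phi; rewrite (coord_basis bB (memvf phi)) !linE_sum //.
  by apply: eq_bigr => i _; case: fl => _ ->; case: gl => _ ->; rewrite fg.
have opK M xi phi : op M (KZ xi phi) = KZ xi (op M phi).
  rewrite /op (conn_sum connection_KZ); apply: eq_bigr => i _.
  rewrite cK dZ (conn_sum connection_KZ) [X in _ + _ *: X]big1 ?scaler0 ?addr0 // => j _.
  by have [_ kj] := fB j; rewrite dZ kj scaler0 der_cst scale0r addr0.
(* Row i of a matrix holds the image of the i-th basis vector, hence the reversed product. *)
have opM M N phi : op M (op N phi) = op (N *m M) phi.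
  move: phi; apply: ext => [||i].
  - by split=> [p q|f p]; case: (opl N) => nD nZ; case: (opl M) => mD mZ; rewrite ?nD ?mD ?nZ ?mZ.
  - exact: opl.
  rewrite !opB linE_sum //; under eq_bigr => j _.
    case: (opl M) => _ ->; rewrite opB scaler_sumr; over.
  rewrite exchange_big /=; apply: eq_bigr => j _.
  rewrite mxE rmorph_sum scaler_suml; apply: eq_bigr => l _.
  by rewrite scalerA rmorphM.
have /boolp.choice[c hc] : forall ij : 'I_n * 'I_n, exists c,
    coord B ij.2 (th B`_ij.1) = cst c.
  move=> [i j] /=; apply: der_const => xi; rewrite -cK -thK.
  by have [_ ->] := fB i; rewrite linE0 // linear0.
pose M := \matrix_(i, j) c (i, j).
have thE : th =1 op M.
  apply: ext => // i; rewrite opB {1}(coord_basis bB (memvf (th B`_i))).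
  by apply: eq_bigr => j _; rewrite mxE -hc.
exists (op (pinvmx M)); split=> // [phi hp|phi].
  apply: regE_sum => i _ _; apply: regEZ; first exact/Reg_Pol/(coord_polE bB fB).
  apply: regE_sum => j _ _; apply: regEZ; first exact: Reg_cst.
  by case: (fB j).
by rewrite !thE !opM mulmxA mulmxKpV.
Qed.

(** Averaging the conjugates w eta w^-1 preserves the property of a pseudo-inverse, since th w eta
    w^-1 th = w (th eta th) w^-1 = th for equivariant th. *)
Lemma equivariant_pseudo_inverse th : linE th ->
  (forall xi phi, th (KZ xi phi) = KZ xi (th phi)) ->
  (forall w phi, th (wact w phi) = wact w (th phi)) ->
  exists eta, [/\ linE eta, forall xi phi, eta (KZ xi phi) = KZ xi (eta phi),
    forall w phi, eta (wact w phi) = wact w (eta phi),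
    forall phi, polE phi -> regE (eta phi) &
    forall phi, th (eta (th phi)) = th phi].
Proof.
move=> thl thK thW; have [eta [el eK eR eP]] := flat_pseudo_inverse thl thK.
have [eD eZ] := el; have [thD thZ] := thl.
have [dD dZ _ dW] := connection_KZ.
pose av phi := cst #|W|%:R^-1 *: \sum_w wact w (eta (wact w^-1%g phi)).
exists av; split.
- split=> [phi psi|f phi]; rewrite /av.
    rewrite -scalerDr -big_split; congr (_ *: _); apply: eq_bigr => w _.
    by rewrite wactD eD wactD.
  rewrite [RHS]scalerA [f * _]mulrC -[RHS]scalerA; congr (_ *: _).
  by rewrite scaler_sumr; apply: eq_bigr => w _; rewrite wactZ eZ wactZ -actM mulgV act1.
- move=> xi phi; rewrite /av dZ der_cst scale0r add0r (conn_sum connection_KZ).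
  congr (_ *: _); apply: eq_bigr => w _; rewrite !dW eK dW.
  by rewrite (rhoVK rho1 rhoM).
- move=> w phi; rewrite /av wactZ act_cst wact_sum; congr (_ *: _).
  rewrite (reindex_inj (mulgI w)) /=; apply: eq_bigr => x _.
  rewrite -[RHS]wactM; congr (wact _ (eta _)).
  by rewrite -wactM invMg mulgKV.
- move=> phi hp; apply: regEZ; first exact: Reg_cst.
  apply: regE_sum => w _ _; exact/regE_wact/eR/polE_wact.
- move=> phi; rewrite /av thZ linE_sum //.
  rewrite (eq_bigr (fun=> th phi)) => [|w _].
    rewrite sumr_const -scaler_nat scalerA -(rmorph_nat cst) -rmorphM mulVf ?rmorph1 ?scale1r //.
    by rewrite char0 -lt0n (cardD1 1%g).
  by rewrite thW -(thW w^-1%g) eP thW -wactM mulgV wact1.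
Qed.

(** [KZ] and its Dunkl operators differ by a combination of W-translations, with which an
    equivariant linear map commutes. *)
Lemma horizontal_dunklE eta : linE eta ->
  (forall xi phi, eta (KZ xi phi) = KZ xi (eta phi)) ->
  (forall w phi, eta (wact w phi) = wact w (eta phi)) ->
  forall xi phi, eta (dunklE KZ xi phi) = dunklE KZ xi (eta phi).
Proof.
move=> el eK eW xi phi; have [eD eZ] := el.
rewrite /dunklE eD eK -scaleN1r eZ scaleN1r; congr (_ - _).
rewrite linE_sum //; apply: eq_bigr => H _; rewrite eZ linE_sum //; congr (_ *: _).
by apply: eq_bigr => s _; rewrite eZ eW.
Qed.

Lemma horizontal_of_dunklE th : linE th ->
  (forall xi phi, th (dunklE KZ xi phi) = dunklE KZ xi (th phi)) ->
  (forall w phi, th (wact w phi) = wact w (th phi)) ->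
  forall xi phi, th (KZ xi phi) = KZ xi (th phi).
Proof.
move=> el eT eW xi phi; have [eD eZ] := el.
rewrite !KZ_dunklE eD eT; congr (_ + _).
rewrite linE_sum //; apply: eq_bigr => H _; rewrite eZ linE_sum //; congr (_ *: _).
by apply: eq_bigr => s _; rewrite eZ eW.
Qed.

(** The image of the polynomial tuples is stable under W and the Dunkl operators, and its poles are
    bounded because eta is determined by the finitely many eta (1 (x) u). Along each hyperplane
    [lattice_bound_step] then lowers the pole order to 0. *)
Lemma horizontal_polE eta : linE eta ->
  (forall xi phi, eta (KZ xi phi) = KZ xi (eta phi)) ->
  (forall w phi, eta (wact w phi) = wact w (eta phi)) ->
  (forall phi, polE phi -> regE (eta phi)) ->
  forall phi, polE phi -> polE (eta phi).
Proof.
move=> el eK eW eR; have [eD eZ] := el.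
have eT := horizontal_dunklE el eK eW.
have /boolp.choice[m hm] : forall u, exists m, polE (arrpoly ^+ m *: eta (basisE u)).
  by move=> u; apply/regE_bound/eR/polE_basisE.
pose N := \max_u m u.
have hN phi : polE phi -> polE (arrpoly ^+ N *: eta phi).
  move=> hp; rewrite (linE_basisE _ el) scaler_sumr.
  apply: (big_ind polE) => [||u _]; [exact: polE0|exact: polED|].
  have le : (m u <= N)%N by exact: leq_bigmax.
  rewrite scalerA mulrC -scalerA -(subnK le) exprD -scalerA.
  by apply: polEZ => //; apply: polEZ (hm u); exact/Pol_exp/Pol_arrpoly.
move=> phi hp; apply: polE_of_inO => [|H HA]; first exact: eR.
pose Y psi := exists2 p, polE p & psi = eta p.
have YO r : (r <= N)%N -> forall psi, Y psi -> inO H (al H ^+ (N - r) *: psi).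
  elim: r => [|r IH] rN psi.
    move=> [p pp ->]; rewrite subn0.
    have -> : al H ^+ N = (\prod_(H' <- A | H' != H) al H')^-1 ^+ N * arrpoly ^+ N.
      rewrite -exprMn /arrpoly (bigD1_seq H) ?undup_uniq //= mulrCA mulVf ?mulr1 //.
      rewrite -big_filter prodf_seq_neq0; apply/allP => H'.
      by rewrite mem_filter => /andP[_ HA'] /=; exact: al_neq0.
    rewrite -scalerA; apply: inOZ => //; last exact/polE_inO/hN.
    apply: O_exp => //; rewrite -prodfV -big_filter big_seq.
    apply: big_ind => [|f g|H']; [exact: O_1|exact: O_mul|].
    by rewrite mem_filter => /andP[ne HA']; exact: O_alV.
  apply: (lattice_bound_step HA (X := Y)) => //.
  - by exists 0; [exact: polE0|rewrite linE0].
  - by move=> _ _ [p pp ->] [q pq ->]; exists (p + q); [exact: polED|rewrite eD].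
  - by move=> c _ [p pp ->]; exists (cst c *: p); [exact: polE_cst|rewrite eZ].
  - by move=> w _ [p pp ->]; exists (wact w p); [exact: polE_wact|rewrite eW].
  - move=> xi _ [p pp ->]; exists (dunklE KZ xi p); last by rewrite eT.
    exact: polE_dunklE_KZ.
  - by move=> p; rewrite subnSK //; apply: IH; exact: ltnW.
have := YO N (leqnn _) (eta phi); rewrite subnn expr0 scale1r; apply.
by exists phi.
Qed.

(** * Singular vectors and order at the origin *)

Variable ord : nat -> K -> Prop.
Hypothesis ord_0 : forall m, ord m 0.
Hypothesis ord_add : forall m f g, ord m f -> ord m g -> ord m (f + g).
Hypothesis ord_mul : forall m l f g, ord m f -> ord l g -> ord (m + l) (f * g).
Hypothesis ord_act : forall m w f, ord m f -> ord m (act w f).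
Hypothesis ord_Pol : forall f, Pol f -> ord 0 f.
Hypothesis ord_inf : forall f, (forall m, ord m f) -> f = 0.
Hypothesis ord_const : forall f, Pol f -> exists c, ord 1 (f - cst c).
Hypothesis act_faithful : forall w, w != 1%g -> exists2 f, Pol f & act w f != f.

Definition ordE m (phi : E) := forall u, ord m (phi u).

Lemma ordE_linE th m l phi : linE th -> (forall u, ordE l (th (basisE u))) ->
  ordE m phi -> ordE (m + l) (th phi).
Proof.
move=> tl h hp; rewrite (linE_basisE _ tl).
apply: (big_ind (ordE _)) => [u|p q hu hv u|u _ x].
- rewrite ffunE; exact: ord_0.
- by rewrite ffunE; exact: ord_add.
- by rewrite ffunE; apply: ord_mul; [exact: hp|exact: h].
Qed.

Definition singular phi := forall xi, dunklE KZ xi phi = 0.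

Lemma singular_wact w phi : singular phi -> singular (wact w phi).
Proof.
move=> h xi; rewrite -[xi](rhoVK rho1 rhoM w) -(dunklE_wact connection_KZ) h.
exact: wact0.
Qed.

(* The horizontal endomorphism theta of the standard module determined by a
   singular vector raises the order of vanishing at the origin; for a
   pseudo-inverse eta, the idempotent eta theta raises it as well, hence is 0. *)
Lemma singular_ord1_eq0 v : polE v -> singular v -> ordE 1 v -> v = 0.
Proof.
move=> pv sv ov.
have thl := linE_orbit_map v; have thW w phi := orbit_map_wact v w phi.
have thT xi phi : orbit_map v (dunklE KZ xi phi) = dunklE KZ xi (orbit_map v phi).
  rewrite orbit_map_dunklE; last exact: connection_KZ.
  rewrite [X in _ + X]big1 ?addr0 // => u _.
  by rewrite singular_wact // scaler0.
have thK := horizontal_of_dunklE thl thT thW.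
have [eta [el eK eW eR eP]] := equivariant_pseudo_inverse thl thK thW.
have ep := horizontal_polE el eK eW eR.
pose pr phi := eta (orbit_map v phi).
have prl : linE pr.
  by case: thl => tD tZ; case: el => eD eZ; split=> *; rewrite /pr ?tD ?eD ?tZ ?eZ.
have prpr phi : pr (pr phi) = pr phi by rewrite /pr eP.
have pr1 u : ordE 1 (pr (basisE u)).
  rewrite /pr orbit_map_basisE -[1%N]addn0; apply: ordE_linE => // [x y|x].
    exact/ord_Pol/ep/polE_basisE.
  by rewrite ffunE; exact: ord_act.
(* As [pr] is idempotent, its values on the basis may be substituted into themselves, and each
   substitution adds one to the order. *)
have prN m u : ordE m.+1 (pr (basisE u)).
  by elim: m => [|m IH] //; rewrite -prpr -[m.+2]addn1; exact: ordE_linE.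
have pr0 u : pr (basisE u) = 0.
  apply/ffunP => x; rewrite ffunE; apply: ord_inf => -[|m]; last exact: prN.
  rewrite /pr orbit_map_basisE; apply/ord_Pol/ep; exact: polE_wact.
(* v is the image of 1 (x) 1 under theta = theta eta theta, and eta theta is zero on the basis. *)
rewrite -[v]wact1 -orbit_map_basisE -eP -[eta _]/(pr _) pr0.
exact: orbit_map0.
Qed.

(** * Constants, left ideals of CW and spherical submodules *)

Definition constE (a : {ffun W -> C^o}) : E := [ffun u => cst (a u)].

Lemma constE_sum a : constE a = \sum_u cst (a u) *: basisE u.
Proof. by rewrite {1}(basisE_sum (constE a)); apply: eq_bigr => u _; rewrite ffunE. Qed.

Lemma polE_constE a : polE (constE a).
Proof. by move=> u; rewrite ffunE. Qed.

Lemma singular_constE a : singular (constE a).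
Proof.
have [_ dZ _ _] := connection_KZ.
move=> xi; rewrite constE_sum (dunklE_sum connection_KZ); apply: big1 => u _.
rewrite (dunklE_scale connection_KZ) dunklE_KZ_basisE scaler0 add0r der_cst scale0r add0r.
rewrite /refl_diff big1 // => H _; rewrite big1 ?scaler0 // => s _.
by rewrite act_cst subrr mulr0 scale0r.
Qed.

(** A subspace of largest dimension inside U exhausts U, since a further vector of U would enlarge
    it. This makes the projection [projv] available for a predicate. *)
Lemma vspace_of_set (vT : vectType C) (U : vT -> Prop) : U 0 ->
  (forall x y, U x -> U y -> U (x + y)) -> (forall c x, U x -> U (c *: x)) ->
  exists F : {vspace vT}, forall x, U x <-> x \in F.
Proof.
move=> U0 UD UZ.
pose P m := `[< exists F : {vspace vT}, \dim F = m /\ forall x, x \in F -> U x >].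
have P0 : exists m, P m.
  exists 0%N; apply/asboolP; exists 0%VS; rewrite dimv0; split=> // x.
  by rewrite memv0 => /eqP->.
have Pb m : P m -> (m <= \dim {:vT})%N.
  by move=> /asboolP[F [<- _]]; exact/dimvS/subvf.
case: (ex_maxnP P0 Pb) => m /asboolP[F [dF hF]] hmax.
exists F => x; split=> [Ux|]; last exact: hF.
apply/negPn/negP => nx.
have : P (\dim (F + <[x]>)%VS).
  apply/asboolP; exists (F + <[x]>)%VS; split=> // y.
  move=> /memv_addP[a aF [b /vlineP[c ->] ->]].
  by apply: UD; [exact: hF|exact: UZ].
move=> /hmax; rewrite leqNgt -dF => /negP; apply.
rewrite ltn_neqAle dimvS ?addvSl // andbT; apply/eqP => e.
have : F == (F + <[x]>)%VS by rewrite eqEdim addvSl e leqnn.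
move=> /eqP eF; case/negP: nx; rewrite eF.
by apply: (subvP (addvSr _ _)); exact: memv_line.
Qed.

(* Maschke: average a projection onto the left ideal U. *)
Lemma left_ideal_right_identity (Y : E -> Prop) : Y 0 ->
  (forall phi psi, Y phi -> Y psi -> Y (phi + psi)) ->
  (forall c phi, Y phi -> Y (cst c *: phi)) ->
  (forall w phi, Y phi -> Y (wact w phi)) ->
  exists b, Y (constE b) /\
    forall a, Y (constE a) -> orbit_map (constE b) (constE a) = constE a.
Proof.
move=> Y0 YD YZ YW.
have cD (a b : {ffun W -> C^o}) : constE (a + b) = constE a + constE b.
  by apply/ffunP => u; rewrite !ffunE rmorphD.
have cZ c (a : {ffun W -> C^o}) : constE (c *: a) = cst c *: constE a.
  by apply/ffunP => u; rewrite !ffunE rmorphM.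
have c0 : constE 0 = 0 by apply/ffunP => u; rewrite !ffunE rmorph0.
have [||c x Yx|F hF] := @vspace_of_set _ (fun a => Y (constE a)).
- by rewrite c0.
- by move=> x y hx hy; rewrite cD; exact: YD.
- by rewrite cZ; exact: YZ.
pose tr (w : W) (a : {ffun W -> C^o}) : {ffun W -> C^o} := [ffun u => a (w^-1 * u)%g].
have ctr w a : constE (tr w a) = wact w (constE a).
  by apply/ffunP => u; rewrite !ffunE act_cst.
pose e1 (w : W) : {ffun W -> C^o} := [ffun u => (u == w)%:R].
(* b is the value at 1 of the W-average of the projection onto F; by equivariance the value of this
   average at a is the product a b. *)
pose b := #|W|%:R^-1 *: \sum_w tr w (projv F (e1 w^-1%g)).
have W0 : #|W|%:R != 0 :> C by rewrite char0 -lt0n (cardD1 1%g).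
have csum (G : W -> {ffun W -> C^o}) : constE (\sum_w G w) = \sum_w constE (G w).
  exact: (big_morph _ cD c0).
have Yproj a : Y (constE (projv F a)) by apply/hF; exact: memv_proj.
exists b; split.
  rewrite /b cZ csum; apply: YZ; apply: big_ind => // w _; rewrite ctr; exact: YW.
move=> a /hF aF.
have e : orbit_map (constE b) (constE a) =
    constE (#|W|%:R^-1 *: \sum_w tr w (projv F (tr w^-1%g a))).
  rewrite /orbit_map /b !cZ !csum.
  under eq_bigr => u _ do rewrite wactZ act_cst wact_sum scalerA mulrC -scalerA.
  rewrite -scaler_sumr; congr (_ *: _).
  under eq_bigr => u _ do rewrite scaler_sumr (reindex_inj (mulgI u^-1%g)) /=.
  rewrite exchange_big /=; apply: eq_bigr => w _.
  have -> : tr w^-1%g a = \sum_u a u *: e1 (w^-1 * u)%g.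
    apply/ffunP => x; rewrite sum_ffunE ffunE invgK (bigD1 (w * x)%g) //= big1 => [|u ne].
      by rewrite !ffunE mulKg eqxx addr0 -[_ *: _]/(_ * _) mulr1.
    rewrite !ffunE -(inj_eq (mulgI w)) mulKVg eq_sym (negPf ne).
    exact: scaler0.
  rewrite linear_sum /= ctr csum wact_sum; apply: eq_bigr => u _.
  rewrite linearZ /= cZ wactZ act_cst ctr -wactM ffunE; congr (_ *: wact _ (constE (projv F (e1 _)))).
    by rewrite mulKVg.
  by rewrite invMg invgK.
have trK w : tr w (tr w^-1%g a) = a.
  by apply/ffunP => u; rewrite !ffunE invgK mulKVg.
rewrite e; congr constE.
rewrite (eq_bigr (fun=> a)) => [|w _]; last first.
  rewrite projv_id ?trK //; apply/hF; rewrite ctr; apply: YW; exact/hF.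
by rewrite sumr_const -scaler_nat scalerA mulVf // scale1r.
Qed.

(* Artin's independence of characters. *)
Lemma act_independent (s : seq W) (b : W -> K) : uniq s ->
  (forall f, Pol f -> \sum_(w <- s) act w f * b w = 0) ->
  forall w, w \in s -> b w = 0.
Proof.
elim: s b => [|w1 s IH] b //= /andP[w1s us] h.
have tl w : w \in s -> b w = 0.
  move=> ws; have [|p Pp ne] := @act_faithful (w1^-1 * w)%g.
    by apply/eqP => e; move: w1s; rewrite -[w1]mulg1 -e mulKVg ws.
  have ne' : act w p - act w1 p != 0.
    rewrite subr_eq0; apply: contra ne => /eqP e.
    by rewrite actM e -actM mulVg act1.
  have := IH (fun w => (act w p - act w1 p) * b w) us _ w ws.
  move=> IHw; apply/(mulfI ne'); rewrite mulr0; apply: IHw => f Pf.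
  have := h _ (Pol_mul Pp Pf); have := h _ Pf; rewrite !big_cons => h1 h2.
  have : (act w1 (p * f) * b w1 + \sum_(j <- s) act j (p * f) * b j)
     - act w1 p * (act w1 f * b w1 + \sum_(j <- s) act j f * b j) = 0.
    by rewrite h1 h2 mulr0 subrr.
  rewrite mulrDr opprD addrACA rmorphM mulrA subrr add0r mulr_sumr -sumrB => h'.
  by rewrite -[RHS]h'; apply: eq_bigr => x _; rewrite rmorphM /=; ring.
move=> w; rewrite inE => /orP[/eqP->|]; last exact: tl.
have := h 1 Pol_1; rewrite big_cons rmorph1 mul1r big_seq big1 ?addr0 //.
by move=> x xs; rewrite tl // mulr0.
Qed.

Definition symE (phi : E) : E := \sum_w wact w phi.

(** The component of symE (f phi) at u is sum_w w(f) w(phi(w^-1 u)). By [act_independent] every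
    coefficient vanishes, in particular phi u, the one at w = 1. *)
Lemma symE_eq0 phi : (forall f, Pol f -> symE (f *: phi) = 0) -> phi = 0.
Proof.
move=> h; apply/ffunP => u; rewrite ffunE.
have h0 := @act_independent (enum W) (fun w => act w (phi (w^-1 * u)%g)) (enum_uniq _).
have := h0 _ 1%g (mem_enum _ _); rewrite act1 invg1 mul1g; apply=> f Pf.
have := congr1 (fun psi : E => psi u) (h f Pf); rewrite /symE sum_ffunE ffunE => e.
by rewrite -[RHS]e big_enum; apply: eq_bigr => w _; rewrite !ffunE rmorphM.
Qed.

Lemma linE_symE th : linE th -> (forall w phi, th (wact w phi) = wact w (th phi)) ->
  forall phi, th (symE phi) = symE (th phi).
Proof. by move=> tl tW phi; rewrite /symE linE_sum //; apply: eq_bigr => w _. Qed.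

(* The constants in Y form a left ideal of CW, with right identity b; let p be the
   induced projection. A vector of Y of least degree not fixed by p would yield
   a nonconstant singular vector phi - p phi. *)
Lemma standard_spherical (Y : E -> Prop) :
  (forall phi psi, Y phi -> Y psi -> Y (phi + psi)) ->
  (forall f phi, Pol f -> Y phi -> Y (f *: phi)) ->
  (forall w phi, Y phi -> Y (wact w phi)) ->
  (forall xi phi, polE phi -> Y phi -> Y (dunklE KZ xi phi)) ->
  (forall phi, polE phi -> Y (symE phi)) ->
  Y (basisE 1%g).
Proof.
move=> YD YZ YW YT Ye.
have Y0 : Y 0.
  have := Ye _ polE0; rewrite /symE big1 // => w _; exact: wact0.
have YC c phi : Y phi -> Y (cst c *: phi) by apply: YZ.
have [b [Yb hb]] := left_ideal_right_identity Y0 YD YC YW.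
pose p := orbit_map (constE b).
have [pD pZ] : linE p := linE_orbit_map (constE b).
have pW w phi : p (wact w phi) = wact w (p phi) by exact: orbit_map_wact.
have pT xi phi : p (dunklE KZ xi phi) = dunklE KZ xi (p phi).
  rewrite /p orbit_map_dunklE; last exact: connection_KZ.
  rewrite [X in _ + X]big1 ?addr0 // => u _.
  by rewrite singular_wact ?scaler0 //; exact: singular_constE.
have pY phi : polE phi -> Y (p phi).
  by move=> hp; apply: (big_ind Y) => // u _; apply: (YZ) => //; exact: YW.
have pP phi : polE phi -> polE (p phi).
  move=> hp; apply: (big_ind polE) => [||u _]; [exact: polE0|exact: polED|].
  apply: polEZ => //; exact/polE_wact/polE_constE.
have pp phi : p (p phi) = p phi.
  have -> : p (p phi) = \sum_u p (phi u *: wact u (constE b)).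
    exact: (linE_sum _ _ _ (linE_orbit_map (constE b))).
  by apply: eq_bigr => u _; rewrite pZ pW /p hb.
have main (N : nat) phi : Y phi -> polE phi -> degE (N%:Z - 1) phi -> p phi = phi.
  elim: N phi => [|N IH] phi Yp hp hd.
    have -> : phi = 0 by apply: degE_neg hd.
    exact: orbit_map0.
  pose psi := phi - p phi.
  have psiY : Y psi.
    by apply: (YD) => //; rewrite -scaleN1r -(rmorphN1 cst); apply/YC/pY.
  have psiP : polE psi.
    by apply: polED => //; rewrite -scaleN1r -(rmorphN1 cst); apply/polE_cst/pP.
  have psiS : singular psi.
    move=> xi; rewrite /psi (dunklED connection_KZ).
    have -> : dunklE KZ xi (- p phi) = - dunklE KZ xi (p phi).
      apply: (addrI (dunklE KZ xi (p phi))).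
      by rewrite -(dunklED connection_KZ) !subrr (dunklE0 connection_KZ).
    rewrite -pT IH ?subrr //; [exact: YT|exact: polE_dunklE_KZ|].
    have -> : N%:Z - 1 = (N.+1%:Z - 1) - 1 by lia.
    by apply: degE_dunklE => // q; exact: degE_KZ.
  (* Without its constant term psi is a singular vector of positive order, hence zero; so psi is
     constant. Constants in Y are fixed by p, whereas p psi = 0. *)
  have /boolp.choice[c hc] : forall u, exists c, ord 1 (psi u - cst c).
    by move=> u; exact: ord_const.
  have psiC : psi = constE [ffun u => c u].
    apply/eqP; rewrite -subr_eq0; apply/eqP; apply: singular_ord1_eq0.
    - apply: polED => //; rewrite -scaleN1r -(rmorphN1 cst).
      exact/polE_cst/polE_constE.
    - move=> xi; rewrite (dunklED connection_KZ) psiS add0r.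
      apply: (addrI (dunklE KZ xi (constE [ffun u => c u]))).
      rewrite -(dunklED connection_KZ) subrr (dunklE0 connection_KZ) addr0.
      by rewrite singular_constE.
    - move=> u; have -> : (psi - constE [ffun u => c u]) u = psi u - cst (c u).
        by rewrite ffunE; congr (_ + _); rewrite !ffunE.
      exact: hc.
  have : p psi = psi by rewrite {1}psiC /p hb -?psiC.
  have -> : p psi = 0.
    by rewrite /psi pD -scaleN1r pZ pp scaleN1r subrr.
  by move=> /esym/eqP; rewrite subr_eq0 => /eqP.
(* For polynomial f put q = f (1 - b). Then p q = f (b - b b) = 0, while symE q lies in Y and is
   fixed by p; so symE q = symE (p q) = 0 for all f, which forces 1 = b. *)
suff q0 : basisE 1%g - constE b = 0.
  by move/eqP: q0; rewrite subr_eq0 => /eqP->.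
have p1 : p (basisE 1%g) = constE b by rewrite /p orbit_map_basisE wact1.
have qP : polE (basisE 1%g - constE b).
  apply: polED; first exact: polE_basisE.
  by rewrite -scaleN1r -(rmorphN1 cst); exact/polE_cst/polE_constE.
apply: symE_eq0 => f Pf; set q := f *: _.
have qfP : polE q by exact: polEZ.
have sP : polE (symE q).
  apply: (big_ind polE) => [||w _]; [exact: polE0|exact: polED|exact: polE_wact].
have [d hd] := degE_polE sP.
rewrite -(main d.+1 (symE q)) //; [|exact: Ye|]; last first.
  by apply: degE_le hd; lia.
rewrite (linE_symE (conj pD pZ) pW) /q pZ pD.
have -> : p (- constE b) = - constE b by rewrite -scaleN1r pZ /p hb.
rewrite p1 subrr scaler0 /symE big1 // => w _; exact: wact0.
Qed.

(** * Comparison of two submodules of the differential action *)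

Local Notation T := (dunklE derE).

(* For phi with all T xi phi in M', the map [orbit_map phi] intertwines the Dunkl
   operators of the standard module modulo M'. *)
Theorem submodule_le_of_symmetric (M M' : E -> Prop) :
  (forall f phi, Pol f -> M phi -> M (f *: phi)) ->
  (forall phi psi, M phi -> M psi -> M (phi + psi)) ->
  (forall w phi, M phi -> M (wact w phi)) ->
  (forall xi phi, M phi -> M (T xi phi)) ->
  (exists N, forall phi, M phi -> polE (arrpoly ^+ N *: phi)) ->
  (forall f phi, Pol f -> M' phi -> M' (f *: phi)) ->
  M' 0 ->
  (forall phi psi, M' phi -> M' psi -> M' (phi + psi)) ->
  (forall w phi, M' phi -> M' (wact w phi)) ->
  (forall xi phi, M' phi -> M' (T xi phi)) ->
  (forall phi, M phi -> M' (symE phi)) ->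
  forall phi, M phi -> M' phi.
Proof.
move=> MZ MD MW MT [N MN] MZ' M0' MD' MW' MT' Msym.
(* c is the degree of arrpoly^N, so an element of M of degree at most -1 - c becomes a polynomial
   tuple of negative degree; this is the case m = 0. *)
pose c := (N * size A)%N.
suff main (m : nat) phi : M phi -> degE (m%:Z - 1 - c%:Z) phi -> M' phi.
  move=> phi Mphi; have [d hd] := degE_polE (MN _ Mphi).
  apply: (main d.+1) => //.
  have -> : phi = arrpoly^-1 ^+ N *: (arrpoly ^+ N *: phi).
    by rewrite scalerA -exprMn mulVf ?arrpoly_neq0 // expr1n scale1r.
  have := degEZ (deg_exp N deg_arrpolyV) hd; apply: degE_le; rewrite /c; lia.
elim: m phi => [|m IH] phi Mphi hd.
  have -> : phi = 0; last exact: M0'.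
  apply: (scalerI (expf_neq0 N arrpoly_neq0)); rewrite scaler0.
  apply: (@degE_neg (- 1)) => //; first exact: MN.
  have := degEZ (deg_exp N deg_arrpoly) hd; apply: degE_le; rewrite /c; lia.
have MT'phi xi : M' (T xi phi).
  apply: IH; first exact: MT.
  have -> : m%:Z - 1 - c%:Z = (m.+1%:Z - 1 - c%:Z) - 1 by lia.
  by apply: degE_dunklE => // psi; exact: degE_derE.
have M0 : M 0.
  by rewrite -(scale0r phi); apply: MZ => //; exact: Pol_0.
(* phi is the image of 1 (x) 1 under [orbit_map phi], so the preimage of M' has to contain 1 (x)
   1. *)
rewrite -[phi]wact1 -orbit_map_basisE.
apply: (standard_spherical (Y := fun d => M' (orbit_map phi d))).
- by move=> p q hp hq; rewrite orbit_mapD; exact: MD'.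
- by move=> f p Pf hp; rewrite orbit_mapZ; exact: MZ'.
- by move=> w p hp; rewrite orbit_map_wact; exact: MW'.
- move=> xi p pp hp.
  have := orbit_map_dunklE phi xi p connection_derE.
  move=> /esym/(canRL (addrK _)) ->; apply: (MD'); first exact: MT'.
  rewrite -scaleN1r -(rmorphN1 cst); apply: (MZ'); first exact: Pol_cst.
  apply: (big_ind M') => // u _; apply: (MZ') => //.
  rewrite -[xi](rhoVK rho1 rhoM u) -(dunklE_wact connection_derE).
  exact: MW'.
- move=> p pp; rewrite (linE_symE (linE_orbit_map _)); last exact: orbit_map_wact.
  apply: Msym; apply: (big_ind M) => // u _; apply: MZ => //; exact: MW.
Qed.

(** * The module of quasi-invariants *)

Hypothesis O_img : forall w H f, H \in A -> O H f -> O (rho w @: H)%VS (act w f).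

Definition left_proj H i (phi : E) : E :=
  cst (ordH rho H)%:R^-1 *: \sum_(s in stab H) cst (chi s ^- i) *: lact s phi.

Definition quasi_order H i := (ordH rho H * k H i)%N.

Definition quasiE (phi : E) := regE phi /\
  forall H, H \in A -> forall i, (i < ordH rho H)%N ->
    inO H ((al H)^-1 ^+ quasi_order H i *: left_proj H i phi).

Lemma left_projD H i phi psi :
  left_proj H i (phi + psi) = left_proj H i phi + left_proj H i psi.
Proof.
rewrite /left_proj -scalerDr -big_split; congr (_ *: _).
by apply: eq_bigr => s _; rewrite lactD scalerDr.
Qed.

Lemma left_projZ H i f phi : left_proj H i (f *: phi) = f *: left_proj H i phi.
Proof.
rewrite [RHS]scalerA [f * _]mulrC -[RHS]scalerA; congr (_ *: _).
rewrite scaler_sumr; apply: eq_bigr => s _.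
by rewrite lactZ !scalerA mulrC.
Qed.

Lemma linE_left_proj H i : linE (left_proj H i).
Proof. by split; [exact: left_projD|exact: left_projZ]. Qed.

Lemma derE_left_proj H i xi phi :
  derE xi (left_proj H i phi) = left_proj H i (derE xi phi).
Proof.
have [_ dZ _ _] := connection_derE.
rewrite /left_proj dZ der_cst scale0r add0r (conn_sum connection_derE).
congr (_ *: _); apply: eq_bigr => s _.
by rewrite dZ der_cst scale0r add0r derE_lact.
Qed.

Lemma wact_left_proj w H i phi :
  wact w (left_proj H i phi) = left_proj (rho w @: H)%VS i (wact w phi).
Proof.
rewrite /left_proj wactZ act_cst (ordH_img rho1 rhoM) wact_sum; congr (_ *: _).
rewrite [RHS](reindex_inj (conjg_inj w^-1%g)) /=.
apply: eq_big => s; first by rewrite (pstabJ rho1 rhoM).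
by move=> _; rewrite wactZ act_cst wact_lact (detVJ rho1 rhoM).
Qed.

Lemma act_alV w H : H \in A ->
  exists c, act w (al H)^-1 = cst c * (al (rho w @: H)%VS)^-1.
Proof.
move=> HA; have [v av] := alpha_normal alphaP HA.
exists (alpha (rho w @: H)%VS (rho w v)).
by have := act_alpha_frac w v HA; rewrite av rmorph1 mul1r.
Qed.

Lemma quasiE0 : quasiE 0.
Proof.
split=> [|H HA i _]; first exact: regE0.
by rewrite (linE0 (linE_left_proj H i)) scaler0; exact: inO0.
Qed.

Lemma quasiED phi psi : quasiE phi -> quasiE psi -> quasiE (phi + psi).
Proof.
move=> [rp hp] [rq hq]; split=> [|H HA i lti]; first exact: regED.
rewrite left_projD scalerDr; apply: inOD => //; [exact: hp|exact: hq].
Qed.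

Lemma quasiEZ f phi : Pol f -> quasiE phi -> quasiE (f *: phi).
Proof.
move=> Pf [rp hp]; split=> [|H HA i lti]; first exact/regEZ/rp/Reg_Pol.
rewrite left_projZ scalerA mulrC -scalerA; apply: inOZ => //; first exact: Pol_O.
exact: hp.
Qed.

Lemma quasiE_cst c phi : quasiE phi -> quasiE (cst c *: phi).
Proof. exact/quasiEZ/Pol_cst. Qed.

(** The condition at H is the one at H0 = w^-1 H transported by w: the orders agree by invariance of
    k, and w maps alpha_(H0) to a multiple of alpha_H. *)
Lemma quasiE_wact w phi : quasiE phi -> quasiE (wact w phi).
Proof.
move=> [rp hp]; split=> [|H HA i lti]; first exact: regE_wact.
pose H0 := (rho w^-1%g @: H)%VS.
have H0A : H0 \in A by exact: rho_hyperplanes.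
have HE : H = (rho w @: H0)%VS by rewrite /H0 -limg_comp -rhoM mulgV rho1 lim1g.
have n0 : ordH rho H0 = ordH rho H by rewrite (ordH_img rho1 rhoM).
have m0 : quasi_order H0 i = quasi_order H i.
  by rewrite /quasi_order n0 (k_inv w^-1%g).
have [c ec] := act_alV w^-1%g HA.
have [c' ec'] := act_alV w H0A; rewrite -HE in ec'.
have lti0 : (i < ordH rho H0)%N by rewrite n0.
have := hp _ H0A i lti0; rewrite m0.
set m := quasi_order H i; set q := left_proj _ _ _ => qO.
have al0 := al_neq0 H0A.
have c'0 : cst c' != 0.
  apply/eqP => e; move: ec'; rewrite e mul0r => /eqP.
  by rewrite fmorph_eq0 invr_eq0 (negPf al0).
have -> : left_proj H i (wact w phi) = wact w q.
  by rewrite /q wact_left_proj -HE.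
have -> : (al H)^-1 ^+ m *: wact w q = (cst c')^-1 ^+ m *: wact w ((al H0)^-1 ^+ m *: q).
  rewrite [wact w (_ ^+ m *: q)]wactZ rmorphXn /= ec' scalerA -exprMn mulrA mulVf // mul1r.
  reflexivity.
apply: inOZ => //; first by rewrite -fmorphV -rmorphXn; exact: O_cst.
by move=> u; rewrite ffunE {1}HE; apply: O_img.
Qed.

Lemma quasiE_sum (I : Type) (r : seq I) (P : pred I) (F : I -> E) :
  (forall i, P i -> quasiE (F i)) -> quasiE (\sum_(i <- r | P i) F i).
Proof.
by move=> h; apply: big_ind => //; [exact: quasiE0|exact: quasiED].
Qed.

Lemma quasiE_zdiag H phi : quasiE phi -> quasiE (zdiag H phi).
Proof. by move=> hp; apply: quasiE_sum => s _; exact/quasiE_cst/quasiE_wact. Qed.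

Lemma sum_left_proj H phi : H \in A -> \sum_(i < ordH rho H) left_proj H i phi = phi.
Proof.
move=> HA; rewrite /left_proj -scaler_sumr exchange_big /=.
rewrite (bigD1 1%g) ?(group1 (pstab_group rho1 rhoM H)) //=.
rewrite [X in _ + X]big1 ?addr0 => [|s /andP[sS s1]].
  rewrite -scaler_suml lact1 scalerA -rmorph_sum -rmorphM /=.
  under eq_bigr do rewrite detV1 // expr1n invr1.
  rewrite sumr_const card_ord mulVf ?rmorph1 ?scale1r //.
  by rewrite char0 -lt0n ordH_gt0.
rewrite -scaler_suml -rmorph_sum; under eq_bigr do rewrite -exprVn -(detVV rho1 rhoM).
rewrite (sum_detV_expn char0 rho1 rhoM rho_inj alphaP HA); last first.
  exact: (@groupVr _ (pstab_group rho1 rhoM H)).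
by rewrite invg_eq1 (negPf s1) muln0 rmorph0 scale0r.
Qed.

Lemma quasiE_polE phi : quasiE phi -> polE phi.
Proof.
move=> [rp hp]; apply: polE_of_inO => // H HA.
rewrite -(sum_left_proj phi HA); apply: inO_sum => // i _ _.
have al0 := al_neq0 HA.
have -> : left_proj H i phi = al H ^+ quasi_order H i *:
    ((al H)^-1 ^+ quasi_order H i *: left_proj H i phi).
  by rewrite scalerA -exprMn mulfV // expr1n scale1r.
by apply: inOZ => //; [apply: O_exp => //; exact: O_al|exact: hp].
Qed.

Lemma lact_left_proj H i s phi : s \in stab H ->
  lact s (left_proj H i phi) = cst (chi s ^+ i) *: left_proj H i phi.
Proof.
move=> sS; rewrite lactZ lact_sum scalerA mulrC -scalerA; congr (_ *: _).
rewrite scaler_sumr [RHS](reindex_inj (mulgI s)) /=.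
apply: eq_big => t; first by rewrite -[stab H]/(pstab_group rho1 rhoM H : {set W}) groupMl.
move=> _; rewrite lactZ lactM scalerA -rmorphM /=.
rewrite (detVM rhoM) exprMn invfM mulrA mulfV ?mul1r //.
by rewrite expf_neq0 ?(detV_neq0 rho1 rhoM).
Qed.

Lemma zdiag_left_proj H i phi : H \in A ->
  left_proj H i (zdiag H phi) = zdiag H (left_proj H i phi).
Proof.
move=> HA; have ll := linE_left_proj H i.
rewrite /zdiag linE_sum //; apply: eq_bigr => s sS.
case: (ll) => _ ->; congr (_ *: _).
by rewrite wact_left_proj (img_pstab sS).
Qed.

Lemma derE_alX H m xi : H \in A -> der xi (al H ^+ m) = m%:R * (al H ^+ m * afrac H xi).
Proof.
move=> HA; have al0 := al_neq0 HA; elim: m => [|m IH]; first by rewrite expr0 der1 mul0r.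
by rewrite exprS derM IH der_al // -[m.+1]addn1 natrD /afrac; field.
Qed.

(** Along H write the component of type i as alpha_H^m g with m = n_H k_(H,i) and g integral.
    Differentiating alpha_H^m gives m (alpha_H(xi) / alpha_H) alpha_H^m g; the reflection term of H
    has the same leading part, because up to higher order W_H acts by det^i, where its eigenvalue is
    m. The two cancel, and the rest is divisible by alpha_H^m. *)
Lemma quasiE_dunklE xi phi : quasiE phi -> quasiE (dunklE derE xi phi).
Proof.
move=> qphi; have [rp hp] := qphi; have pp := quasiE_polE qphi.
split=> [|H HA i lti].
  apply: regE_dunklE => // psi hpsi u; rewrite ffunE; exact: Reg_der.
have ll := linE_left_proj H i; have al0 := al_neq0 HA.
have -> : dunklE derE xi phi = (derE xi phi - afrac H xi *: zdiag H phi) +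
    -1 *: (\sum_(H' <- A | H' != H) afrac H' xi *: zdiag H' phi).
  by rewrite /dunklE (bigD1_seq H) ?undup_uniq //= opprD addrA scaleN1r.
rewrite left_projD scalerDr; apply: inOD => //; last first.
  rewrite left_projZ (linE_sum _ _ _ ll) scaler_sumr scaler_sumr.
  apply: inO_sum => // H' HA' ne; have [_ hz] := quasiE_zdiag H' qphi.
  set z := zdiag H' phi in hz *.
  have -> : (al H)^-1 ^+ quasi_order H i *: (-1 *: left_proj H i (afrac H' xi *: z)) =
     (cst (-1) * afrac H' xi) *: ((al H)^-1 ^+ quasi_order H i *: left_proj H i z).
    rewrite left_projZ !scalerA rmorphN1; congr (_ *: _).
    by move: (_ ^+ quasi_order H i) => am; ring.
  apply: inOZ => //; last exact: hz.
  by apply: O_mul => //; [exact: O_cst|exact: O_afrac].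
set m := quasi_order H i; pose g := (al H)^-1 ^+ m *: left_proj H i phi.
have gO : inO H g by exact: hp.
have phiE : left_proj H i phi = al H ^+ m *: g.
  by rewrite /g scalerA -exprMn mulfV // expr1n scale1r.
clearbody g; have [_ dZ _ _] := connection_derE.
rewrite left_projD -derE_left_proj -scaleN1r !left_projZ zdiag_left_proj // scaleN1r.
pose h s : E := [ffun u => (act s (g u) - g u) / al H].
have hO s : s \in stab H -> inO H (h s) by move=> sS u; rewrite ffunE; exact: O_act.
(* The diagonal action of s is [lact s], contributing det(s)^i, followed by s on coefficients, which
   turns g into g + alpha_H h_s and fixes alpha_H^m because n_H divides m. *)
have wE s : s \in stab H ->
    wact s (left_proj H i phi) = cst (chi s ^+ i) *: (al H ^+ m *: (g + al H *: h s)).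
  move=> sS; have scaleE (f : K) (psi : E) u : (f *: psi) u = f * psi u by rewrite ffunE.
  apply/ffunP => u; rewrite ffunE.
  rewrite -[left_proj H i phi _](lactE s) lact_left_proj // phiE !scaleE.
  rewrite !rmorphM /= act_cst [act s (al H ^+ m)]rmorphXn /= act_al // exprMn.
  have chim : chi s ^+ m = 1.
    by rewrite /m /quasi_order exprM (detV_ordH rho1 rhoM sS) expr1n.
  rewrite -[cst (chi s)^-1 ^+ m]rmorphXn /= [(chi s)^-1 ^+ m]exprVn chim invr1 rmorph1 mul1r.
  congr (_ * (_ * _)); have -> : (g + al H *: h s) u = g u + al H * h s u.
    by rewrite [LHS]ffunE (scaleE (al H) (h s)).
  have -> : h s u = (act s (g u) - g u) / al H by rewrite ffunE.
  by rewrite [al H * _]mulrC divfK // subrKC.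
have zE : zdiag H (left_proj H i phi) =
    al H ^+ m *: (m%:R *: g + al H *: \sum_(s in stab H)
       cst (refl_coef H s * chi s ^+ i) *: h s).
  rewrite /zdiag (eq_bigr (fun s => al H ^+ m *: (cst (refl_coef H s * chi s ^+ i) *: g
     + al H *: (cst (refl_coef H s * chi s ^+ i) *: h s)))) => [|s sS].
    rewrite -scaler_sumr big_split /= -scaler_suml -rmorph_sum sum_refl_coef //=.
    by rewrite -scaler_sumr rmorph_nat /kmod modn_small.
  rewrite wE // [cst _ *: _]scalerA -rmorphM scalerDr scalerDr !scalerA.
  rewrite scalerDr !scalerA; move: (al H ^+ m) => am.
  by congr (_ *: _ + _ *: _); ring.
rewrite zE phiE dZ derE_alX //.
set Z := \sum_(s in _) _.
have -> : (al H)^-1 ^+ m *: ((m%:R * (al H ^+ m * afrac H xi)) *: g + al H ^+ m *: derE xi g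
   - afrac H xi *: (al H ^+ m *: (m%:R *: g + al H *: Z))) =
   derE xi g + cst (- alpha H xi) *: Z.
  have alm : al H ^+ m != 0 by rewrite expf_neq0.
  have e : afrac H xi * al H = cst (alpha H xi) by rewrite divfK.
  move: (derE xi g) => dg; apply/ffunP => u; rewrite rmorphN -e.
  rewrite exprVn; move: (al H ^+ m) alm => am am0; move: (g) (Z) => g' Z'.
  by rewrite !ffunE -![_ *: _]/(_ * _); field.
apply: inOD => //; first exact: inO_derE.
apply: inO_cst => //; apply: inO_sum => // s _ sS.
by apply: inO_cst => //; exact: hO.
Qed.

Definition quasi_inv f := Pol f /\ forall H, H \in A -> forall i, (i < ordH rho H)%N ->
  exists2 g, Pol g & cst (ordH rho H)%:R^-1 * \sum_(s in stab H) cst (chi s ^+ i) * act s f =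
     al H ^+ quasi_order H i * g.

Lemma symE_basisE1 f u : symE (f *: basisE 1%g) u = act u f.
Proof.
rewrite /symE sum_ffunE (bigD1 u) //= big1 => [|w wu].
  by rewrite wactZ wact_basisE !ffunE mulg1 eqxx addr0 -[_ *: _]/(_ * _) mulr1.
by rewrite wactZ wact_basisE !ffunE mulg1 eq_sym (negPf wu); exact: scaler0.
Qed.

(** Substituting s^-1 for s turns chi^-i into chi^i: the idempotent e_(H,i) on CW becomes e_(H,-i)
    on coefficients, as in [quasi_inv]. *)
Lemma left_proj_invariant H i (psi : E) u :
  (forall w x, psi (w * x)%g = act w (psi x)) ->
  left_proj H i psi u =
  cst (ordH rho H)%:R^-1 * \sum_(s in stab H) cst (chi s ^+ i) * act s (psi u).
Proof.
move=> hpsi; rewrite ffunE sum_ffunE; congr (_ * _).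
rewrite (reindex_inj invg_inj) /=; apply: eq_big => s.
  by rewrite -[stab H]/(pstab_group rho1 rhoM H : {set W}) groupV.
by move=> _; rewrite !ffunE invgK hpsi (detVV rho1 rhoM) exprVn invrK.
Qed.

Lemma wact_symE w phi : wact w (symE phi) = symE phi.
Proof.
rewrite /symE wact_sum [RHS](reindex_inj (mulgI w)) /=; apply: eq_bigr => x _.
by rewrite wactM.
Qed.

Lemma symE_shift phi w x : symE phi (w * x)%g = act w (symE phi x).
Proof. by rewrite -{1}(wact_symE w phi) ffunE mulKg. Qed.

Lemma quasiE_symE phi : quasiE phi -> quasiE (symE phi).
Proof. by move=> h; apply: quasiE_sum => w _; exact: quasiE_wact. Qed.

Lemma quasi_inv_symE phi : quasiE phi ->
  quasi_inv (symE phi 1%g) /\ symE phi = symE (symE phi 1%g *: basisE 1%g).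
Proof.
move=> qphi; have qs := quasiE_symE qphi; have ps := quasiE_polE qs.
split; last first.
  by apply/ffunP => u; rewrite symE_basisE1 -symE_shift mulg1.
split=> [|H HA i lti]; first exact: ps.
have [rs hs] := qs; rewrite -(left_proj_invariant H i 1%g (@symE_shift phi)).
set m := quasi_order H i; have al0 := al_neq0 HA.
pose g := (al H)^-1 ^+ m * left_proj H i (symE phi) 1%g.
exists g; last by rewrite /g mulrA -exprMn mulfV // expr1n mul1r.
have lP : Pol (left_proj H i (symE phi) 1%g).
  have : polE (left_proj H i (symE phi)); last exact.
  apply: polE_cst; apply: (big_ind polE) => [||s _]; [exact: polE0|exact: polED|].
  by apply: polE_cst => u; rewrite ffunE.
have rg : Reg g.
  apply: Reg_mul; last exact: Reg_Pol.
  elim: (m) => [|q IH]; first by rewrite expr0; exact/Reg_Pol/Pol_1.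
  by rewrite exprS; apply: Reg_mul => //; exact: Reg_alV.
(* The quotient g has no poles: along H by [quasiE], along any other hyperplane because alpha_H is
   invertible there. *)
have [N /Pol_of_O hN] := rg; apply: hN => H' HA'.
have [->|ne] := eqVneq H' H.
  by have := hs H HA i lti 1%g; rewrite ffunE.
apply: O_mul => //; last exact: Pol_O.
by apply: O_exp => //; apply: O_alV => //; rewrite eq_sym.
Qed.

(** Needed because the component of symE (f (x) 1) at u is u f, so that the divisibility has to hold
    for all translates of f. *)
Lemma quasi_inv_act w f : quasi_inv f -> quasi_inv (act w f).
Proof.
move=> [Pf hf]; split=> [|H HA i lti]; first exact: Pol_act.
pose H0 := (rho w^-1%g @: H)%VS.
have H0A : H0 \in A by exact: rho_hyperplanes.
have HE : H = (rho w @: H0)%VS by rewrite /H0 -limg_comp -rhoM mulgV rho1 lim1g.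
have n0 : ordH rho H0 = ordH rho H by rewrite (ordH_img rho1 rhoM).
have m0 : quasi_order H0 i = quasi_order H i.
  by rewrite /quasi_order n0 (k_inv w^-1%g).
have [|g Pg eg] := hf _ H0A i; first by rewrite n0.
have [c ec] := act_alV w H0A; rewrite -HE in ec.
exists ((cst c)^-1 ^+ quasi_order H i * act w g).
  apply: Pol_mul; last exact: Pol_act.
  by rewrite -fmorphV -rmorphXn; exact: Pol_cst.
have eal : act w (al H0) = al H * (cst c)^-1.
  have := congr1 (fun x => x^-1) ec; rewrite fmorphV invrK => ->.
  by rewrite invfM invrK mulrC.
have := congr1 (act w) eg; rewrite n0 m0 rmorphM act_cst /=.
rewrite rmorphM rmorphXn /= eal exprMn -mulrA => <-; congr (_ * _).
rewrite rmorph_sum (reindex_inj (conjg_inj w^-1%g)) /=.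
apply: eq_big => s; first by rewrite {1}HE (pstabJ rho1 rhoM).
move=> _; rewrite rmorphM act_cst (detVJ rho1 rhoM); congr (_ * _).
by rewrite -!actM conjgE invgK -!mulgA mulVg mulg1.
Qed.

Lemma quasiE_quasi_inv f : quasi_inv f -> quasiE (symE (f *: basisE 1%g)).
Proof.
move=> qf; have sE u := symE_basisE1 f u; split=> [u|H HA i lti u].
  by rewrite sE; have [Pf _] := quasi_inv_act u qf; exact: Reg_Pol.
rewrite ffunE (left_proj_invariant H i u (@symE_shift _)) sE.
have [_ h] := quasi_inv_act u qf; have [g Pg ->] := h H HA i lti.
rewrite -[_ *: _]/(_ * _) mulrA -exprMn mulVf ?al_neq0 // expr1n mul1r.
exact: Pol_O.
Qed.

Definition dunkl_submodule (M : E -> Prop) :=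
  [/\ M 0, forall phi psi, M phi -> M psi -> M (phi + psi),
      forall f phi, Pol f -> M phi -> M (f *: phi),
      forall w phi, M phi -> M (wact w phi) &
      forall xi phi, M phi -> M (T xi phi)].

Theorem quasi_invariant_submodule :
  [/\ dunkl_submodule quasiE, forall phi, quasiE phi -> polE phi,
      forall phi, quasiE phi ->
        quasi_inv (symE phi 1%g) /\ symE phi = symE (symE phi 1%g *: basisE 1%g),
      forall f, quasi_inv f -> quasiE (symE (f *: basisE 1%g)) &
      forall M M', dunkl_submodule M -> dunkl_submodule M' ->
        (exists N, forall phi, M phi -> polE (arrpoly ^+ N *: phi)) ->
        (forall phi, M phi -> M' (symE phi)) -> forall phi, M phi -> M' phi].
Proof.
split.
- split; [exact: quasiE0|exact: quasiED|exact: quasiEZ|exact: quasiE_wact|].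
  exact: quasiE_dunklE.
- exact: quasiE_polE.
- exact: quasi_inv_symE.
- exact: quasiE_quasi_inv.
move=> M M' [_ MD MZ MW MT] [M0' MD' MZ' MW' MT'] bM; exact: submodule_le_of_symmetric.
Qed.

End DunklConnections.

(** * Polynomials, fractions and their valuations *)

Section QuotientRule.
Variables (R : idomainType) (K : fieldType) (t : {rmorphism R -> K}).
Hypothesis t_eq0 : forall p, (t p == 0) = (p == 0).
Hypothesis fracP : forall f, exists p q, q != 0 /\ f = t p / t q.

Section OneDerivation.
Variables (d : R -> R) (D : K -> K).
Hypothesis dD : forall p q, d (p + q) = d p + d q.
Hypothesis dM : forall p q, d (p * q) = d p * q + p * d q.
Hypothesis DE : forall p q, q != 0 -> D (t p / t q) = t (d p * q - p * d q) / t q ^+ 2.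

(** Kept as two fractions so that a degree bound can be read off each summand. *)
Lemma quotient_ruleE p q : q != 0 -> D (t p / t q) = t (d p) / t q + t p * t (- d q) / t (q ^+ 2).
Proof.
move=> q0; have b0 : t q != 0 by rewrite t_eq0.
by rewrite DE // !(rmorphB, rmorphM, rmorphN, rmorphXn) /=; field.
Qed.

Lemma quotient_ruleM f g : D (f * g) = D f * g + f * D g.
Proof.
have [p [q [q0 ->]]] := fracP f; have [p' [q' [q'0 ->]]] := fracP g.
rewrite mulf_div -!rmorphM !DE ?mulf_neq0 // !dM.
have a0 : t q != 0 by rewrite t_eq0.
have b0 : t q' != 0 by rewrite t_eq0.
by rewrite !(rmorphM, rmorphB, rmorphD) /=; field; rewrite a0 b0.
Qed.

Lemma quotient_ruleD f g : D (f + g) = D f + D g.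
Proof.
have [p [q [q0 ->]]] := fracP f; have [p' [q' [q'0 ->]]] := fracP g.
have a0 : t q != 0 by rewrite t_eq0.
have b0 : t q' != 0 by rewrite t_eq0.
rewrite addf_div // -!rmorphM -rmorphD !DE ?mulf_neq0 // !dM !dD !dM.
by rewrite !(rmorphM, rmorphB, rmorphD) /=; field; rewrite a0 b0.
Qed.
End OneDerivation.

Lemma quotient_rule_lin (b : R) (d1 d2 d3 : R -> R) (D1 D2 D3 : K -> K) :
  (forall p q, q != 0 -> D1 (t p / t q) = t (d1 p * q - p * d1 q) / t q ^+ 2) ->
  (forall p q, q != 0 -> D2 (t p / t q) = t (d2 p * q - p * d2 q) / t q ^+ 2) ->
  (forall p q, q != 0 -> D3 (t p / t q) = t (d3 p * q - p * d3 q) / t q ^+ 2) ->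
  (forall p, d1 p = b * d2 p + d3 p) ->
  forall f, D1 f = t b * D2 f + D3 f.
Proof.
move=> E1 E2 E3 h f; have [p [q [q0 ->]]] := fracP f.
have a0 : t q != 0 by rewrite t_eq0.
by rewrite E1 // E2 // E3 // !h !(rmorphM, rmorphB, rmorphD) /=; field.
Qed.

(** With f q = p, both second derivatives of f q expand by the Leibniz rule; as the derivations
    commute on p and q, the comparison leaves q D1 (D2 f) = q D2 (D1 f). *)
Lemma derivations_commute (D1 D2 : K -> K) :
  (forall f g, D1 (f + g) = D1 f + D1 g) -> (forall f g, D1 (f * g) = D1 f * g + f * D1 g) ->
  (forall f g, D2 (f + g) = D2 f + D2 g) -> (forall f g, D2 (f * g) = D2 f * g + f * D2 g) ->
  (forall p, D1 (D2 (t p)) = D2 (D1 (t p))) -> forall f, D1 (D2 f) = D2 (D1 f).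
Proof.
move=> A1 M1 A2 M2 h f; have [p [q [q0 fE]]] := fracP f.
have a0 : t q != 0 by rewrite t_eq0.
have fq : f * t q = t p by rewrite fE divfK.
have := h p; rewrite -fq M1 M2 A1 A2 !M1 !M2 (h q) => e.
apply: (mulIf a0); apply: (addIr (D1 f * D2 (t q) + (D2 f * D1 (t q) + f * D2 (D1 (t q))))).
have -> : D1 (D2 f) * t q + (D1 f * D2 (t q) + (D2 f * D1 (t q) + f * D2 (D1 (t q)))) =
   D1 (D2 f) * t q + D2 f * D1 (t q) + (D1 f * D2 (t q) + f * D2 (D1 (t q))) by ring.
by rewrite e; ring.
Qed.

End QuotientRule.

Section PolynomialFacts.
Variables (C : fieldType) (V : vectType C).
Local Notation n := (\dim {:V}).
Local Notation P := (polyV V).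
Local Notation bas i := ((vbasis {:V})`_i : V).

(** * Divisibility by a linear form and the local ring of a hyperplane *)

Definition divides (a p : P) := exists g, p = a * g.

Lemma dividesD a p q : divides a p -> divides a q -> divides a (p + q).
Proof. by move=> [g ->] [h ->]; exists (g + h); rewrite mulrDr. Qed.
Lemma dividesMr a p q : divides a p -> divides a (p * q).
Proof. by move=> [g ->]; exists (g * q); rewrite mulrA. Qed.
Lemma dividesMl a p q : divides a p -> divides a (q * p).
Proof. by rewrite mulrC; exact: dividesMr. Qed.
Lemma dividesN a p : divides a p -> divides a (- p).
Proof. by move=> [g ->]; exists (- g); rewrite mulrN. Qed.
Lemma divides0 a : divides a 0.
Proof. by exists 0; rewrite mulr0. Qed.

(** Modulo a, both maps are determined by constants and variables. This serves restriction to a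
    hyperplane as well as the elements of its stabilizer. *)
Lemma divides_rmorph_sub (f g : {rmorphism P -> P}) a :
  (forall c, f c%:MP = g c%:MP) -> (forall i, divides a (f 'X_i - g 'X_i)) ->
  forall p, divides a (f p - g p).
Proof.
move=> fgC fgX; elim/polyV_ind => [c|//|p q hp hq|p q hp hq].
- by rewrite fgC subrr; exact: divides0.
- by rewrite !raddfD /= addrACA; exact: dividesD.
have -> : f (p * q) - g (p * q) = (f p - g p) * f q + g p * (f q - g q).
  by rewrite !rmorphM; ring.
by apply: dividesD; [exact: dividesMr|exact: dividesMl].
Qed.

Lemma linpoly_ext (a b : V -> C) : (forall i : 'I_n, a (bas i) = b (bas i)) -> linpoly a = linpoly b.
Proof. by move=> ab; apply: eq_bigr => i _; rewrite ab. Qed.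

Lemma linpolyB (a b : 'Hom(V, C^o)) : linpoly (a - b)%R = linpoly a - linpoly b.
Proof.
rewrite -sumrB; apply: eq_bigr => i _.
by rewrite !lfunE /= lfunE /= scalerBl.
Qed.

Definition coordf (i : 'I_n) : 'Hom(V, C^o) := linfun (coord (vbasis {:V}) i : V -> C^o).

Lemma coordfE i x : coordf i x = coord (vbasis {:V}) i x.
Proof. by rewrite lfunE. Qed.

Lemma linpoly_coordf i : linpoly (coordf i) = 'X_i.
Proof.
rewrite /linpoly (bigD1 i) //= big1 ?addr0 => [|j ji].
  by rewrite coordfE coord_free ?(basis_free (vbasisP _)) // eqxx scale1r.
by rewrite coordfE coord_free ?(basis_free (vbasisP _)) // (negPf ji) scale0r.
Qed.

Lemma linpoly_inj (a b : 'Hom(V, C^o)) : linpoly a = linpoly b -> a = b.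
Proof. by move=> e; apply/lfunP => x; rewrite -!evalV_linpoly e. Qed.

(** Unlike [actV], this allows a non-invertible f, in particular the projection onto a
    hyperplane. *)
Definition pull (f : 'End(V)) (p : P) : P :=
  p \mPo [tuple linpoly (coordf i \o f)%VF | i < n].

HB.instance Definition _ f := GRing.RMorphism.copy (pull f) (pull f).

Lemma pullC f c : pull f c%:MP = c%:MP.
Proof. exact: comp_mpolyC. Qed.
Lemma pullX f i : pull f 'X_i = linpoly (coordf i \o f)%VF.
Proof. by rewrite /pull comp_mpolyXU -tnth_nth tnth_mktuple. Qed.
Lemma pull_linpoly f (a : 'Hom(V, C^o)) : pull f (linpoly a) = linpoly (a \o f)%VF.
Proof.
rewrite {1}/linpoly raddf_sum /=.
under eq_bigr => i _ do rewrite -mul_mpolyC rmorphM /= pullC pullX mul_mpolyC /linpoly scaler_sumr.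
rewrite exchange_big /=; apply: eq_bigr => j _.
under eq_bigr => i _ do rewrite scalerA.
rewrite -scaler_suml comp_lfunE; congr (_ *: _).
rewrite (coord_vbasis (memvf (f (bas j)))) linear_sum.
by apply: eq_bigr => i _; rewrite linearZ /= comp_lfunE coordfE mulrC.
Qed.

Section Hyperplane.
Variables (a : 'Hom(V, C^o)) (v : V).
Hypothesis av : a v = 1.

Lemma ker_multiple (b : 'Hom(V, C^o)) : (forall x, a x = 0 -> b x = 0) -> b = b v *: a.
Proof.
move=> ab; apply/lfunP => x; have : a (x - a x *: v) = 0.
  by rewrite linearB linearZ /= av -[_ *: _]/(_ * _) mulr1 subrr.
move=> /ab; rewrite linearB linearZ /= => /eqP; rewrite subr_eq0 => /eqP ->.
by rewrite scale_lfunE; exact: mulrC.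
Qed.

Lemma divides_linpoly_ker (b : 'Hom(V, C^o)) : (forall x, a x = 0 -> b x = 0) ->
  divides (linpoly a) (linpoly b).
Proof.
move=> /ker_multiple ->; rewrite linpolyZ -mul_mpolyC; exact/dividesMl/(ex_intro _ 1)/esym/mulr1.
Qed.

Definition kerproj_fun (x : V) : V := x - a x *: v.

Lemma kerproj_is_linear : linear kerproj_fun.
Proof.
move=> c x y; rewrite /kerproj_fun; have -> : a (c *: x + y) = c * a x + a y by rewrite linearP.
by rewrite scalerDl opprD addrACA scalerBr scalerA.
Qed.
HB.instance Definition _ :=
  GRing.isLinear.Build _ _ _ _ kerproj_fun kerproj_is_linear.

Definition kerproj : 'End(V) := linfun kerproj_fun.

Lemma kerprojE x : kerproj x = x - a x *: v.
Proof. by rewrite lfunE. Qed.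

Lemma pull_kerproj_linpoly : pull kerproj (linpoly a) = 0.
Proof.
rewrite pull_linpoly (_ : (a \o kerproj)%VF = 0).
  by apply/eqP; rewrite linpoly_eq0.
apply/lfunP => x; rewrite comp_lfunE kerprojE linearB linearZ /= av.
by rewrite -[_ *: _]/(_ * _) mulr1 subrr lfunE.
Qed.

(** Composition with [kerproj] is restriction to ker a and changes a polynomial only modulo a. So
    the ideal (a) is the kernel of a ring endomorphism of a domain, hence prime. *)
Lemma divides_pullP p : divides (linpoly a) p <-> pull kerproj p = 0.
Proof.
split=> [[g ->]|e]; first by rewrite rmorphM /= pull_kerproj_linpoly mul0r.
suff : divides (linpoly a) (p - pull kerproj p) by rewrite e subr0.
apply: (@divides_rmorph_sub idfun (pull kerproj)) => [c|i] /=; first by rewrite pullC.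
rewrite pullX -linpoly_coordf -linpolyB; apply: divides_linpoly_ker => x ax.
by rewrite add_lfunE opp_lfunE comp_lfunE kerprojE ax scale0r subr0 subrr.
Qed.

Lemma linpoly_prime p q : divides (linpoly a) (p * q) ->
  divides (linpoly a) p \/ divides (linpoly a) q.
Proof.
move/divides_pullP; rewrite rmorphM /= => /eqP.
by rewrite mulf_eq0 => /orP[/eqP h|/eqP h]; [left|right]; apply/divides_pullP.
Qed.

Lemma linpoly_not_divides1 : ~ divides (linpoly a) 1.
Proof. by move/divides_pullP; rewrite rmorph1 => /eqP; rewrite oner_eq0. Qed.

Lemma divides_linpoly (b : 'Hom(V, C^o)) : divides (linpoly a) (linpoly b) -> forall x, a x = 0 -> b x = 0.
Proof.
move=> [g e] x ax; rewrite -evalV_linpoly e /evalV mevalM.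
by rewrite -/(evalV (linpoly a) x) evalV_linpoly ax mul0r.
Qed.

Definition localring (f : ratV V) :=
  exists p q, ~ divides (linpoly a) q /\ f = tofrac p / tofrac q.

Lemma ndivides_neq0 q : ~ divides (linpoly a) q -> q != 0.
Proof. by move=> h; apply/eqP => q0; apply: h; rewrite q0; exact: divides0. Qed.

Lemma localring_poly p : localring (tofrac p).
Proof.
exists p, 1; split; first exact: linpoly_not_divides1.
by rewrite tofrac1 divr1.
Qed.

Lemma localring_add f g : localring f -> localring g -> localring (f + g).
Proof.
move=> [p [q [hq ->]]] [p' [q' [hq' ->]]]; exists (p * q' + p' * q), (q * q').
split; first by case/linpoly_prime.
by rewrite addf_div ?tofrac_eq0 ?ndivides_neq0 // tofracD !tofracM.
Qed.

Lemma localring_mul f g : localring f -> localring g -> localring (f * g).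
Proof.
move=> [p [q [hq ->]]] [p' [q' [hq' ->]]]; exists (p * p'), (q * q').
split; first by case/linpoly_prime.
by rewrite mulf_div !tofracM.
Qed.

Lemma localring_der xi f : localring f -> localring (drat xi f).
Proof.
move=> [p [q [hq ->]]]; rewrite dratE ?ndivides_neq0 //.
exists (dpoly xi p * q - p * dpoly xi q), (q ^+ 2); split; last by rewrite tofracXn.
by rewrite expr2; case/linpoly_prime.
Qed.

Lemma localring_inv b : ~ divides (linpoly a) b -> localring (tofrac b)^-1.
Proof. by move=> h; exists 1, b; rewrite tofrac1 div1r. Qed.

Lemma localring_div p : localring (tofrac p / tofrac (linpoly a)) -> divides (linpoly a) p.
Proof.
move=> [p' [q [hq]]].
have a0 : linpoly a != 0.
  by rewrite linpoly_eq0; apply/eqP => a0; move: av; rewrite a0 lfunE /= => /esym/eqP; rewrite oner_eq0.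
move/(tofrac_div_eq _ _ a0 (ndivides_neq0 hq)) => e.
have : divides (linpoly a) (p * q) by exists p'; rewrite e mulrC.
by case/linpoly_prime.
Qed.

End Hyperplane.

(** One notion for three uses: S = (< k) expresses [msize], S = (= d) homogeneity, and S = (>= k)
    the order at the origin. *)
Definition suppdeg (S : pred nat) (p : P) := forall m : 'X_{1..n}, ~~ S (mdeg m) -> p@_m = 0.

Lemma suppdegD S p q : suppdeg S p -> suppdeg S q -> suppdeg S (p + q).
Proof. by move=> hp hq m hm; rewrite mcoeffD hp // hq // addr0. Qed.
Lemma suppdegZ S c p : suppdeg S p -> suppdeg S (c *: p).
Proof. by move=> hp m hm; rewrite mcoeffZ hp // mulr0. Qed.
Lemma suppdeg0 S : suppdeg S 0.
Proof. by move=> m _; rewrite mcoeff0. Qed.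
Lemma suppdeg_sum S (I : eqType) (r : seq I) (Q : pred I) (F : I -> P) :
  (forall i, i \in r -> Q i -> suppdeg S (F i)) -> suppdeg S (\sum_(i <- r | Q i) F i).
Proof.
move=> h; rewrite big_seq_cond; apply: (big_ind (suppdeg S)) => [||i /andP[ir Qi]].
- exact: suppdeg0.
- exact: suppdegD.
- exact: h.
Qed.

Lemma suppdegM (S S' S'' : pred nat) p q : (forall a b, S a -> S' b -> S'' (a + b)%N) ->
  suppdeg S p -> suppdeg S' q -> suppdeg S'' (p * q).
Proof.
move=> hS hp hq m hm; rewrite mcoeffM big1 // => k /eqP mk.
have [s1|s1] := boolP (S (mdeg k.1)); last by rewrite hp // mul0r.
have [s2|s2] := boolP (S' (mdeg k.2)); last by rewrite hq // mulr0.
by case/negP: hm; rewrite mk mdegD; exact: hS.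
Qed.

Lemma suppdegC (S : pred nat) c : S 0%N -> suppdeg S c%:MP.
Proof.
move=> S0 m; rewrite mcoeffC; have [->|_] := eqVneq m 0%MM; last by rewrite mulr0.
by rewrite mdeg0 S0.
Qed.

Lemma suppdeg_linpoly (S : pred nat) (a : V -> C) : S 1%N -> suppdeg S (linpoly a).
Proof.
move=> S1; apply: suppdeg_sum => i _ _; apply: suppdegZ => m.
rewrite mcoeffX; have [<-|_ //] := eqVneq; by rewrite mdeg1 S1.
Qed.

Lemma suppdeg_pullX f (m : 'X_{1..n}) : suppdeg (pred1 (mdeg m)) (pull f 'X_[m]).
Proof.
rewrite /pull comp_mpolyX mdegE.
elim/big_rec2: _ => [|i q d _ hq].
  by rewrite -mpolyC1; apply: suppdegC; rewrite /= eqxx.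
apply: (@suppdegM (pred1 (m i)) (pred1 d)) => [a b /eqP-> /eqP->||//] /=.
  by rewrite eqxx.
rewrite tnth_mktuple; elim: (m i) => [|l IH].
  by rewrite expr0 -mpolyC1; apply: suppdegC; rewrite /= eqxx.
rewrite exprS; apply: (@suppdegM (pred1 1%N) (pred1 l)) => [a b /eqP-> /eqP->||//].
  by rewrite /= add1n.
by apply: suppdeg_linpoly; rewrite /= eqxx.
Qed.

Lemma suppdeg_pull S f p : suppdeg S p -> suppdeg S (pull f p).
Proof.
move=> hp; rewrite {1}/pull comp_mpolyEX; apply: suppdeg_sum => m mp _.
apply: suppdegZ => m' hm'; apply: suppdeg_pullX.
apply/negP => /eqP e; move: mp; rewrite mcoeff_msupp hp ?eqxx //.
by rewrite -e.
Qed.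

Lemma msize_suppdeg (p : P) k : (msize p <= k)%N <-> suppdeg (fun d => (d < k)%N) p.
Proof.
split=> [le m|h].
  rewrite -leqNgt => km; apply/eqP; rewrite mcoeff_eq0.
  by apply: msize_mdeg_ge; exact: leq_trans km.
rewrite msizeE; apply/bigmax_leqP_seq => m mp _.
rewrite ltnNge; apply/negP => km; move: mp; rewrite mcoeff_msupp h ?eqxx //.
by rewrite -leqNgt.
Qed.

Lemma msize_pull_le f p : (msize (pull f p) <= msize p)%N.
Proof. by apply/msize_suppdeg/suppdeg_pull/msize_suppdeg. Qed.

Lemma msize_dpoly_le xi (p : P) : (msize (dpoly xi p) <= (msize p).-1)%N.
Proof.
apply/msize_suppdeg; apply: suppdeg_sum => i _ _; apply: suppdegZ => m hm.
rewrite mcoeff_mderiv (_ : p@_(m + U_(i)) = 0) ?mul0rn //.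
have /msize_suppdeg := leqnn (msize p); apply.
by move: hm; rewrite mdegD mdeg1; lia.
Qed.

Lemma msize_linpoly_le (a : V -> C) : (msize (linpoly a) <= 2)%N.
Proof. by apply/msize_suppdeg/suppdeg_linpoly. Qed.

Lemma msize_linpoly_gt1 (a : 'Hom(V, C^o)) : a != 0 -> (1 < msize (linpoly a))%N.
Proof.
move=> a0; rewrite ltnNge; apply/negP => /msize1_polyC e.
case/eqP: a0; apply: linpoly_inj; rewrite e.
have -> : (linpoly a)@_0 = 0 by apply: (@suppdeg_linpoly (pred1 1%N)); rewrite ?mdeg0.
by rewrite mpolyC0; apply/esym/eqP; rewrite linpoly_eq0.
Qed.

(** Degree of the numerator minus degree of the denominator; as [msize] is the degree plus one, the
    ones cancel. The numerator 0 is exempt, so that 0 has every degree. *)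
Definition degle (d : int) (f : ratV V) := exists p q,
  [/\ q != 0, f = tofrac p / tofrac q & p != 0 -> (msize p)%:Z <= (msize q)%:Z + d].

Lemma degle_0 d : degle d 0.
Proof. by exists 0, 1; split; rewrite ?oner_neq0 ?tofrac0 ?mul0r // eqxx. Qed.

Lemma msize_gt0 (p : P) : p != 0 -> (0 < msize p)%N.
Proof. by rewrite lt0n mmeasure_poly_eq0. Qed.

Lemma degle_poly (p : P) d : (msize p)%:Z <= 1 + d -> degle d (tofrac p).
Proof.
by move=> h; exists p, 1; split; rewrite ?oner_neq0 ?tofrac1 ?divr1 ?msize1.
Qed.

Lemma degle_polyV (a : P) d : a != 0 -> 1 <= (msize a)%:Z + d -> degle d (tofrac a)^-1.
Proof. by move=> a0 h; exists 1, a; split; rewrite ?tofrac1 ?div1r ?msize1. Qed.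

Lemma degle_add d f g : degle d f -> degle d g -> degle d (f + g).
Proof.
move=> [p [q [q0 -> hp]]] [p' [q' [q0' -> hp']]]; exists (p * q' + p' * q), (q * q').
split; first by rewrite mulf_neq0.
  by rewrite addf_div ?tofrac_eq0 // tofracD !tofracM.
move=> s0; have h (x y z : P) : y != 0 -> z != 0 -> (x != 0 -> (msize x)%:Z <= (msize y)%:Z + d) ->
    x * z != 0 -> (msize (x * z))%:Z <= (msize (y * z))%:Z + d.
  move=> y0 z0 hx; rewrite mulf_eq0 negb_or => /andP[x0 _]; rewrite !msizeM //.
  have := hx x0; have := msize_gt0 x0; have := msize_gt0 y0; have := msize_gt0 z0.
  move: (msize x) (msize y) (msize z) => i j l; clear; lia.
have h1 := h p q q' q0 q0' hp; have := h p' q' q q0' q0 hp'; rewrite [q' * q]mulrC => h2.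
have hs : (msize (p * q' + p' * q) <= maxn (msize (p * q')) (msize (p' * q)))%N.
  exact: mmeasureD_le.
move: h1 h2 s0 hs; move: (p * q') (p' * q) => x y h1 h2 s0 hs.
have [x0|x0] := eqVneq x 0; first by move: s0; rewrite x0 add0r => /h2.
have [y0|y0] := eqVneq y 0; first by move: s0; rewrite y0 addr0 => /h1.
move: (h1 x0) (h2 y0) hs.
by move: (msize x) (msize y) (msize (q * q')) (msize (x + y)) => i j l m; clear; lia.
Qed.

Lemma degle_mul d e f g : degle d f -> degle e g -> degle (d + e) (f * g).
Proof.
move=> [p [q [q0 -> hp]]] [p' [q' [q0' -> hp']]]; exists (p * p'), (q * q').
split; [by rewrite mulf_neq0|by rewrite mulf_div !tofracM|].
rewrite mulf_eq0 negb_or => /andP[p0 p'0]; rewrite !msizeM //.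
have := hp p0; have := hp' p'0; have := msize_gt0 p0; have := msize_gt0 p'0.
have := msize_gt0 q0; have := msize_gt0 q0'.
by move: (msize p) (msize p') (msize q) (msize q') => i j l m; clear; lia.
Qed.

Lemma degle_le d e f : d <= e -> degle d f -> degle e f.
Proof.
move=> de [p [q [q0 -> hp]]]; exists p, q; split=> // /hp; lia.
Qed.

Lemma degle_der d xi f : degle d f -> degle (d - 1) (drat xi f).
Proof.
move=> [p [q [q0 -> hp]]].
have dr : drat xi (tofrac p / tofrac q) =
    tofrac (dpoly xi p) / tofrac q + tofrac p * tofrac (- dpoly xi q) / tofrac (q ^+ 2).
  exact: (quotient_ruleE (@tofrac_eq0 P) (d := dpoly xi) (D := drat xi) (@dratE _ _ xi) p q0).
have [p0|p0] := eqVneq p 0.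
  rewrite dr p0 (_ : dpoly xi 0 = 0); last by rewrite -(mpolyC0 n C) dpolyC.
  by rewrite tofrac0 !mul0r addr0; exact: degle_0.
have hp0 := hp p0; have qs := msize_gt0 q0; have ps := msize_gt0 p0.
rewrite dr; apply: degle_add.
  exists (dpoly xi p), q; split=> // dp0.
  have := msize_dpoly_le xi p; move: hp0 ps.
  by move: (msize p) (msize q) (msize (dpoly xi p)) => i j l; clear; lia.
exists (p * - dpoly xi q), (q ^+ 2); split; rewrite ?expf_neq0 ?tofracM //.
rewrite mulf_eq0 oppr_eq0 negb_or => /andP[_ dq0].
rewrite expr2 !msizeM ?oppr_eq0 // mmeasureN.
have := msize_dpoly_le xi q; have := msize_gt0 dq0; move: hp0 qs ps.
by move: (msize p) (msize q) (msize (dpoly xi q)) => i j l; clear; lia.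
Qed.

Lemma degle_neg d (p : P) : d < 0 -> degle d (tofrac p) -> p = 0.
Proof.
move=> d0 [p' [q [q0 e hp]]]; apply/eqP/negPn/negP => p0.
have {}e : p' = p * q.
  apply/eqP; rewrite -tofrac_eq tofracM e divfK // tofrac_eq0 //.
have p'0 : p' != 0 by rewrite e mulf_neq0.
have := hp p'0; rewrite e msizeM //.
have := msize_gt0 q0; have := msize_gt0 p0; move: d0.
by move: (msize p) (msize q) => i j; clear; lia.
Qed.

Definition ordge (k : nat) (f : ratV V) := exists2 p, f = tofrac p & suppdeg (leq k) p.

Lemma ordge0 k : ordge k 0.
Proof. by exists 0; [rewrite tofrac0|exact: suppdeg0]. Qed.
Lemma ordgeD k f g : ordge k f -> ordge k g -> ordge k (f + g).
Proof.
by move=> [p -> hp] [q -> hq]; exists (p + q); [rewrite tofracD|exact: suppdegD].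
Qed.
Lemma ordgeM k l f g : ordge k f -> ordge l g -> ordge (k + l) (f * g).
Proof.
move=> [p -> hp] [q -> hq]; exists (p * q); first by rewrite tofracM.
by apply: suppdegM hp hq => a b; exact: leq_add.
Qed.
Lemma ordge_poly p : ordge 0 (tofrac p).
Proof. by exists p. Qed.
Lemma ordge_inf f : (forall k, ordge k f) -> f = 0.
Proof.
move=> h; have [p fp _] := h 0%N; rewrite fp.
suff -> : p = 0 by rewrite tofrac0.
apply/mpolyP => m; rewrite mcoeff0; have [q fq hq] := h (mdeg m).+1.
have -> : p = q by apply/eqP; rewrite -tofrac_eq -fp fq.
by apply: hq; rewrite ltnn.
Qed.
Lemma ordge_const p : ordge 1 (tofrac p - tofrac (p@_0)%:MP).
Proof.
exists (p - (p@_0)%:MP); first by rewrite tofracB.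
move=> m; rewrite -eqn0Ngt mdeg_eq0 => /eqP->.
by rewrite mcoeffB mcoeffC eqxx mulr1 subrr.
Qed.

(** * Derivations of C(V) and their constants *)

Hypothesis char0 : forall m, (m%:R == 0 :> C) = (m == 0)%N.

(* Comparing leading coefficients in p' q = p q' shows that p and q have the same
   leading monomial; subtracting a suitable multiple of q from p leaves 0. *)
Lemma mpoly_frac_const (p q : P) : q != 0 ->
  (forall i, p^`M(i) * q = p * q^`M(i)) -> exists c, p = c *: q.
Proof.
move=> q0 h; have lead (r : P) : r != 0 -> (forall i, r^`M(i) * q = r * q^`M(i)) ->
    mlead r = mlead q.
  move=> r0 hr; apply/mnmP => i.
  (* X_i d/dX_i is diagonal on monomials, so leading monomials can be compared exponent by
     exponent. *)
  have XE (s : P) m : ('X_i * s^`M(i))@_m = s@_m *+ m i.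
    have [mi|mi] := posnP (m i).
      rewrite mi mulr0n; apply/eqP; rewrite mcoeff_eq0; apply/negP => ms.
      have := msuppM_le ms => /allpairsP[[a b] /= [ma _ e]].
      move: ma; rewrite msuppX mem_seq1 => /eqP ea.
      by move: mi; rewrite e ea mnmDE mnm1E eqxx.
    have le : (U_(i) <= m)%MM.
      by apply/mnm_lepP => j; rewrite mnm1E; case: eqP => // <-.
    rewrite -{1}(submK le) addmC mulrC mcoeffMX mcoeff_mderiv submK // mnmBE mnm1E eqxx.
    by rewrite subn1 prednK.
  have XM (s : P) : s != 0 -> (mlead ('X_i * s^`M(i)) <= mlead s)%O.
    move=> s0; have [->|n0] := eqVneq ('X_i * s^`M(i)) 0.
      by rewrite mlead0; exact: le0x.
    apply: msupp_le_mlead; rewrite mcoeff_msupp; apply: contraTneq (mlead_supp n0) => e.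
    by rewrite mcoeff_msupp XE e mul0rn eqxx.
  have : ('X_i * (r^`M(i) * q))@_(mlead r + mlead q)%MM =
      ('X_i * (r * q^`M(i)))@_(mlead r + mlead q)%MM by rewrite hr.
  rewrite [X in X@__ = _]mulrA [X in _ = X@__]mulrCA !mleadcMW ?XM // !XE.
  rewrite mulrnAl mulrnAr -[LHS]mulr_natr -[RHS]mulr_natr => /mulfI e.
  have {e} : (mlead r i)%:R = (mlead q i)%:R :> C.
    by apply: e; rewrite mulf_neq0 ?mleadc_eq0.
  case/orP: (leq_total (mlead r i) (mlead q i)) => le /eqP.
    by rewrite eq_sym -subr_eq0 -natrB // char0 subn_eq0 => ge; apply/eqP; rewrite eqn_leq le ge.
  by rewrite -subr_eq0 -natrB // char0 subn_eq0 => ge; apply/eqP; rewrite eqn_leq le ge.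
(* With this c the coefficient of p - c q at the leading monomial of q is 0, whereas a nonzero p - c
   q satisfies the same relation and would have that leading monomial. *)
exists (p@_(mlead q) / mleadc q); apply/eqP; rewrite -subr_eq0; apply/negPn/negP => s0.
have := lead _ s0; rewrite -mul_mpolyC => hs.
have {}hs : mlead (p - (p@_(mlead q) / mleadc q)%:MP * q) = mlead q.
  by apply: hs => i; rewrite mderivB mderiv_mulC !mulrBl h; ring.
move: (mlead_supp s0); rewrite -mul_mpolyC mcoeff_msupp hs mcoeffB mcoeffCM.
by rewrite divfK ?subrr ?eqxx // mleadc_eq0.
Qed.

Lemma dpoly_bas (i : 'I_n) (p : P) : dpoly (bas i) p = p^`M(i).
Proof.
rewrite /dpoly (bigD1 i) //= big1 ?addr0 => [|j ji].
  by rewrite coord_free ?(basis_free (vbasisP _)) // eqxx scale1r.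
by rewrite coord_free ?(basis_free (vbasisP _)) // eq_sym (negPf ji) scale0r.
Qed.

Lemma drat_const (f : ratV V) : (forall xi, drat xi f = 0) -> exists c, f = tofrac c%:MP.
Proof.
have [p [q [q0 ->]]] := ratVP f => h.
have [i|c ->] := @mpoly_frac_const p q q0.
  have := h (bas i); rewrite dratE // => /eqP.
  rewrite mulf_eq0 => /orP[|]; last by rewrite invr_eq0 expf_eq0 /= tofrac_eq0 (negPf q0).
  by rewrite tofrac_eq0 !dpoly_bas subr_eq0 => /eqP.
by exists c; rewrite -mul_mpolyC tofracM mulfK // tofrac_eq0.
Qed.

Lemma drat_poly xi (p : P) : drat xi (tofrac p) = tofrac (dpoly xi p).
Proof.
have := @dratE _ _ xi p 1 (oner_neq0 _).
rewrite tofrac1 expr1n !divr1 mulr1 -mpolyC1 dpolyC mulr0 subr0; exact.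
Qed.

Lemma dratM xi (f g : ratV V) : drat xi (f * g) = drat xi f * g + f * drat xi g.
Proof.
exact: (quotient_ruleM (@tofrac_eq0 P) (@ratVP _ _) (dpolyM xi) (@dratE _ _ xi) f g).
Qed.

Lemma dratD xi (f g : ratV V) : drat xi (f + g) = drat xi f + drat xi g.
Proof.
exact: (quotient_ruleD (@tofrac_eq0 P) (@ratVP _ _) (dpolyD xi) (dpolyM xi) (@dratE _ _ xi) f g).
Qed.

Lemma dpoly_lin b xi eta (p : P) :
  dpoly (b *: xi + eta) p = b *: dpoly xi p + dpoly eta p.
Proof.
rewrite /dpoly scaler_sumr -big_split; apply: eq_bigr => i _ /=.
by rewrite linearP /= scalerDl scalerA.
Qed.

Lemma drat_lin b xi eta (f : ratV V) :
  drat (b *: xi + eta) f = tofrac b%:MP * drat xi f + drat eta f.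
Proof.
apply: (quotient_rule_lin (@tofrac_eq0 P) (@ratVP _ _) (@dratE _ _ (b *: xi + eta))
  (@dratE _ _ xi) (@dratE _ _ eta)) => p.
by rewrite dpoly_lin mul_mpolyC.
Qed.

Lemma dpoly_comm xi eta (p : P) : dpoly xi (dpoly eta p) = dpoly eta (dpoly xi p).
Proof.
elim/polyV_ind: p => [c|i|p q hp hq|p q hp hq].
- by rewrite !dpolyC.
- by rewrite !dpolyX !dpolyC.
- by rewrite !dpolyD hp hq.
- by rewrite !dpolyM !dpolyD !dpolyM hp hq; ring.
Qed.

Lemma drat_comm xi eta (f : ratV V) : drat xi (drat eta f) = drat eta (drat xi f).
Proof.
apply: (derivations_commute (@tofrac_eq0 P) (@ratVP _ _) (dratD xi) (dratM xi)
  (dratD eta) (dratM eta)) => p.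
by rewrite !drat_poly dpoly_comm.
Qed.

End PolynomialFacts.

(** * The group action and local rings in C(V) *)

Section RationalFunctions.
Variables (C : fieldType) (V : vectType C) (W : finGroupType).
Variables (rho : W -> 'End(V)) (alpha : {vspace V} -> 'Hom(V, C^o)).
Hypothesis rho1 : rho 1%g = \1%VF.
Hypothesis rhoM : forall u w, rho (u * w)%g = (rho u \o rho w)%VF.
Hypothesis rho_inj : injective rho.
Hypothesis alphaP : forall H, H \in hyperplanes rho -> lker (alpha H) = H.

Local Notation A := (hyperplanes rho).
Local Notation K := (ratV V).
Local Notation al H := (tofrac (linpoly (alpha H)) : ratV V).
Local Notation bas i := ((vbasis {:V})`_i : V).

Definition cstV : {rmorphism C -> ratV V} := (@tofrac (polyV V) \o @mpolyC _ _).

Lemma actF_is_zmod_morphism w : zmod_morphism (actF rho w).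
Proof.
have aD := actFD rho1 rhoM w; move=> f g.
have a0 : actF rho w 0 = 0 by apply: (addrI (actF rho w 0)); rewrite -aD !addr0.
have aN : actF rho w (- g) = - actF rho w g.
  by apply: (addrI (actF rho w g)); rewrite -aD !subrr.
by rewrite aD aN.
Qed.

Lemma actF_is_monoid_morphism w : monoid_morphism (actF rho w).
Proof.
split; last exact: actFM.
by rewrite -tofrac1 actFp // /actV comp_mpoly1.
Qed.

Definition actF_rmorphism (w : W) : {rmorphism K -> K} :=
  HB.pack (actF rho w)
    (GRing.isZmodMorphism.Build K K (actF rho w) (actF_is_zmod_morphism w))
    (GRing.isMonoidMorphism.Build K K (actF rho w) (actF_is_monoid_morphism w)).

Lemma actVE w p : actV rho w p = pull (rho w^-1%g) p.
Proof.
rewrite /actV /pull; congr (_ \mPo _); apply: eq_mktuple => i.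
by apply: linpoly_ext => j; rewrite comp_lfunE coordfE.
Qed.

Lemma actV_mpolyC w c : actV rho w c%:MP = c%:MP.
Proof. exact: comp_mpolyC. Qed.

Lemma actF_cstV w c : actF rho w (cstV c) = cstV c.
Proof. by rewrite /= actFp // actV_mpolyC. Qed.

Lemma drat_cstV xi c : drat xi (cstV c) = 0.
Proof. by rewrite /= drat_poly dpolyC tofrac0. Qed.

Lemma actF_drat w xi f : actF rho w (drat xi f) = drat (rho w xi) (actF rho w f).
Proof. by rewrite -(drat_conj rho1 rhoM) -(actF_mul rho1 rhoM) mulVg actF1. Qed.

Lemma al_neq0 H : H \in A -> al H != 0.
Proof. by move=> HA; rewrite tofrac_eq0 linpoly_eq0 (alpha_neq0 alphaP). Qed.

Lemma drat_al H xi : drat xi (al H) = cstV (alpha H xi).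
Proof. by rewrite drat_poly dpoly_linpoly. Qed.

Lemma actF_alpha_frac w H xi : H \in A ->
  actF rho w (cstV (alpha H xi) / al H) =
  cstV (alpha (rho w @: H)%VS (rho w xi)) / al (rho w @: H)%VS.
Proof.
move=> HA; have HA' := rho_hyperplanes rho1 rhoM w HA.
have [c c0 e] := actV_alpha rho1 rhoM alphaP w HA.
have -> : alpha H xi = c * alpha (rho w @: H)%VS (rho w xi).
  have := congr1 (fun p => evalV p (rho w xi)) e.
  rewrite evalV_actV (rhoKV rho1 rhoM) evalV_linpoly => ->.
  by rewrite /evalV mevalZ -/(evalV _ _) evalV_linpoly.
rewrite actFE //; last by rewrite linpoly_eq0 (alpha_neq0 alphaP).
rewrite actV_mpolyC e mpolyCM -mul_mpolyC !tofracM -mulf_div divff ?mul1r //.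
by rewrite tofrac_eq0 mpolyC_eq0.
Qed.

Definition isPoly (f : K) := exists p, f = tofrac p.

Section AtH.
Variable H : {vspace V}.
Hypothesis HA : H \in A.

Lemma ndivides_other H' : H' \in A -> H' != H ->
  ~ divides (linpoly (alpha H)) (linpoly (alpha H')).
Proof.
move=> HA' ne /divides_linpoly h; case/eqP: ne.
apply/eqP; rewrite eq_sym eqEdim.
have dimA (H0 : {vspace V}) : H0 \in A -> (\dim H0).+1 = \dim {:V}.
  by move=> /hyperplanesP[w /eqP rw ->].
have /eqP := etrans (dimA _ HA) (esym (dimA _ HA')); rewrite eqSS => /eqP ->.
rewrite leqnn andbT; apply/subvP => x.
by rewrite -{1}(alphaP HA) -(alphaP HA') !memv_ker => /eqP/h->.
Qed.

Lemma divides_actV_sub s p : s \in pstab rho H ->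
  divides (linpoly (alpha H)) (actV rho s p - p).
Proof.
move=> sS; have [v av] := alpha_normal alphaP HA.
have -> : actV rho s p = pull (rho s^-1%g) p by exact: actVE.
apply: (@divides_rmorph_sub _ _ (pull (rho s^-1%g)) idfun) => [c|i] /=.
  by rewrite pullC.
rewrite pullX -linpoly_coordf -linpolyB; apply: (divides_linpoly_ker av) => x ax.
have xH : x \in H by rewrite -(alphaP HA) memv_ker ax.
rewrite add_lfunE opp_lfunE comp_lfunE.
have /pstabP-> // : s^-1%g \in pstab rho H by exact: (@groupVr _ (pstab_group rho1 rhoM H)).
by rewrite subrr.
Qed.

(** With s p = p + alpha g and s q = q + alpha h, the difference of s p / s q and p / q has
    numerator alpha (g q - p h), and s q is still not divisible by alpha. *)
Lemma localring_act s f : s \in pstab rho H -> localring (alpha H) f ->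
  localring (alpha H) ((actF rho s f - f) / al H).
Proof.
move=> sS [p [q [hq ->]]]; have [v av] := alpha_normal alphaP HA.
have q0 : q != 0 by exact: ndivides_neq0 hq.
have [g eg] := divides_actV_sub p sS; have [h eh] := divides_actV_sub q sS.
have hsq : ~ divides (linpoly (alpha H)) (actV rho s q).
  move=> dv; apply: hq; rewrite -[q](subKr (actV rho s q)) subKr.
  have -> : q = actV rho s q - (actV rho s q - q) by rewrite subKr.
  by apply: dividesD => //; apply: dividesN; exists h.
exists (g * q - p * h), (actV rho s q * q); split; first by case/(linpoly_prime av).
rewrite actFE // -mulNr addf_div ?tofrac_eq0 ?actV_eq0 //.
have -> : tofrac (actV rho s p) * tofrac q + - tofrac p * tofrac (actV rho s q) =
    al H * tofrac (g * q - p * h).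
  rewrite mulNr -!tofracM -tofracB; congr tofrac.
  have -> : actV rho s p = p + linpoly (alpha H) * g by rewrite -eg subrKC.
  have -> : actV rho s q = q + linpoly (alpha H) * h by rewrite -eh subrKC.
  ring.
rewrite tofracM mulrC mulrA mulKf //; exact: al_neq0.
Qed.

Lemma localring_img w f : localring (alpha H) f ->
  localring (alpha (rho w @: H)%VS) (actF rho w f).
Proof.
move=> [p [q [hq ->]]]; have [v av] := alpha_normal alphaP HA.
exists (actV rho w p), (actV rho w q); split; last by rewrite actFE // (ndivides_neq0 hq).
have [c c0 e] := actV_alpha rho1 rhoM alphaP w HA.
move=> [g eg]; apply: hq; exists (c^-1 *: actV rho w^-1%g g).
apply: (can_inj (actVK rho1 rhoM w)); rewrite eg.
have -> : actV rho w (linpoly (alpha H) * (c^-1 *: actV rho w^-1%g g)) =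
    actV rho w (linpoly (alpha H)) * actV rho w (c^-1%:MP * actV rho w^-1%g g).
  by rewrite -rmorphM mul_mpolyC.
rewrite e [actV rho w (_ * actV _ _ _)]rmorphM /= actV_mpolyC.
rewrite -(actVM rhoM) mulgV actV1 // -[c *: _]mul_mpolyC mulrACA.
have -> : c%:MP * c^-1%:MP = 1 :> polyV V by rewrite -rmorphM mulfV // rmorph1.
by rewrite mul1r.
Qed.

End AtH.

(** The denominator is removed one hyperplane at a time: once alpha_H f is a polynomial, integrality
    of f at H makes alpha_H divide it. *)
Lemma isPoly_of_localring_seq (r : seq {vspace V}) f : {subset r <= A} ->
  isPoly ((\prod_(H <- r) al H) * f) -> (forall H, H \in A -> localring (alpha H) f) ->
  isPoly f.
Proof.
elim: r f => [|H r IH] f rA; first by rewrite big_nil mul1r.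
have HA : H \in A by apply: rA; rewrite mem_head.
have [v av] := alpha_normal alphaP HA.
rewrite big_cons -mulrA mulrCA => hp hl.
have [||p ep] := IH (al H * f) _ hp.
- by move=> x xr; apply: rA; rewrite inE xr orbT.
- move=> H' HA'; have [v' av'] := alpha_normal alphaP HA'.
  by apply: (localring_mul av'); [exact: (localring_poly av')|exact: hl].
have fE : f = tofrac p / al H by rewrite -ep mulrC mulKf //; exact: al_neq0.
have := hl H HA; rewrite fE => /(localring_div av)[g ->].
by exists g; rewrite tofracM mulrC mulKf //; exact: al_neq0.
Qed.

Lemma isPoly_of_localring m f : isPoly ((\prod_(H <- A) al H) ^+ m * f) ->
  (forall H, H \in A -> localring (alpha H) f) -> isPoly f.
Proof.
elim: m f => [|m IH] f; first by rewrite expr0 mul1r.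
rewrite exprSr -mulrA => hp hl; apply: (@isPoly_of_localring_seq A) => //.
apply: IH => // H HA; have [v av] := alpha_normal alphaP HA.
apply: (localring_mul av); last exact: hl.
rewrite big_seq; apply: (big_ind (localring (alpha H))) => [|x y|H' HA'].
- by rewrite -tofrac1; exact: (localring_poly av).
- exact: (localring_mul av).
- exact: (localring_poly av).
Qed.

Lemma degle_act d w f : degle d f -> degle d (actF rho w f).
Proof.
have ms u p : (msize (actV rho u p) <= msize p)%N by rewrite actVE; exact: msize_pull_le.
have msE p : msize (actV rho w p) = msize p.
  apply/eqP; rewrite eqn_leq ms /=.
  by rewrite -{1}[p](actVK rho1 rhoM w); exact: ms.
move=> [p [q [q0 -> h]]]; exists (actV rho w p), (actV rho w q).
by split; rewrite ?actV_eq0 ?actFE // !msE.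
Qed.

Lemma ordge_act k w f : ordge k f -> ordge k (actF rho w f).
Proof.
move=> [p -> hp]; exists (actV rho w p); first by rewrite actFp.
by rewrite actVE; exact: suppdeg_pull.
Qed.

Lemma actF_faithful w : w != 1%g -> exists2 f, isPoly f & actF rho w f != f.
Proof.
move=> w1; apply: contrapT => no; case/eqP: w1.
have h i : actV rho w 'X_i = 'X_i.
  apply/eqP; rewrite -tofrac_eq -(actFp rho1 rhoM); apply/negPn/negP => ne.
  by apply: no; exists (tofrac 'X_i) => //; exists 'X_i.
apply: invg_inj; apply: rho_inj; rewrite invg1 rho1; apply/lfunP => x; rewrite lfunE /=.
apply: (can_inj (@passmx.rVofK _ _ _ (vbasisP _))); apply/rowP => i; rewrite !mxE.
have := h i; rewrite actVE pullX -linpoly_coordf => /linpoly_inj/lfunP/(_ x).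
by rewrite comp_lfunE !coordfE.
Qed.

End RationalFunctions.

(** * Noetherianity of polynomial modules *)

Section Noetherian.

Definition seq_le (s t : seq nat) := all2 leq s t.

Lemma seq_le_trans s t u : seq_le s t -> seq_le t u -> seq_le s u.
Proof.
elim: s t u => [|a s IH] [|b t] [|c u] //= /andP[ab st] /andP[bc tu].
by rewrite (leq_trans ab bc) (IH _ _ st tu).
Qed.

(** Dickson's lemma, by induction on the length. Finitely many tails b in B dominate all tails, each
    occurring with some head [j b]; a head above the maximum m of these is covered by B, and each
    head i <= m has its own finite set [D i] of tails. *)
Lemma dickson n (S : seq nat -> Prop) : (forall s, S s -> size s = n) ->
  exists B : seq (seq nat), (forall b, b \in B -> S b) /\
    forall s, S s -> exists2 b, b \in B & seq_le b s.
Proof.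
elim: n S => [|n IH] S Sn.
  have [S0|nS0] := pselect (S [::]).
    exists [:: [::]]; split=> [b|s /Sn /size0nil ->]; last by exists [::].
    by rewrite mem_seq1 => /eqP->.
  by exists [::]; split=> // s Ss; case: nS0; rewrite -(size0nil (Sn _ Ss)).
have [|B [BS Bmin]] := IH (fun t => exists j, S (j :: t)).
  by move=> t [j /Sn [->]].
have /boolp.choice[j hj] : forall b, exists j : nat, b \in B -> S (j :: b).
  move=> b; have [/BS[j Sj]|_] := boolP (b \in B); first by exists j.
  by exists 0%N.
pose m := \max_(b <- B) j b.
have /boolp.choice[D hD] : forall i, exists D : seq (seq nat),
    (forall b, b \in D -> S (i :: b)) /\
    forall s, S (i :: s) -> exists2 b, b \in D & seq_le b s.
  by move=> i; apply: IH => t /Sn [->].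
exists [seq i :: b | i <- iota 0 m.+1, b <- D i]; split.
  by move=> b /allpairsPdep[i [c [_ ci ->]]]; have [h _] := hD i; exact: h.
have cover i t : (i <= m)%N -> S (i :: t) -> forall l u, (i <= l)%N -> seq_le t u ->
    exists2 b, b \in [seq i :: b | i <- iota 0 m.+1, b <- D i] & seq_le b (l :: u).
  move=> im Sit l u il tu; have [_ h] := hD i; have [b bD bt] := h t Sit.
  exists (i :: b); last by rewrite /seq_le /= il; exact: seq_le_trans bt tu.
  by apply/allpairsPdep; exists i, b; rewrite mem_iota.
move=> [|i t] St; first by move: (Sn _ St).
have [im|mi] := leqP i m; first by apply: cover im St _ _ _ _ => //; elim: (t) => //= a u ->; rewrite leqnn.
have [b bB bt] := Bmin t (ex_intro _ i St).
have jm : (j b <= m)%N by exact: leq_bigmax_seq.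
by apply: (cover (j b) b) => //; [exact: hj|exact: leq_trans jm (ltnW mi)].
Qed.

(** The span as the intersection of all submodules containing L, so that induction over it is plain
    application; [generated_combination] recovers coefficients. *)
Definition generated (R : pzRingType) (M : lmodType R) (L : seq M) (x : M) :=
  forall Z : M -> Prop, Z 0 -> (forall y z, Z y -> Z z -> Z (y + z)) ->
    (forall a y, Z y -> Z (a *: y)) -> (forall y, y \in L -> Z y) -> Z x.

Definition submod (R : pzRingType) (M : lmodType R) (N : M -> Prop) :=
  [/\ N 0, forall y z, N y -> N z -> N (y + z) & forall a y, N y -> N (a *: y)].

Definition fingen (R : pzRingType) (M : lmodType R) (N : M -> Prop) :=
  exists L : seq M, (forall y, y \in L -> N y) /\ forall x, N x -> generated L x.

Variables (C : fieldType) (n : nat).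
Local Notation P := {mpoly C[n]}.

(** By [dickson] finitely many leading monomials of J divide all others. Elements of J having them
    generate J: subtracting a multiple of one lowers the leading monomial, and the monomial order is
    well-founded. *)
Lemma ideal_fingen (J : P^o -> Prop) : submod J -> fingen J.
Proof.
move=> [J0 JD JZ].
pose toseq (m : 'X_{1..n}) : seq nat := m.
have [|B [BS Bmin]] := @dickson n
    (fun s => exists p, [/\ J p, p != 0 & s = toseq (mlead p)]).
  by move=> s [p [_ _ ->]]; rewrite size_tuple.
have /boolp.choice[g hg] : forall b, exists g : P, b \in B ->
    [/\ J g, g != 0 & b = toseq (mlead g)].
  move=> b; have [/BS[p hp]|_] := boolP (b \in B); first by exists p.
  by exists 0.
exists [seq g b | b <- B]; split.
  by move=> y /mapP[b /hg[? _ _] ->].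
move=> p Jp Z Z0 ZD ZZ ZL; move: p Jp.
elim/mleadrect => p IH Jp.
have [->//|p0] := eqVneq p 0.
have [b bB ble] := Bmin _ (ex_intro _ p (And3 Jp p0 erefl)).
have [Jb b0 eb] := hg b bB.
have le : (mlead (g b) <= mlead p)%MM.
  have : seq_le (toseq (mlead (g b))) (toseq (mlead p)) by rewrite -eb.
  move=> {}ble; apply/mnm_lepP => i; move: ble; rewrite /seq_le all2E !size_tuple eqxx /=.
  move=> /(all_nthP (0%N, 0%N)) /(_ i); rewrite size_zip !size_tuple minnn => /(_ (ltn_ord i)).
  by rewrite nth_zip ?size_tuple //= !mnm_tnth !(tnth_nth 0%N).
pose c := mleadc p / mleadc (g b).
pose h : P := c *: 'X_[mlead p - mlead (g b)].
have Jq : J (p - h * g b).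
  by rewrite -mulNr; apply: JD => //; exact: JZ.
have Zq : Z (h * g b) by apply: (ZZ h); apply: ZL; exact: map_f.
have cp : (h * g b)@_(mlead p) = mleadc p.
  have e : (g b * 'X_[mlead p - mlead (g b)])@_(mlead p) = mleadc (g b).
    by rewrite -[in X in _@_X](submK le) mcoeffMX.
  by rewrite -scalerAl mcoeffZ mulrC [_ * g b]mulrC e /c mulrC divfK // mleadc_eq0.
have -> : p = (p - h * g b) + h * g b by rewrite subrK.
apply: ZD => //; have [->//|q0] := eqVneq (p - h * g b) 0.
apply: IH => //; rewrite lt_neqAle; apply/andP; split.
  apply: contraNneq q0 => e; rewrite -mleadc_eq0 e mcoeffB cp.
  by rewrite subrr.
apply: le_trans (mleadB_le _ _) _; rewrite leUx lexx /=.
apply: le_trans (mleadM_le _ _) _.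
have : (mlead h <= (mlead p - mlead (g b))%MM)%O.
  by apply: le_trans (mleadZ_le _ _) _; rewrite mleadXm.
by move=> hle; rewrite -[X in (_ <= X)%O](submK le); exact: lem_add hle (lexx _).
Qed.

(** Induction on the coordinates that may be nonzero: lifts of generators of the ideal of values at
    x, together with generators of the submodule vanishing at x. *)
Lemma module_fingen (I : finType) (N : {ffun I -> P^o} -> Prop) : submod N -> fingen N.
Proof.
have main (s : seq I) (M : {ffun I -> P^o} -> Prop) : submod M ->
    (forall phi, M phi -> forall x, x \notin s -> phi x = 0) -> fingen M.
  elim: s M => [|x s IH] M [M0 MD MZ] Ms.
    exists [::]; split=> // phi /Ms h Z Z0 _ _ _.
    by have -> : phi = 0 by apply/ffunP => x; rewrite ffunE h.
  have [|G [GJ Ggen]] := @ideal_fingen (fun p => exists2 phi, M phi & phi x = p).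
    split=> [|_ _ [phi hp <-] [psi hq <-]|a _ [phi hp <-]].
    - by exists 0 => //; rewrite ffunE.
    - by exists (phi + psi); [exact: MD|rewrite ffunE].
    - by exists (a *: phi); [exact: MZ|rewrite ffunE].
  have [|phi Mphi|L [LM Lgen]] := IH (fun phi => M phi /\ phi x = 0).
  - split=> [|y z [My y0] [Mz z0]|a y [My y0]].
    + by split=> //; rewrite ffunE.
    + by split; [exact: MD|rewrite ffunE y0 z0 addr0].
    + by split; [exact: MZ|rewrite ffunE y0 scaler0].
  - move=> y ys; case: Mphi => Mp p0; have [->//|yx] := eqVneq y x.
    by apply: Ms => //; rewrite inE negb_or yx.
  have /boolp.choice[l hl] : forall p : P^o, exists phi : {ffun I -> P^o},
      p \in G -> M phi /\ phi x = p.
    move=> p; have [/GJ[phi Mp px]|_] := boolP (p \in G); first by exists phi.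
    by exists 0.
  exists ([seq l p | p <- G] ++ L); split.
    move=> y; rewrite mem_cat => /orP[/mapP[p /hl[Mp _] ->//]|/LM[]//].
  move=> phi Mphi Z Z0 ZD ZZ ZL.
  have [psi [Mpsi Zpsi px]] : exists psi, [/\ M psi, Z psi & psi x = phi x].
    apply: (Ggen (phi x) (ex_intro2 _ _ phi Mphi erefl)
      (fun p => exists psi, [/\ M psi, Z psi & psi x = p])).
    - by exists 0; rewrite ffunE.
    - move=> _ _ [y [My Zy <-]] [z [Mz Zz <-]]; exists (y + z).
      by split; [exact: MD|exact: ZD|rewrite ffunE].
    - move=> a _ [y [My Zy <-]]; exists (a *: y).
      by split; [exact: MZ|exact: ZZ|rewrite ffunE].
    - move=> p pG; have [Mp lp] := hl p pG; exists (l p); split=> //.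
      by apply: ZL; rewrite mem_cat map_f.
  have -> : phi = (phi - psi) + psi by rewrite subrK.
  apply: (ZD) => //; apply: Lgen => //; last by move=> y yL; apply: ZL; rewrite mem_cat yL orbT.
  split; last by rewrite !ffunE px subrr.
  by apply: MD => //; rewrite -scaleN1r; exact: MZ.
by move=> hN; apply: (main (enum I)) => // phi _ x; rewrite mem_enum.
Qed.

Lemma generated_combination (M : lmodType P) (L : seq M) x : generated L x ->
  exists c : 'I_(size L) -> P, x = \sum_i c i *: L`_i.
Proof.
move/(_ (fun x => exists c : 'I_(size L) -> P, x = \sum_i c i *: L`_i)).
apply=> [|y z [c ->] [d ->]|a y [c ->]|y yL].
- by exists (fun=> 0); rewrite big1 // => i _; rewrite scale0r.
- by exists (fun i => c i + d i); rewrite -big_split; apply: eq_bigr => i _; rewrite scalerDl.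
- by exists (fun i => a * c i); rewrite scaler_sumr; apply: eq_bigr => i _; rewrite scalerA.
have lt : (index y L < size L)%N by rewrite index_mem.
exists (fun i => (i == Ordinal lt)%:R); rewrite (bigD1 (Ordinal lt)) //= eqxx scale1r.
rewrite nth_index // big1 ?addr0 // => i ne; by rewrite (negPf ne) scale0r.
Qed.

End Noetherian.

(** * Realization in C(V) *)

Section Realization.
Variables (C : fieldType) (V : vectType C) (W : finGroupType).
Variables (rho : W -> 'End(V)) (alpha : {vspace V} -> 'Hom(V, C^o)).
Hypothesis char0 : forall n, (n%:R == 0 :> C) = (n == 0)%N.
Hypothesis rho1 : rho 1%g = \1%VF.
Hypothesis rhoM : forall u w, rho (u * w)%g = (rho u \o rho w)%VF.
Hypothesis rho_inj : injective rho.
Hypothesis alphaP : forall H, H \in hyperplanes rho -> lker (alpha H) = H.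
Variable k : {vspace V} -> nat -> nat.
Hypothesis k_inv : forall w H i, H \in hyperplanes rho -> (i < ordH rho H)%N ->
  k (rho w @: H)%VS i = k H i.

Local Notation A := (hyperplanes rho).
Local Notation K := (ratV V).
Local Notation E := (Efun W K).
Local Notation cst := (cstV V).
Local Notation act := (actF_rmorphism rho1 rhoM).
Local Notation al := (fun H => tofrac (linpoly (alpha H)) : ratV V).
Local Notation loc := (fun H => localring (alpha H)).
Local Notation Pol := (@isPoly C V).

Definition Qk : E -> Prop := quasiE rho k cst al loc Pol.

Local Notation symm := (symE act).
Local Notation qinv := (quasi_inv rho k cst act al Pol).
Local Notation dsub := (dunkl_submodule rho alpha k cst act (@drat C V) al Pol).

Lemma realization :
  [/\ dsub Qk, forall phi, Qk phi -> polE Pol phi,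
      forall phi, Qk phi ->
        qinv (symm phi 1%g) /\ symm phi = symm (symm phi 1%g *: basisE K 1%g),
      forall f, qinv f -> Qk (symm (f *: basisE K 1%g)) &
      forall M M', dsub M -> dsub M' ->
        (exists N, forall phi, M phi -> polE Pol (arrpoly rho al ^+ N *: phi)) ->
        (forall phi, M phi -> M' (symm phi)) -> forall phi, M phi -> M' phi].
Proof.
have nrm H : H \in A -> exists v, alpha H v = 1 by exact: (alpha_normal alphaP).
apply: (@quasi_invariant_submodule C V W rho alpha char0 rho1 rhoM rho_inj alphaP k k_inv
  K cst act (@drat C V) al _ _ _ _ _ _ _ _ _ _ _ loc _ _ _ _ _ _ _ _ Pol _ _ _ _ _ _ _ _
  (@degle C V) _ _ _ _ _ _ _ _ _ _ _ (fun i => tofrac 'X_i) _ _ _ (@ordge C V)).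
- exact: (actF1 rho1).
- exact: (actF_mul rho1 rhoM).
- exact: (actF_cstV rho1 rhoM).
- exact: dratD.
- exact: dratM.
- exact: drat_cstV.
- exact: drat_lin.
- exact: (actF_drat rho1 rhoM).
- exact: (al_neq0 alphaP).
- by move=> H xi _; exact: drat_al.
- exact: (actF_alpha_frac rho1 rhoM alphaP).
- by move=> H c /nrm[v av]; exact: (localring_poly av).
- by move=> H f g /nrm[v av]; exact: (localring_add av).
- by move=> H f g /nrm[v av]; exact: (localring_mul av).
- by move=> H xi f /nrm[v av]; exact: (localring_der av).
- by move=> H H' /nrm[v av] _; exact: (localring_poly av).
- by move=> H H' HA HA' ne; apply: localring_inv; exact: (ndivides_other alphaP).
- by move=> H s f HA; exact: (localring_act rho1 rhoM alphaP HA).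
- exact: drat_comm.
- by move=> c; exists c%:MP.
- by move=> _ _ [p ->] [q ->]; exists (p + q); rewrite tofracD.
- by move=> _ _ [p ->] [q ->]; exists (p * q); rewrite tofracM.
- by move=> xi _ [p ->]; exists (dpoly xi p); rewrite drat_poly.
- by move=> w _ [p ->]; exists (actV rho w p); rewrite /= actFp.
- by move=> H _; exists (linpoly (alpha H)).
- by move=> H _ /nrm[v av] [p ->]; exact: (localring_poly av).
- exact: (isPoly_of_localring alphaP).
- move=> c; apply: degle_poly; rewrite mmeasureC; by case: (c != 0).
- exact: degle_0.
- exact: degle_add.
- exact: degle_mul.
- exact: degle_der.
- exact: (degle_act rho1 rhoM).
- exact: degle_le.
- by move=> _ [p ->]; exists (msize p); apply: degle_poly; move: (msize p) => i; clear; lia.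
- by move=> d _ d0 [p ->] /(degle_neg d0)->; rewrite tofrac0.
- by move=> H _; apply: degle_poly; move: (msize_linpoly_le (alpha H)); move: (msize _) => i; clear; lia.
- move=> H HA; apply: degle_polyV.
    by rewrite linpoly_eq0 (alpha_neq0 alphaP HA).
  by move: (msize_linpoly_gt1 (alpha_neq0 alphaP HA)); move: (msize _) => i; clear; lia.
- by move=> i; exists 'X_i.
- move=> i j; rewrite drat_poly dpolyX coord_free ?(basis_free (vbasisP _)) //.
  by rewrite eq_sym; case: eqP => _; rewrite ?mpolyC1 ?mpolyC0 ?tofrac1 ?tofrac0.
- exact: (drat_const char0).
- exact: ordge0.
- exact: ordgeD.
- exact: ordgeM.
- exact: (ordge_act rho1 rhoM).
- by move=> _ [p ->]; exact: ordge_poly.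
- exact: ordge_inf.
- by move=> _ [p ->]; exists (p@_0); exact: ordge_const.
- exact: (actF_faithful rho1 rhoM rho_inj).
- by move=> w H f HA; exact: (localring_img rho1 rhoM alphaP HA).
Qed.

(** * The Cherednik algebra acting on tuples *)

Local Notation S := {ffun W -> ratV V}.
Local Notation T := (dunklE rho alpha k cst act al (derE (@drat C V))).

Lemma dact_cpoly p (phi : E) : dact rho (@cpoly C V W p) phi = tofrac p *: phi.
Proof.
apply/ffunP => u; rewrite !ffunE (bigD1 1%g) //= big1 => [|w w1].
  by rewrite addr0 /cpoly /cop eqxx invg1 mul1g (actF1 rho1).
by rewrite /cpoly /cop (negPf w1).
Qed.

Lemma dact_cgrp a (phi : E) : dact rho (cgrp a) phi = \sum_w cst (a w) *: wact act w phi.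
Proof.
apply/ffunP => u; rewrite ffunE sum_ffunE; apply: eq_bigr => w _.
by rewrite !ffunE.
Qed.

(** The factor n_H of the Dunkl operator cancels the 1 / n_H in e_(H,i), which is why [refl_coef]
    contains neither. *)
Lemma refl_coef_idemH H (w : W) (f : K) : w \in pstab rho H ->
  \sum_(i < ordH rho H) cgrp (idemH rho H i) w f *+ (ordH rho H * k H i) =
  cst (refl_coef rho k H w) * f.
Proof.
move=> wS; rewrite rmorph_sum mulr_suml; apply: eq_bigr => i _.
rewrite /cgrp ffunE wS -mulrnAl; congr (_ * _).
rewrite -[LHS]/(cst _ *+ _) -raddfMn /=; congr (tofrac _%:MP).
have n0 : (ordH rho H)%:R != 0 :> C by rewrite char0 -lt0n ordH_gt0.
rewrite -exprnN mulrnA -mulrnAl -(mulr_natr _^-1) mulVf //.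
by rewrite -mulrnAl.
Qed.

Lemma dact_dunkl xi (phi : E) : dact rho (dunkl rho alpha k xi) phi = T xi phi.
Proof.
apply/ffunP => u; rewrite ffunE /dunkl sumrB [RHS]ffunE; congr (_ + _).
  rewrite (bigD1 1%g) //= big1 => [|w w1]; last by rewrite /cop (negPf w1).
  by rewrite addr0 /cop eqxx invg1 mul1g (actF1 rho1) // [RHS]ffunE.
rewrite [RHS]ffunE; congr (- _); rewrite exchange_big sum_ffunE /=.
apply: eq_bigr => H _; rewrite -mulr_sumr ffunE; congr (_ * _).
rewrite sum_ffunE [RHS]big_mkcond /=; apply: eq_bigr => w _.
case: ifP => wS; first by rewrite refl_coef_idemH // !ffunE.
by rewrite big1 // => i _; rewrite /cgrp ffunE wS mpolyC0 tofrac0 mul0r mul0rn.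
Qed.

Lemma dact_cadd a b (phi : E) :
  dact rho (cadd a b) phi = (dact rho a phi + dact rho b phi : E).
Proof. by apply/ffunP => u; rewrite !ffunE -big_split. Qed.

Lemma div_exp_eq (F : fieldType) (f p d : F) m : d != 0 ->
  (f = p / d ^+ m <-> d ^+ m * f = p).
Proof.
move=> /(expf_neq0 m); move: (d ^+ m) => {}d d0.
by split=> [->|<-]; [rewrite mulrC divfK|rewrite mulrC mulKf].
Qed.

Lemma regV_Reg f : regV rho alpha f <-> Reg rho al Pol f.
Proof.
have dE : tofrac (\prod_(H <- A) linpoly (alpha H)) = arrpoly rho al.
  by rewrite /arrpoly rmorph_prod.
have d0 : arrpoly rho al != 0 by apply: arrpoly_neq0; exact: (al_neq0 alphaP).
split=> [[p [m e]]|[m [p e]]].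
  by exists m, p; apply/(div_exp_eq f _ _ d0); rewrite e dE.
by exists p, m; rewrite dE; apply/(div_exp_eq f _ _ d0).
Qed.

Lemma regW_regE (phi : E) : regW rho alpha phi <-> regE rho al Pol phi.
Proof. by split=> h u; apply/regV_Reg. Qed.

Lemma dsub_submodule (M : E -> Prop) : dsub M -> (forall phi, M phi -> regE rho al Pol phi) ->
  is_submodule rho alpha k M.
Proof.
move=> [M0 MD MZ MW MT] Mreg; split=> [phi /Mreg/regW_regE//|//|//|a phi ca].
have Msum (F : W -> E) : (forall w, M (F w)) -> M (\sum_w F w).
  by move=> h; apply: (big_ind M).
elim: ca phi => {a} [p|a|xi|a b _ ha _ hb|a b ca ha _ hb] phi Mphi.
- by rewrite dact_cpoly; apply: MZ => //; exists p.
- rewrite dact_cgrp; apply: Msum => w; apply: MZ; last exact: MW.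
  by exists (a w)%:MP.
- by rewrite dact_dunkl; exact: MT.
- by rewrite dact_cadd; apply: MD; [exact: ha|exact: hb].
rewrite (dactM rho1 rhoM (alpha := alpha)) //; first by apply: ha; exact: hb.
exact: (cherednik_DW rho1 rhoM alphaP ca).
Qed.

Lemma submodule_dsub (M : set S) : is_submodule rho alpha k M -> dsub M.
Proof.
move=> [Mreg M0 MD Ma]; split=> //.
- move=> _ phi [p ->] Mphi; rewrite -dact_cpoly; apply: Ma => //.
  exact: cherednik_poly.
- move=> w phi Mphi.
  have -> : wact act w phi = dact rho (cgrp [ffun x => (x == w)%:R]) phi.
    rewrite dact_cgrp (bigD1 w) //= big1 => [|x xw].
      by rewrite ffunE eqxx rmorph1 scale1r addr0.
    by rewrite ffunE (negPf xw) rmorph0 scale0r.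
  by apply: Ma => //; exact: cherednik_grp.
- move=> xi phi Mphi; rewrite -dact_dunkl; apply: Ma => //.
  exact: cherednik_dunkl.
Qed.

(** Finitely many generators have a common denominator, and polynomial combinations keep it. *)
Lemma fin_gen_bound (M : set S) : is_submodule rho alpha k M -> fin_gen rho M ->
  exists N, forall phi : E, M phi -> polE Pol (arrpoly rho al ^+ N *: phi).
Proof.
move=> [Mreg _ _ _] [m [q [Mq gen]]].
have PolD f g : Pol f -> Pol g -> Pol (f + g).
  by move=> [p ->] [r ->]; exists (p + r); rewrite tofracD.
have PolM f g : Pol f -> Pol g -> Pol (f * g).
  by move=> [p ->] [r ->]; exists (p * r); rewrite tofracM.
have Polc c : Pol (cst c) by exists c%:MP.
have Polal H : H \in A -> Pol (al H) by exists (linpoly (alpha H)).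
have Pold N : Pol (arrpoly rho al ^+ N).
  apply: (Pol_exp (cst := cst)) => //; exact: (Pol_arrpoly (cst := cst)).
have /boolp.choice[N hN] : forall i, exists N, polE Pol (arrpoly rho al ^+ N *: (q i : E)).
  move=> i; apply: (regE_bound (cst := cst)) => //.
  exact/regW_regE/Mreg/Mq.
exists (\max_i N i) => phi /gen[c ->].
have -> : (\sum_(i < m) dact rho (@cpoly C V W (c i)) (q i) : E) =
    \sum_(i < m) tofrac (c i) *: (q i : E).
  by apply: eq_bigr => i _; exact: dact_cpoly.
rewrite scaler_sumr; apply: (big_ind (polE Pol)) => [u|x y hx hy u|i _ u].
- by rewrite ffunE -tofrac0; exists 0.
- by rewrite ffunE; exact: PolD.
rewrite scalerA mulrC -scalerA ffunE; apply: (PolM); first by exists (c i).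
have le : (N i <= \max_i N i)%N by exact: leq_bigmax.
have := hN i u; rewrite !ffunE -(subnK le) exprD => h.
by rewrite -[_ *: _]/(_ * _) -mulrA; apply: (PolM).
Qed.

(** With polynomial coefficients, M is the image of a C[V]-submodule of a free module of finite
    rank, where [module_fingen] applies. *)
Lemma polE_submodule_fin_gen (M : set S) : is_submodule rho alpha k M ->
  (forall phi : E, M phi -> polE Pol phi) -> fin_gen rho M.
Proof.
move=> Msub Mpol; have [M0 MD MZ _ _] := submodule_dsub Msub.
pose emb (phi : {ffun W -> (polyV V)^o}) : E := [ffun u => tofrac (phi u)].
have embD x y : emb (x + y) = emb x + emb y.
  by apply/ffunP => u; rewrite !ffunE tofracD.
have embZ a x : emb (a *: x) = tofrac a *: emb x.
  by apply/ffunP => u; rewrite !ffunE tofracM.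
have emb0 : emb 0 = 0 by apply/ffunP => u; rewrite !ffunE tofrac0.
have [|L [LM Lgen]] := @module_fingen C _ W (fun phi => M (emb phi)).
  split=> [|y z hy hz|a y hy]; first by rewrite emb0.
    by rewrite embD; exact: MD.
  by rewrite embZ; apply: MZ => //; exists a.
exists (size L), (fun i : 'I_(size L) => emb L`_i); split.
  by move=> i; apply: LM; exact: mem_nth.
move=> phi Mphi; have /boolp.choice[f hf] := Mpol phi Mphi.
have phiE : phi = emb [ffun u => f u] by apply/ffunP => u; rewrite !ffunE.
have [|c ec] := @generated_combination C _ _ L [ffun u => f u].
  by apply: Lgen; rewrite -phiE.
exists c; rewrite phiE ec (big_morph emb embD emb0).
by apply: eq_bigr => i _; rewrite embZ; apply/esym; exact: dact_cpoly.
Qed.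

(** * The idempotent e and the conclusion *)

Lemma dact_idemW (phi : E) : dact rho (cgrp (idemW C W)) phi = cst #|W|%:R^-1 *: symm phi.
Proof.
by rewrite dact_cgrp scaler_sumr; apply: eq_bigr => w _; rewrite ffunE.
Qed.

Lemma tens_basisE f : tens f 1%g = (f *: basisE K 1%g : E).
Proof.
apply/ffunP => u; rewrite !ffunE; case: eqP => _; first exact/esym/mulr1.
exact/esym/mulr0.
Qed.

Lemma gactV_idemH H i (f : polyV V) :
  tofrac (gactV rho (idemH rho H (- i%:Z)) f) =
  cst (ordH rho H)%:R^-1 *
    \sum_(s in pstab rho H) cst (detV rho s ^+ i) * act s (tofrac f).
Proof.
rewrite /gactV rmorph_sum mulr_sumr [RHS]big_mkcond /=; apply: eq_bigr => w _.
rewrite ffunE; case: ifP => wS; last by rewrite scale0r tofrac0.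
by rewrite opprK -exprnP -mul_mpolyC mpolyCM !tofracM mulrA /= actFp.
Qed.

Lemma quasi_invariant_qinv f : quasi_invariant rho alpha k f <-> qinv (tofrac f).
Proof.
have gE H i g : (gactV rho (idemH rho H (- i%:Z)) f = linpoly (alpha H) ^+ (ordH rho H * k H i) * g)
   <-> cst (ordH rho H)%:R^-1 * \sum_(s in pstab rho H) cst (detV rho s ^+ i) * act s (tofrac f)
     = al H ^+ quasi_order rho k H i * tofrac g.
  rewrite -gactV_idemH -tofracXn -tofracM; split=> [->//|/eqP].
  by rewrite tofrac_eq => /eqP.
split=> [h|[_ h] H HA i lti].
  split=> [|H HA i lti]; first by exists f.
  by have [g /gE e] := h H HA i lti; exists (tofrac g) => //; exists g.
by have [_ [g ->] /gE e] := h H HA i lti; exists g.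
Qed.

Theorem quasi_invariant_module_unique :
  exists! Q : set S,
    [/\ is_submodule rho alpha k Q,
        fin_gen rho Q &
        [set dact rho (cgrp (idemW C W)) phi | phi in Q]%classic =
        [set dact rho (cgrp (idemW C W)) (tens (tofrac f) 1%g)
           | f in quasi_invariant rho alpha k]%classic].
Proof.
have [Qsub Qpol Qinv invQ uniq] := realization.
have W0 : #|W|%:R != 0 :> C by rewrite char0 -lt0n (cardD1 1%g).
(* Idempotency of e, in terms of [symE], which is |W| e. *)
have symsym (phi : E) : symm (cst #|W|%:R^-1 *: symm phi) = symm phi.
  rewrite {1}/symE (eq_bigr (fun=> cst #|W|%:R^-1 *: symm phi)) => [|w _].
    rewrite sumr_const scalerMnl -[cst _ *+ _]raddfMn -(mulr_natr _^-1).
    by rewrite mulVf // [X in X *: _](rmorph1 cst) scale1r.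
  have act_cst : act w (cst #|W|%:R^-1) = cst #|W|%:R^-1 by exact: (actF_cstV rho1 rhoM).
  rewrite wactZ act_cst wact_symE //; exact: (actF_mul rho1 rhoM).
have [Q0 QD QZ QW QT] := Qsub.
have PolC c : Pol (cst c) by exists c%:MP.
have Qmod : is_submodule rho alpha k Qk.
  apply: dsub_submodule => // phi [].
  by [].
have sym_eq (M : set S) : [set dact rho (cgrp (idemW C W)) phi | phi in M]%classic =
    [set dact rho (cgrp (idemW C W)) (tens (tofrac f) 1%g)
       | f in quasi_invariant rho alpha k]%classic ->
    (forall phi : E, M phi -> Qk (symm phi)) /\
    (forall f, qinv (tofrac f) -> exists2 phi : E, M phi & symm phi = symm (tofrac f *: basisE K 1%g)).
  move=> e; have cancel_idem (phi psi : E) : dact rho (cgrp (idemW C W)) phi =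
      dact rho (cgrp (idemW C W)) psi -> symm phi = symm psi.
    have c0 : cst #|W|%:R^-1 != 0 by rewrite fmorph_eq0 invr_eq0.
    move=> e'; apply/ffunP => u; apply: (mulfI c0).
    have dE (chi : E) : cst #|W|%:R^-1 * symm chi u = dact rho (cgrp (idemW C W)) chi u.
      by rewrite dact_idemW ffunE.
    by rewrite !dE e'.
  split=> [phi Mphi|f /quasi_invariant_qinv qf].
    have : [set dact rho (cgrp (idemW C W)) phi | phi in M]%classic
       (dact rho (cgrp (idemW C W)) phi) by exists phi.
    rewrite e => -[f /quasi_invariant_qinv qf].
    by rewrite tens_basisE => /cancel_idem <-; exact: invQ.
  have : [set dact rho (cgrp (idemW C W)) (tens (tofrac f) 1%g)
       | f in quasi_invariant rho alpha k]%classic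
     (dact rho (cgrp (idemW C W)) (tens (tofrac f) 1%g)) by exists f.
  rewrite -e => -[phi Mphi]; rewrite tens_basisE => /cancel_idem <-.
  by exists phi.
exists Qk; split.
  split=> //; first exact: polE_submodule_fin_gen.
  apply/seteqP; split=> [_ [phi Qphi <-]|_ [f /quasi_invariant_qinv qf <-]].
    have [qs se] := Qinv phi Qphi; have [[p ep] _] := qs.
    exists p; first by apply/quasi_invariant_qinv; rewrite -ep.
    by rewrite tens_basisE !dact_idemW -ep -se.
  exists (cst #|W|%:R^-1 *: symm (tofrac f *: basisE K 1%g)).
    by apply: QZ; [exact: PolC|exact: invQ].
  by rewrite tens_basisE !dact_idemW symsym.
move=> M [Msub Mfg Me]; have [MQ QM] := sym_eq M Me.
have Mdsub := submodule_dsub Msub.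
have Mbound := fin_gen_bound Msub Mfg.
(* [uniq] is used in both directions: [Qk] has no poles, M has bounded ones by finite generation,
   and each contains the symmetrizations of the other. *)
apply/seteqP; split=> phi.
  apply: uniq => //.
    by exists 0%N => psi /Qpol; rewrite expr0 scale1r.
  move=> psi Qpsi; have [qs se] := Qinv psi Qpsi; have [[p ep] _] := qs.
  have [|psi' Mpsi' e] := QM p; first by rewrite -ep.
  rewrite se ep -e; have [M0 MD _ MW _] := Mdsub.
  by apply: (big_ind (M : E -> Prop)) => [||w _]; [exact: M0|exact: MD|exact: MW].
by apply: uniq.
Qed.

End Realization.

Local Open Scope classical_set_scope.

Theorem theorem3p4 (R : realType) (V : vectType R[i]) (W : finGroupType)
    (rho : W -> 'End(V))
    (rho1 : rho 1%g = \1%VF)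
    (rhoM : forall u w, rho (u * w)%g = (rho u \o rho w)%VF)
    (rho_inj : injective rho)
    (W_gen : <<[set w | is_reflection rho w]%SET>>%g = [set: W]%SET)
    (alpha : {vspace V} -> 'Hom(V, R[i]^o))
    (alphaP : forall H, H \in hyperplanes rho -> lker (alpha H) = H)
    (k : {vspace V} -> nat -> nat)
    (k_inv : forall w H i, H \in hyperplanes rho -> (i < ordH rho H)%N ->
       k (rho w @: H)%VS i = k H i)
    (k_0 : forall H, H \in hyperplanes rho -> k H 0%N = 0%N) :
  exists! Q : set {ffun W -> ratV V},
    [/\ is_submodule rho alpha k Q,
        fin_gen rho Q &
        [set dact rho (cgrp (idemW R[i] W)) phi | phi in Q] =
        [set dact rho (cgrp (idemW R[i] W)) (tens (tofrac f) 1%g)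
           | f in quasi_invariant rho alpha k]].
Proof.
apply: quasi_invariant_module_unique => // n.
exact: pnatr_eq0.
Qed.
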